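(* Let $G\subset\mathbb{C}$ be a bounded simply connected domain, let $D$ be the open unit disk, and let $\varphi:G\to D$ be the Riemann map of $G$. Then $\varphi$ extends continuously to $\overline{G}$ if and only if $\partial_m G=\emptyset$, i.e. if and only if $\partial G$ contains no multiple points of $G$.
   Context: A simply connected domain is a connected open set $G\subset\mathbb{C}$ such that $(\mathbb{C}\cup\{\infty\})\setminus G$ is connected. The Riemann map of $G$ is an injective analytic function $\varphi$ from $G$ onto the open unit disk $D$. A Jordan arc is the image of an injective continuous function on a closed interval $[a,b]$. A crosscut of $G$ is a Jordan arc whose interior (the arc without its two endpoints) is contained in $G$ and whose endpoints are in $\partial G$. For sets $A,B\subset\mathbb{C}$, $\mathrm{dist}(A,B)=\inf\{|a-b|:a\in A,\,b\in B\}$. A point $\lambda\in\partial G$ is called a multiple point of $G$ if for each $i=1,2$ there are a crosscut $\gamma_i$ of $G$ and a connected component $V_i$ of $G\setminus\gamma_i$ such that $V_1\cap V_2=\emptyset$, $\lambda\in\partial V_1\cap\partial V_2$, and $\mathrm{dist}(\gamma_1,\gamma_2)>0$. The set of multiple points of $G$ is denoted $\partial_m G$. *)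

(* Defs.v *)
From HB Require Import structures.
From mathcomp Require Import all_boot all_order all_algebra.
From mathcomp Require Import all_classical all_reals all_analysis.
From mathcomp Require Import complex.

Set Implicit Arguments.
Unset Strict Implicit.
Unset Printing Implicit Defensive.

Import Order.TTheory GRing.Theory Num.Theory.
Import numFieldNormedType.Exports.

Local Open Scope classical_set_scope.
Local Open Scope ring_scope.
Local Open Scope complex_scope.

(* The complex plane is R[i], for R : realType, with the topology of its norm
   and as a normed space over itself: these are the structures that
   MathComp-Analysis puts on an abstract numClosedFieldType, which are not
   inferred for the concrete type R[i]. *)
HB.instance Definition _ (R : realType) := PseudoPointedMetric.copy R[i] R[i]^o.
HB.instance Definition _ (R : realType) := GRing.ComAlgebra.copy R[i] R[i]^o.
HB.instance Definition _ (R : realType) := Vector.copy R[i] R[i]^o.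
HB.instance Definition _ (R : realType) := NormedModule.copy R[i] R[i]^o.

Definition boundary (T : topologicalType) (A : set T) : set T :=
  closure A `\` interior A.

(* The Riemann sphere is the one-point compactification of the plane, in which
   [Some] embeds the plane and [None] is the point at infinity. *)
Definition simply_connected_domain (R : realType) (G : set R[i]) : Prop :=
  [/\ open G, connected G &
      connected (~` (Some @` G) : set (one_point_compactification R[i]))].

(* Differentiability is over the field R[i], hence complex. *)
Definition analytic_on (R : realType) (G : set R[i]) (f : R[i] -> R[i]) : Prop :=
  forall z, G z -> derivable f z 1.

Definition unit_disk (R : realType) : set R[i] := [set z | `|z| < 1].

(* A map on G is represented by a total function, whose values outside G are
   irrelevant. *)
Definition riemann_map (R : realType) (G : set R[i]) (phi : R[i] -> R[i]) : Prop :=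
  analytic_on G phi /\ set_bij G (@unit_disk R) phi.

Definition jordan_arc (R : realType) (gamma : set R[i]) (p q : R[i]) : Prop :=
  exists (a b : R) (f : R -> R[i]),
    [/\ a < b, {within `[a, b], continuous f}, set_inj `[a, b] f,
        gamma = f @` `[a, b] & f a = p /\ f b = q].

Definition crosscut (R : realType) (G gamma : set R[i]) : Prop :=
  exists p q : R[i],
    [/\ jordan_arc gamma p q, gamma `\` [set p; q] `<=` G,
        boundary G p & boundary G q].

(* The norm of R[i] is R[i]-valued, with real values; [complex.Re] returns the
   distance in R. *)
Definition dist (R : realType) (A B : set R[i]) : R :=
  inf [set complex.Re `|a - b| | a in A & b in B].

Definition is_component (T : topologicalType) (A V : set T) : Prop :=
  exists2 x, A x & V = connected_component A x.

Definition multiple_points (R : realType) (G : set R[i]) : set R[i] :=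
  [set l | boundary G l /\
    exists gamma1 gamma2 V1 V2 : set R[i],
      [/\ crosscut G gamma1 /\ crosscut G gamma2,
          is_component (G `\` gamma1) V1 /\ is_component (G `\` gamma2) V2,
          V1 `&` V2 = set0,
          boundary V1 l /\ boundary V2 l &
          0 < dist gamma1 gamma2]].

Definition extends_continuously (T U : topologicalType) (G : set T) (f : T -> U)
    : Prop :=
  exists F : T -> U,
    {within closure G, continuous F} /\ (forall z, G z -> F z = f z).

(* Main.v *)
Require Import Defs.
From mathcomp Require Import all_boot all_order all_algebra.
From mathcomp Require Import all_classical all_reals all_analysis.
From mathcomp Require Import complex.
From mathcomp Require Import ring lra.

Set Implicit Arguments.
Unset Strict Implicit.
Unset Printing Implicit Defensive.

Import Order.TTheory GRing.Theory Num.Theory.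
Import numFieldNormedType.Exports.

Local Open Scope classical_set_scope.
Local Open Scope ring_scope.
Local Open Scope complex_scope.

(* Let psi be the inverse of phi. Cauchy's theorem on rectangles, applied in log-polar coordinates,
   gives the mean value property, hence the maximum modulus principle, from which phi is open, phi'
   does not vanish and psi is holomorphic.

   The boundary behaviour rests on one estimate (crossing_small): if f is holomorphic and bounded by
   1 on the disk, and small on a set that meets all circles |z - zeta| = r with s <= r <= 2 s, where
   |zeta| = 1, then f is small at the points at distance at most s from zeta which are nontangential
   at scale s. It yields Lindelof's theorem, the landing in the unit circle of phi o sigma when sigma
   is a curve in G ending at a boundary point of G, and the existence, near each point of the circle,
   of nontangential limits of psi that avoid three given values.

   If phi does not extend continuously to a boundary point l, it has two cluster values a <> b
   there. Chords joining points with distinct nontangential limits on both sides of a, and of b, are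
   mapped by psi to crosscuts with disjoint closures, and the images of the caps that they cut off
   show that l is a multiple point. Conversely, let phi extend to F and let l be a multiple point
   with crosscuts gamma1 and gamma2. If F maps an end point of each crosscut to F l, Lindelof's theorem
   makes both end points equal to the nontangential limit of psi at F l, so the crosscuts touch.
   Otherwise F l is at a positive distance from F(gamma_i) for some i, and psi maps a neighbourhood
   of F l in the disk into V_i; the other component also comes close to l, so V1 and V2 meet. *)

(** The only analytic tool at the boundary is the maximum principle. [crossing_small] plays the part
    of a lower bound for harmonic measure followed by the two-constants theorem. Its comparison
    function is a discrete Green potential that puts mass dr / (1 - |w|) at one point w of E for
    each distance r from zeta. As |z - w| is at least the difference of the distances of z and w
    from zeta, the potential is bounded in terms of these distances alone, so the shape of E is
    irrelevant. The threshold eps depends only on k and tau, not on f, s or E; Lindelof's theorem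
    and the landing of curves need this uniformity over all small scales.

    Chords are used because they approach the circle nontangentially, so that psi converges along
    them, and caps because they are convex, so that their images are connected. Three values have to
    be avoided because the four ends of the two crosscuts must be distinct: the last end chosen
    avoids both ends of the other crosscut and its own partner. *)

Definition nrm (R : realType) (z : R[i]) : R := complex.Re `|z|.

(** * The real-valued modulus and the topology of the plane in terms of it *)

Section Modulus.
Variable R : realType.
Local Notation C := R[i].
Implicit Types (z w : C).

Lemma nrmC z : `|z| = (nrm z)%:C.
Proof. by rewrite /nrm RRe_real// ger0_real. Qed.

Lemma nrm_sqrt z : nrm z = Num.sqrt (complex.Re z ^+ 2 + complex.Im z ^+ 2).
Proof. by rewrite /nrm normc_def. Qed.

Lemma nrm_ge0 z : 0 <= nrm z.
Proof. by rewrite nrm_sqrt sqrtr_ge0. Qed.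

Lemma nrm_sqr z : nrm z ^+ 2 = complex.Re z ^+ 2 + complex.Im z ^+ 2.
Proof. by rewrite nrm_sqrt sqr_sqrtr// addr_ge0// sqr_ge0. Qed.

Lemma nrm0 : nrm (0 : C) = 0.
Proof. by rewrite /nrm normr0. Qed.

Lemma nrm1 : nrm (1 : C) = 1.
Proof. by rewrite /nrm normr1. Qed.

Lemma nrmN z : nrm (- z) = nrm z.
Proof. by rewrite /nrm normrN. Qed.

Lemma nrmB z w : nrm (z - w) = nrm (w - z).
Proof. by rewrite -nrmN opprB. Qed.

Lemma nrmM z w : nrm (z * w) = nrm z * nrm w.
Proof. by apply: (@complexI R); rewrite -nrmC normrM !nrmC rmorphM. Qed.

Lemma nrmX z n : nrm (z ^+ n) = nrm z ^+ n.
Proof. by elim: n => [|n IH]; rewrite ?expr0 ?nrm1// !exprS nrmM IH. Qed.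

Lemma nrm_eq0 z : (nrm z == 0) = (z == 0).
Proof. by rewrite -[z == 0]normr_eq0 nrmC eq_complex/= eqxx andbT. Qed.

Lemma nrm_gt0 z : (0 < nrm z) = (z != 0).
Proof. by rewrite lt_def nrm_ge0 andbT nrm_eq0. Qed.

Lemma nrmV z : nrm z^-1 = (nrm z)^-1.
Proof. by apply: (@complexI R); rewrite -nrmC normfV nrmC fmorphV. Qed.

Lemma nrmD z w : nrm (z + w) <= nrm z + nrm w.
Proof. by rewrite -lecR -nrmC rmorphD/= -!nrmC ler_normD. Qed.

Lemma nrm_sub z w : nrm (z - w) <= nrm z + nrm w.
Proof. by rewrite -(nrmN w) nrmD. Qed.

Lemma nrm_tri y z w : nrm (z - w) <= nrm (z - y) + nrm (y - w).
Proof. by rewrite (le_trans _ (nrmD _ _))// addrA subrK. Qed.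

Lemma nrm_lb z w : nrm z - nrm w <= nrm (z - w).
Proof. by rewrite lerBlDr (le_trans _ (nrmD _ _))// subrK. Qed.

Lemma nrm_real (x : R) : nrm x%:C = `|x|.
Proof. by rewrite nrm_sqrt/= expr0n addr0 sqrtr_sqr. Qed.

Lemma Re_le_nrm z : `|complex.Re z| <= nrm z.
Proof.
rewrite nrm_sqrt -sqrtr_sqr ler_wsqrtr// lerDl sqr_ge0//.
Qed.

Lemma Im_le_nrm z : `|complex.Im z| <= nrm z.
Proof.
rewrite nrm_sqrt -sqrtr_sqr ler_wsqrtr// lerDr sqr_ge0//.
Qed.

Lemma nrm_le z : nrm z <= `|complex.Re z| + `|complex.Im z|.
Proof.
rewrite -ler_sqr ?nnegrE ?nrm_ge0 ?addr_ge0// nrm_sqr sqrrD !real_normK ?num_real//.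
by rewrite -addrA addrCA addrC lerDl mulrn_wge0// mulr_ge0.
Qed.

Lemma nrm_conj z : nrm (z^*)%C = nrm z.
Proof. by rewrite !nrm_sqrt; case: z => a b /=; rewrite sqrrN. Qed.

Lemma nbhsP (A : set C) z :
  nbhs z A <-> exists2 d : R, 0 < d & forall w, nrm (w - z) < d -> A w.
Proof.
split.
  move=> /nbhs_ballP [e /= e0 eA].
  have er : e = (complex.Re e)%:C by rewrite RRe_real// gtr0_real.
  exists (complex.Re e); first by rewrite -ltcR -er.
  by move=> w wz; apply: eA; rewrite /ball/= distrC nrmC er ltcR.
move=> [d d0 dA]; apply/nbhs_ballP; exists d%:C => /=; first by rewrite ltcR.
by move=> w; rewrite /ball/= distrC nrmC ltcR; exact: dA.
Qed.

Lemma openP (A : set C) : open A <->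
  forall z, A z -> exists2 d : R, 0 < d & forall w, nrm (w - z) < d -> A w.
Proof.
rewrite openE; split=> [oA z Az|H z Az]; first by apply/nbhsP/oA.
by rewrite /interior; apply/nbhsP/H.
Qed.

Lemma closureP (A : set C) z : closure A z <->
  forall d : R, 0 < d -> exists2 w, A w & nrm (w - z) < d.
Proof.
split=> [cA d d0|H B /nbhsP[d d0 dB]].
  have [|w [Aw wz]] := cA [set w | nrm (w - z) < d]; last by exists w.
  by apply/nbhsP; exists d.
by have [w Aw wz] := H d d0; exists w; split => //; exact: dB.
Qed.

Lemma bounded_setP (A : set C) : bounded_set A <->
  exists M : R, forall z, A z -> nrm z <= M.
Proof.
split.
  move=> [M [Mr HM]]; exists (complex.Re M + 1) => z Az.
  have := HM (complex.Re M + 1)%:C; rewrite -{1}(RRe_real Mr) ltcR ltrDl ltr01.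
  by move=> /(_ isT z Az); rewrite /= nrmC lecR.
move=> [M HM]; exists M%:C; split; first by rewrite complex_real.
move=> x; rewrite ltcE => /andP[/eqP/= ix Mx] z Az /=; rewrite nrmC lecE/= ix eqxx/=.
by rewrite (le_trans (HM _ Az))// ltW.
Qed.

End Modulus.
Arguments nrm : simpl never.

(** The norm of [R[i]] has complex values. A common real-valued gauge lets one epsilon-delta
    criterion serve maps between the line and the plane in any combination. *)
Definition metrizes (R : realType) (T : topologicalType) (m : T -> T -> R) :=
  forall (z : T) (A : set T),
    nbhs z A <-> exists2 d : R, 0 < d & forall w, m w z < d -> A w.

Lemma within_continuousP (R : realType) (T U : topologicalType)
    (mT : T -> T -> R) (mU : U -> U -> R) (A : set T) (f : T -> U) :
  metrizes mT -> metrizes mU ->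
  {within A, continuous f} <->
  forall z, A z -> forall e : R, 0 < e ->
    exists2 d : R, 0 < d & forall w, A w -> mT w z < d -> mU (f w) (f z) < e.
Proof.
move=> HT HU; rewrite subspace_continuousP; split.
  move=> H z Az e e0.
  have /(H z Az) : nbhs (f z) [set u | mU u (f z) < e] by apply/HU; exists e.
  by move=> /HT[d d0 dB]; exists d => // w Aw wz; exact: dB.
move=> H z Az B /HU[e e0 eB]; have [d d0 dA] := H z Az e e0.
by apply/HT; exists d => // w wz Aw; apply/eB/dA.
Qed.

(** * Continuity and complex differentiability at a point *)

Section Complex_calculus.
Variable R : realType.
Local Notation C := R[i].
Implicit Types (z w : C) (f g : C -> C).

Lemma metrizesC : metrizes (fun w z : C => nrm (w - z)).
Proof. by move=> z A; exact: nbhsP. Qed.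

Lemma metrizesR : metrizes (fun w z : R => `|w - z|).
Proof.
move=> z A; split=> [/nbhs_ballP[e e0 eA]|[d d0 dA]].
  by exists e => // w wz; apply: eA; rewrite /ball/= distrC.
by apply/nbhs_ballP; exists d => // w; rewrite /ball/= distrC; exact: dA.
Qed.

Definition ccont f z := forall e : R, 0 < e ->
  exists2 d : R, 0 < d & forall w, nrm (w - z) < d -> nrm (f w - f z) < e.

(** Caratheodory's form of differentiability: the difference quotient extends to a function [q]
    continuous at [z], and [q z] is the derivative. The rules of calculus become algebra on [q],
    without limits of quotients. *)
Definition cdiff f z := exists2 q : C -> C, ccont q z &
  exists2 d : R, 0 < d &
    forall w, nrm (w - z) < d -> f w - f z = q w * (w - z).

Lemma ccont_ext f g z (d : R) : 0 < d ->
  (forall w, nrm (w - z) < d -> f w = g w) -> ccont f z -> ccont g z.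
Proof.
move=> d0 fg cf e e0; have [d1 d10 H] := cf e e0.
exists (Num.min d d1); first by rewrite lt_min d0.
move=> w; rewrite lt_min => /andP[wd wd1]; rewrite -!fg ?H//.
by rewrite subrr nrm0.
Qed.

Lemma ccont_cst (c : C) z : ccont (fun=> c) z.
Proof. by move=> e e0; exists 1 => // w _; rewrite subrr nrm0. Qed.

Lemma ccont_id z : ccont id z.
Proof. by move=> e e0; exists e. Qed.

Lemma ccont_bounded f z : ccont f z -> exists2 M : R, 0 < M &
  exists2 d : R, 0 < d & forall w, nrm (w - z) < d -> nrm (f w) <= M.
Proof.
move=> cf; have [d d0 H] := cf 1 ltr01.
exists (nrm (f z) + 1); first by rewrite ltr_wpDl// nrm_ge0.
exists d => // w wz; rewrite -[f w](subrK (f z)) (le_trans (nrmD _ _))//.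
by rewrite addrC lerD2l ltW// H.
Qed.

Lemma ccontD f g z : ccont f z -> ccont g z -> ccont (fun w => f w + g w) z.
Proof.
move=> cf cg e e0; have e2 : 0 < e / 2 by rewrite divr_gt0.
have [d1 d10 H1] := cf _ e2; have [d2 d20 H2] := cg _ e2.
exists (Num.min d1 d2); first by rewrite lt_min d10.
move=> w; rewrite lt_min => /andP[/H1 w1 /H2 w2].
rewrite opprD addrACA (le_lt_trans (nrmD _ _))//.
by rewrite (splitr e) ltrD.
Qed.

Lemma ccontM f g z : ccont f z -> ccont g z -> ccont (fun w => f w * g w) z.
Proof.
move=> cf cg e e0.
have [M M0 [d0 d00 HM]] := ccont_bounded cg.
have N0 : 0 < nrm (f z) + 1 by rewrite ltr_wpDl// nrm_ge0.
have [d1 d10 H1] := cf (e / 2 / M) (divr_gt0 (divr_gt0 e0 (ltr0Sn _ 1)) M0).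
have [d2 d20 H2] := cg (e / 2 / (nrm (f z) + 1)) (divr_gt0 (divr_gt0 e0 (ltr0Sn _ 1)) N0).
exists (Num.min d0 (Num.min d1 d2)); first by rewrite !lt_min d00 d10.
move=> w; rewrite !lt_min => /and3P[/HM w0 /H1 w1 /H2 w2].
have -> : f w * g w - f z * g z = (f w - f z) * g w + f z * (g w - g z) by ring.
rewrite (le_lt_trans (nrmD _ _))// !nrmM (splitr e).
move: w1 w2; rewrite ltr_pdivlMr// => w1; rewrite ltr_pdivlMr// => w2.
apply: ltr_leD.
  by apply: le_lt_trans _ w1; rewrite ler_wpM2l// nrm_ge0.
apply: le_trans _ (ltW w2); rewrite mulrC ler_wpM2l ?nrm_ge0//.
by rewrite lerDl.
Qed.

Lemma ccontV f z : ccont f z -> f z != 0 -> ccont (fun w => (f w)^-1) z.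
Proof.
move=> cf f0 e e0; have n0 : 0 < nrm (f z) by rewrite nrm_gt0.
have [d1 d10 H1] := cf (nrm (f z) / 2) (divr_gt0 n0 (ltr0Sn _ 1)).
have e1 : 0 < e * (nrm (f z) * nrm (f z)) / 2 by rewrite divr_gt0// !mulr_gt0.
have [d2 d20 H2] := cf _ e1.
exists (Num.min d1 d2); first by rewrite !lt_min d10.
move=> w; rewrite !lt_min => /andP[/H1 w1 /H2 w2].
have fw : nrm (f z) / 2 < nrm (f w).
  have := nrm_lb (f z) (f w); rewrite (nrmB (f z)); lra.
have fw0 : f w != 0 by rewrite -nrm_gt0; apply: lt_trans fw; rewrite divr_gt0.
have -> : (f w)^-1 - (f z)^-1 = - ((f w - f z) / (f w * f z)).
  by field; rewrite f0 fw0.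
rewrite nrmN nrmM nrmV nrmM ltr_pdivrMr; last first.
  by rewrite mulr_gt0// nrm_gt0.
apply: lt_le_trans w2 _; rewrite -mulrA ler_wpM2l ?(ltW e0)//.
by rewrite mulrAC ler_wpM2r ?(ltW n0)// ltW.
Qed.

Lemma cdiff_cont f z : cdiff f z -> ccont f z.
Proof.
move=> [q cq [d d0 H]].
apply: (@ccont_ext (fun w => f z + q w * (w + (- z)))  f z d d0).
  by move=> w /H <-; rewrite addrC subrK.
apply: ccontD; first exact: ccont_cst.
by apply: ccontM => //; apply: ccontD; [exact: ccont_id|exact: ccont_cst].
Qed.

Lemma cdiff_ext f g z (d : R) : 0 < d ->
  (forall w, nrm (w - z) < d -> f w = g w) -> cdiff f z -> cdiff g z.
Proof.
move=> d0 fg [q cq [d1 d10 H]]; exists q => //.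
exists (Num.min d d1); first by rewrite lt_min d0.
move=> w; rewrite lt_min => /andP[wd wd1]; rewrite -!fg ?H//.
by rewrite subrr nrm0.
Qed.

Lemma cdiff_cst (c : C) z : cdiff (fun=> c) z.
Proof.
exists (fun=> 0); first exact: ccont_cst.
by exists 1 => // w _; rewrite subrr mul0r.
Qed.

Lemma cdiff_id z : cdiff id z.
Proof.
exists (fun=> 1); first exact: ccont_cst.
by exists 1 => // w _; rewrite mul1r.
Qed.

Lemma cdiffD f g z : cdiff f z -> cdiff g z -> cdiff (fun w => f w + g w) z.
Proof.
move=> [p cp [d1 d10 H1]] [q cq [d2 d20 H2]].
exists (fun w => p w + q w); first exact: ccontD.
exists (Num.min d1 d2); first by rewrite lt_min d10.
move=> w; rewrite lt_min => /andP[/H1 w1 /H2 w2].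
by rewrite opprD addrACA w1 w2 mulrDl.
Qed.

Lemma cdiffM f g z : cdiff f z -> cdiff g z -> cdiff (fun w => f w * g w) z.
Proof.
move=> df dg; have [p cp [d1 d10 H1]] := df; have [q cq [d2 d20 H2]] := dg.
exists (fun w => p w * g w + f z * q w).
  by apply: ccontD; apply: ccontM => //; [exact: cdiff_cont|exact: ccont_cst].
exists (Num.min d1 d2); first by rewrite lt_min d10.
move=> w; rewrite lt_min => /andP[/H1 w1 /H2 w2].
have -> : f w * g w - f z * g z = (f w - f z) * g w + f z * (g w - g z) by ring.
by rewrite w1 w2; ring.
Qed.

Lemma cdiffV f z : cdiff f z -> f z != 0 -> cdiff (fun w => (f w)^-1) z.
Proof.
move=> df f0; have [q cq [d1 d10 H1]] := df; have cf := cdiff_cont df.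
have n0 : 0 < nrm (f z) by rewrite nrm_gt0.
have [d2 d20 H2] := cf _ n0.
exists (fun w => (- 1) * (q w * ((f w)^-1 * (f z)^-1))).
  apply: ccontM; first exact: ccont_cst.
  apply: ccontM => //; apply: ccontM; last exact: ccont_cst.
  exact: ccontV.
exists (Num.min d1 d2); first by rewrite lt_min d10.
move=> w; rewrite lt_min => /andP[/H1 w1 /H2 w2].
have fw0 : f w != 0.
  apply: contraTneq w2 => ->; by rewrite sub0r nrmN ltxx.
have -> : - 1 * (q w * ((f w)^-1 * (f z)^-1)) * (w - z) =
  - ((q w * (w - z)) * ((f w)^-1 * (f z)^-1)) by ring.
by rewrite -w1; field; rewrite f0 fw0.
Qed.

Lemma cdiffX f z n : cdiff f z -> cdiff (fun w => f w ^+ n) z.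
Proof.
move=> df; elim: n => [|n IH].
  apply: (cdiff_ext ltr01 _ (cdiff_cst 1 z)) => w _; by rewrite expr0.
apply: (cdiff_ext ltr01 _ (cdiffM df IH)) => w _; by rewrite exprS.
Qed.

Lemma derivable_cdiff f z : derivable f z 1 -> cdiff f z.
Proof.
move=> /cvg_ex[l /= Hl].
exists (fun w => if w == z then l else (f w - f z) / (w - z)).
  move=> e e0.
  have /Hl : nbhs l [set u : C | nrm (u - l) < e] by apply/nbhsP; exists e.
  move=> /nbhsP[d d0 dH]; exists d => // w wz; rewrite eqxx.
  have [_|nwz] := eqVneq w z; first by rewrite subrr nrm0.
  have := dH (w - z); rewrite subr0 subr_eq0 => /(_ wz nwz) /=.
  rewrite [_ *: 1]mulr1 subrK [_ *: _]mulrC; exact.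
exists 1 => // w _; have [->|nwz] := eqVneq w z; first by rewrite !subrr mulr0.
by rewrite divfK// subr_eq0.
Qed.

End Complex_calculus.

(** * Extrema, distances and cluster points on compact plane sets *)

Section Compactness.
Variable R : realType.
Local Notation C := R[i].
Implicit Types (z w : C) (A K : set C).

Lemma compact_bounded_closed A (M : R) :
  (forall z, A z -> nrm z <= M) ->
  (forall z, (forall d : R, 0 < d -> exists2 w, A w & nrm (w - z) < d) -> A z) ->
  compact A.
Proof.
move=> AM Acl.
pose Q : set (R * R) := `[(- M), M] `*` `[(- M), M].
pose h (p : R * R) : C := p.1 +i* p.2.
have cQ : compact Q by apply: compact_setX; exact: segment_compact.
have ch : {within Q, continuous h}.
  apply: continuous_subspaceT => -[x y] B /nbhsP[d d0 dB].
  exists (ball x (d / 2), ball y (d / 2)) => /=.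
    by split; apply: nbhsx_ballx; rewrite divr_gt0.
  move=> [x' y'] /= [xx yy]; apply: dB.
  rewrite (le_lt_trans (nrm_le _))//= (splitr d).
  by rewrite distrC (distrC y' y) ltrD.
have cP : compact (h @` Q) by exact: continuous_compact.
apply: (subclosed_compact _ cP).
  by move=> z /closureP; exact: Acl.
move=> z Az; exists (complex.Re z, complex.Im z); last by case: (z).
have zM := AM z Az.
have := le_trans (Re_le_nrm z) zM; have := le_trans (Im_le_nrm z) zM.
by rewrite !ler_norml /Q /= !in_itv/= => -> ->.
Qed.

Lemma compact_max K (g : C -> R) : compact K -> K !=set0 ->
  (forall z, K z -> forall e : R, 0 < e ->
    exists2 d : R, 0 < d & forall w, K w -> nrm (w - z) < d -> `|g w - g z| < e) ->
  exists2 c, K c & forall z, K z -> g z <= g c.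
Proof.
move=> cK K0 cg.
have [|c /set_mem Kc H] := @compact_EVT_max _ _ g K K0 cK.
  by apply/(within_continuousP _ _ (@metrizesC R) (@metrizesR R)).
by exists c => // z Kz; apply: H; rewrite inE.
Qed.

Lemma compact_min K (g : C -> R) : compact K -> K !=set0 ->
  (forall z, K z -> forall e : R, 0 < e ->
    exists2 d : R, 0 < d & forall w, K w -> nrm (w - z) < d -> `|g w - g z| < e) ->
  exists2 c, K c & forall z, K z -> g c <= g z.
Proof.
move=> cK K0 cg; have [|c Kc H] := @compact_max K (fun z => - g z) cK K0.
  move=> z Kz e e0; have [d d0 dH] := cg z Kz e e0.
  by exists d => // w Kw wz; rewrite -opprD normrN dH.
by exists c => // z Kz; rewrite -lerN2 H.
Qed.

Lemma lipschitz_cont K (g : C -> R) (k : R) :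
  (forall w z, K w -> K z -> `|g w - g z| <= k * nrm (w - z)) ->
  forall z, K z -> forall e : R, 0 < e ->
    exists2 d : R, 0 < d & forall w, K w -> nrm (w - z) < d -> `|g w - g z| < e.
Proof.
move=> H z Kz e e0; have k0 : 0 < `|k| + 1 by rewrite ltr_wpDl.
exists (e / (`|k| + 1)); first by rewrite divr_gt0.
move=> w Kw; rewrite ltr_pdivlMr// => wz; apply: le_lt_trans wz.
rewrite (le_trans (H w z Kw Kz))// mulrC ler_wpM2l ?nrm_ge0//.
by rewrite (le_trans (ler_norm k))// lerDl.
Qed.

Lemma nrm_dist w z : `|nrm w - nrm z| <= nrm (w - z).
Proof.
by rewrite ler_norml nrm_lb andbT lerNl opprB (nrmB w) nrm_lb.
Qed.

Lemma nearest_point A z : A !=set0 ->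
  (forall u, (forall d : R, 0 < d -> exists2 w, A w & nrm (w - u) < d) -> A u) ->
  exists2 p, A p & forall q, A q -> nrm (z - p) <= nrm (z - q).
Proof.
move=> [a Aa] Acl.
pose K : set C := [set w | A w /\ nrm (z - w) <= nrm (z - a)].
have cK : compact K.
  apply: (@compact_bounded_closed _ (nrm z + nrm (z - a))).
    move=> w [Aw wz]; rewrite -[w](subKr z) (le_trans (nrm_sub _ _))//.
    by rewrite lerD2l.
  move=> u H; split.
    by apply: Acl => d d0; have [w [Aw _] wu] := H d d0; exists w.
  apply/ler_addgt0Pr => d d0; have [w [Aw wz] wu] := H d d0.
  by rewrite (le_trans (nrm_tri w _ _))// lerD// ltW.
have [||p [Ap pa] H] := @compact_min K (fun w => nrm (z - w)) cK.
- by exists a; split.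
- apply: (@lipschitz_cont _ _ 1) => w u _ _; rewrite mul1r.
  rewrite (le_trans (nrm_dist _ _))//.
  have -> : z - w - (z - u) = - (w - u) by ring.
  by rewrite nrmN.
exists p => // q Aq; have [qa|/ltW qa] := leP (nrm (z - q)) (nrm (z - a)).
  by apply: H; split.
exact: le_trans pa qa.
Qed.

Lemma compact_closed_dist K A : compact K ->
  (forall u, (forall d : R, 0 < d -> exists2 w, A w & nrm (w - u) < d) -> A u) ->
  K `&` A = set0 ->
  exists2 d : R, 0 < d & forall z a, K z -> A a -> d <= nrm (z - a).
Proof.
move=> cK Acl KA.
have [->|/set0P[k Kk]] := eqVneq K set0; first by exists 1.
have [->|/set0P A0] := eqVneq A set0; first by exists 1.
pose p z := projT1 (cid2 (nearest_point z A0 Acl)).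
have Ap z : A (p z) by rewrite /p; case: cid2.
have pmin z q : A q -> nrm (z - p z) <= nrm (z - q) by rewrite /p; case: cid2 => /= ? _; apply.
have [||c Kc H] := @compact_min K (fun z => nrm (z - p z)) cK.
- by exists k.
- apply: (@lipschitz_cont _ _ 1) => w z _ _; rewrite mul1r ler_norml lerBlDr lerNl opprB lerBlDr.
  apply/andP; split.
    by rewrite (le_trans (pmin z _ (Ap w)))// (nrmB w) nrm_tri.
  by rewrite (le_trans (pmin w _ (Ap z)))// nrm_tri.
exists (nrm (c - p c)).
  rewrite nrm_gt0 subr_eq0; apply/eqP => cp.
  suff : (K `&` A) c by rewrite KA.
  by split => //; rewrite cp.
by move=> z a Kz Aa; rewrite (le_trans (H _ Kz))// pmin.
Qed.

(** The sets of points of [K] with [P d] shrink with [d] and generate a proper filter, which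
    clusters in [K]. This takes the place of extracting a convergent subsequence. *)
Lemma compact_cluster K (P : R -> C -> Prop) : compact K ->
  (forall d e x, 0 < d -> d <= e -> P d x -> P e x) ->
  (forall d, 0 < d -> exists2 x, K x & P d x) ->
  exists2 a, K a & forall d, 0 < d -> exists x, [/\ K x, P d x & nrm (x - a) < d].
Proof.
move=> cK Pm Pex.
pose F : set_system C := [set A | exists2 d : R, 0 < d & forall x, K x -> P d x -> A x].
have FF : ProperFilter F.
  split.
    by move=> [d d0 H]; have [x Kx Px] := Pex d d0; exact: H Kx Px.
  split.
  - by exists 1.
  - move=> A B [d d0 dA] [e e0 eB].
    have m0 : 0 < Num.min d e by rewrite lt_min d0.
    exists (Num.min d e) => // x Kx Px; split.
      by apply: dA => //; apply: Pm Px => //; rewrite ge_min lexx.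
    by apply: eB => //; apply: Pm Px => //; rewrite ge_min lexx orbT.
  - by move=> A B AB [d d0 dA]; exists d => // x Kx Px; apply/AB/dA.
have [|a [Ka cla]] := cK F FF; first by exists 1.
exists a => // d d0.
have [||x [[Kx Px] xa]] := cla [set x | K x /\ P d x] [set x | nrm (x - a) < d].
- by exists d.
- by apply/nbhsP; exists d.
by exists x.
Qed.

End Compactness.

(** * The Goursat theorem for rectangles *)

Section Segment_integral.
Variable R : realType.
Implicit Types (a b : R) (f g : R -> R).

Definition sint a b f : R := \int[@lebesgue_measure R]_(x in `[a, b]) f x.

Definition scont a b f := {within `[a, b], continuous f}.

Lemma scontP a b f : scont a b f <->
  forall x, a <= x <= b -> forall e : R, 0 < e ->
    exists2 d : R, 0 < d & forall y, a <= y <= b -> `|y - x| < d -> `|f y - f x| < e.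
Proof.
rewrite /scont (within_continuousP _ _ (@metrizesR R) (@metrizesR R)).
split=> H x xab e e0.
  have [|d d0 dH] := H x _ e e0; first by rewrite /= in_itv.
  by exists d => // y yab; apply: dH; rewrite /= in_itv.
move: xab; rewrite /= in_itv => /H /(_ e e0)[d d0 dH].
by exists d => // y; rewrite /= in_itv/=; exact: dH.
Qed.

Lemma scont_integrable a b f : scont a b f ->
  (@lebesgue_measure R).-integrable `[a, b] (EFin \o f).
Proof. by move=> cf; apply: continuous_compact_integrable => //; exact: segment_compact. Qed.

Lemma scont_sub a b a' b' f : a <= a' -> b' <= b -> scont a b f -> scont a' b' f.
Proof.
move=> aa bb; apply: continuous_subspaceW => x; rewrite /= !in_itv/= => /andP[ax xb].
by rewrite (le_trans aa)// (le_trans xb).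
Qed.

Lemma scontB a b f g : scont a b f -> scont a b g -> scont a b (fun x => f x - g x).
Proof.
move=> cf cg; exact: (within_continuousB cf cg).
Qed.

Lemma scont_cst a b (k : R) : scont a b (fun=> k).
Proof. by apply/scontP => x _ e e0; exists 1 => // y _ _; rewrite subrr normr0. Qed.

Lemma sintB a b f g : scont a b f -> scont a b g ->
  sint a b (fun x => f x - g x) = sint a b f - sint a b g.
Proof. by move=> cf cg; rewrite /sint RintegralB//; exact: scont_integrable. Qed.

Lemma sint_split m a b f : a <= m <= b -> scont a b f ->
  sint a b f = sint a m f + sint m b f.
Proof.
move=> /andP[am mb] cf; have fi := scont_integrable cf.
apply/eqP; rewrite addrC -subr_eq; apply/eqP.
rewrite /sint (@Rintegral_itvB R f (BLeft a) (BRight b) m)//.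
rewrite Rintegral_itv_obnd_cbnd//.
apply: integrableS fi => //; apply: subset_itvr; by rewrite bnd_simp.
Qed.

Lemma sint_cst a b (k : R) : a <= b -> sint a b (fun=> k) = k * (b - a).
Proof.
move=> ab; rewrite /sint Rintegral_cst//; congr (_ * _).
transitivity (fine (if a < b then (b%:E - a%:E)%E else 0%E)).
  by congr fine; have := @lebesgue_measure_itv R `[a, b]; rewrite /= lte_fin.
by case: ltgtP ab => // ->; rewrite subrr.
Qed.

Lemma sint_bound a b f (k : R) : a <= b -> scont a b f ->
  (forall x, a <= x <= b -> `|f x| <= k) -> `|sint a b f| <= k * (b - a).
Proof.
move=> ab cf fk; have fi := scont_integrable cf.
rewrite (le_trans (le_normr_Rintegral _ fi))// -sint_cst//.
apply: le_Rintegral => //.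
- exact: integrable_norm fi.
- apply: scont_integrable; exact: scont_cst.
Qed.

Lemma sint_ext a b f g : (forall x, a <= x <= b -> f x = g x) -> sint a b f = sint a b g.
Proof.
move=> fg; apply: eq_Rintegral => x; rewrite inE/= in_itv/=; exact: fg.
Qed.

End Segment_integral.

Section Goursat.
Variable R : realType.
Local Notation C := R[i].
Implicit Types (a b c d : R) (F : R -> R -> C).

(** Complex differentiability in x + iy relative to the closed rectangle: increments that leave the
    rectangle are not considered, so the notion passes to subrectangles. *)
Definition hol_rect a b c d F := forall x y, a <= x <= b -> c <= y <= d ->
  exists l : C, forall e : R, 0 < e -> exists2 r : R, 0 < r &
    forall x' y', a <= x' <= b -> c <= y' <= d -> `|x' - x| < r -> `|y' - y| < r ->
      nrm (F x' y' - F x y - l * ((x' - x) +i* (y' - y))) <= e * (`|x' - x| + `|y' - y|).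

Lemma hol_rect_sub a b c d a' b' c' d' F : a <= a' -> b' <= b -> c <= c' -> d' <= d ->
  hol_rect a b c d F -> hol_rect a' b' c' d' F.
Proof.
move=> aa bb cc dd H x y /andP[x1 x2] /andP[y1 y2].
have [||l Hl] := H x y; rewrite ?(le_trans aa) ?(le_trans x2) ?(le_trans cc) ?(le_trans y2)//.
exists l => e e0; have [r r0 Hr] := Hl e e0; exists r => // x' y' /andP[u1 u2] /andP[v1 v2].
by apply: Hr; rewrite ?(le_trans aa) ?(le_trans u2) ?(le_trans cc) ?(le_trans v2).
Qed.

Lemma hol_rect_cont a b c d F x y : hol_rect a b c d F -> a <= x <= b -> c <= y <= d ->
  forall e : R, 0 < e -> exists2 r : R, 0 < r &
    forall x' y', a <= x' <= b -> c <= y' <= d -> `|x' - x| < r -> `|y' - y| < r ->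
    nrm (F x' y' - F x y) < e.
Proof.
move=> H xab ycd e e0; have [l /(_ 1 ltr01)[r r0 Hr]] := H x y xab ycd.
have k0 : 0 < nrm l + 1 by rewrite ltr_wpDl// nrm_ge0.
exists (Num.min r (e / 2 / (nrm l + 1))).
  by rewrite lt_min r0 !divr_gt0.
move=> x' y' xab' ycd'; rewrite !lt_min => /andP[xr xe] /andP[yr ye].
have := Hr x' y' xab' ycd' xr yr; rewrite mul1r => Hb.
rewrite -[F x' y' - F x y](subrK (l * ((x' - x) +i* (y' - y)))).
rewrite (le_lt_trans (nrmD _ _))// nrmM.
have /= Hn := nrm_le ((x' - x) +i* (y' - y)).
move: xe ye; rewrite ltr_pdivlMr// => xe; rewrite ltr_pdivlMr// => ye.
have := nrm_ge0 l; have := nrm_ge0 ((x' - x) +i* (y' - y)); nra.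
Qed.

Lemma hol_scont_Re a b c d F x : hol_rect a b c d F -> a <= x <= b ->
  scont c d (fun y => complex.Re (F x y)).
Proof.
move=> H xab; apply/scontP => y ycd e e0.
have [r r0 Hr] := hol_rect_cont H xab ycd e0; exists r => // y' ycd' yy.
apply: le_lt_trans (Hr x y' xab ycd' _ yy); last by rewrite subrr normr0.
by apply: le_trans (Re_le_nrm _); case: (F x y') (F x y) => ? ? [].
Qed.

Lemma hol_scont_Im a b c d F y : hol_rect a b c d F -> c <= y <= d ->
  scont a b (fun x => complex.Im (F x y)).
Proof.
move=> H ycd; apply/scontP => x xab e e0.
have [r r0 Hr] := hol_rect_cont H xab ycd e0; exists r => // x' xab' xx.
apply: le_lt_trans (Hr x' y xab' ycd xx _); last by rewrite subrr normr0.
by apply: le_trans (Im_le_nrm _); case: (F x' y) (F x y) => ? ? [].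
Qed.

(* The imaginary part of the integral of F along the boundary of the rectangle. *)
Definition bint F a b c d := sint c d (fun y => complex.Re (F b y) - complex.Re (F a y))
  - sint a b (fun x => complex.Im (F x d) - complex.Im (F x c)).

Lemma bintE F a b c d : a <= b -> c <= d -> hol_rect a b c d F ->
  bint F a b c d = sint c d (fun y => complex.Re (F b y)) - sint c d (fun y => complex.Re (F a y))
  - (sint a b (fun x => complex.Im (F x d)) - sint a b (fun x => complex.Im (F x c))).
Proof.
move=> ab cd H; rewrite /bint !sintB//; first [apply: (hol_scont_Re H)|apply: (hol_scont_Im H)];
by rewrite lexx ?ab ?cd.
Qed.

Lemma bint_splitx F m a b c d : a <= m <= b -> c <= d -> hol_rect a b c d F ->
  bint F a b c d = bint F a m c d + bint F m b c d.
Proof.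
move=> /andP[am mb] cd H; have ab := le_trans am mb.
rewrite !bintE//; last 2 first.
- exact: (hol_rect_sub am _ _ _ H).
- exact: (hol_rect_sub _ mb _ _ H).
rewrite (@sint_split _ m a b (fun x => complex.Im (F x d))) ?am//; last first.
  by apply: (hol_scont_Im H); rewrite lexx cd.
rewrite (@sint_split _ m a b (fun x => complex.Im (F x c))) ?am//; last first.
  by apply: (hol_scont_Im H); rewrite lexx cd.
ring.
Qed.

Lemma bint_splity F m a b c d : c <= m <= d -> a <= b -> hol_rect a b c d F ->
  bint F a b c d = bint F a b c m + bint F a b m d.
Proof.
move=> /andP[cm md] ab H; have cd := le_trans cm md.
rewrite !bintE//; last 2 first.
- exact: (hol_rect_sub _ _ cm _ H).
- exact: (hol_rect_sub _ _ _ md H).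
rewrite (@sint_split _ m c d (fun y => complex.Re (F b y))) ?cm//; last first.
  by apply: (hol_scont_Re H); rewrite lexx ab.
rewrite (@sint_split _ m c d (fun y => complex.Re (F a y))) ?cm//; last first.
  by apply: (hol_scont_Re H); rewrite lexx ab.
ring.
Qed.

(** The linear part of F adds Re l times the area to each of the two integrals, and these cancel.
    What is left is an error small relative to the size, integrated over sides of that size. *)
Lemma bint_local F a b c d x y : hol_rect a b c d F -> a <= x <= b -> c <= y <= d ->
  forall e : R, 0 < e -> exists2 r : R, 0 < r &
    forall a' b' c' d', a <= a' -> a' <= x <= b' -> b' <= b ->
      c <= c' -> c' <= y <= d' -> d' <= d -> b' - a' < r -> d' - c' < r ->
      `|bint F a' b' c' d'| <= e * (b' - a' + (d' - c')) ^+ 2.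
Proof.
move=> H xab ycd e e0.
have [l /(_ (e / 2) (divr_gt0 e0 (ltr0Sn _ 1)))[r r0 Hr]] := H x y xab ycd.
exists r => // a' b' c' d' aa /andP[ax xb] bb cc /andP[cy yd] dd wr hr.
have H' : hol_rect a' b' c' d' F by apply: hol_rect_sub H.
have ab' := le_trans ax xb; have cd' := le_trans cy yd.
set w := b' - a'; set h := d' - c'.
have near_xy u v : a' <= u <= b' -> c' <= v <= d' ->
    nrm (F u v - F x y - l * ((u - x) +i* (v - y))) <= e / 2 * (w + h).
  move=> /andP[u1 u2] /andP[v1 v2].
  have uw : `|u - x| <= w by rewrite ler_distl /w; apply/andP; split; lra.
  have vh : `|v - y| <= h by rewrite ler_distl /h; apply/andP; split; lra.
  apply: (le_trans (Hr u v _ _ _ _)).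
  - by rewrite (le_trans aa)//= (le_trans u2).
  - by rewrite (le_trans cc)//= (le_trans v2).
  - exact: le_lt_trans uw wr.
  - exact: le_lt_trans vh hr.
  - by rewrite ler_pM2l ?divr_gt0// lerD.
have diff u v u' v' : a' <= u <= b' -> c' <= v <= d' ->
    a' <= u' <= b' -> c' <= v' <= d' ->
    nrm (F u v - F u' v' - l * ((u - u') +i* (v - v'))) <= e * (w + h).
  move=> u1 v1 u2 v2; have n1 := near_xy u v u1 v1; have n2 := near_xy u' v' u2 v2.
  have -> : F u v - F u' v' - l * ((u - u') +i* (v - v')) =
     (F u v - F x y - l * ((u - x) +i* (v - y))) -
     (F u' v' - F x y - l * ((u' - x) +i* (v' - y))).
    have -> : (u - u') +i* (v - v') = ((u - x) +i* (v - y)) - ((u' - x) +i* (v' - y)).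
      by congr (_ +i* _); ring.
    by ring.
  by rewrite (le_trans (nrm_sub _ _))//; lra.
have lb : a' <= b' <= b' by rewrite ab' lexx.
have la : a' <= a' <= b' by rewrite ab' lexx.
have lc : c' <= c' <= d' by rewrite cd' lexx.
have ld : c' <= d' <= d' by rewrite cd' lexx.
pose p := complex.Re l.
have -> : bint F a' b' c' d' =
   sint c' d' (fun v => complex.Re (F b' v) - complex.Re (F a' v) - p * w) -
   sint a' b' (fun u => complex.Im (F u d') - complex.Im (F u c') - p * h).
  have cRe : scont c' d' (fun v => complex.Re (F b' v) - complex.Re (F a' v)).
    by apply: scontB; exact: (hol_scont_Re H').
  have cIm : scont a' b' (fun u => complex.Im (F u d') - complex.Im (F u c')).
    by apply: scontB; exact: (hol_scont_Im H').
  rewrite (sintB cRe (@scont_cst _ _ _ (p * w))) (sintB cIm (@scont_cst _ _ _ (p * h))).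
  rewrite !sint_cst// -/w -/h /bint; ring.
have e_bd : e * (w + h) ^+ 2 = e * (w + h) * h + e * (w + h) * w by ring.
rewrite e_bd (le_trans (ler_normB _ _))// lerD//; apply: sint_bound => //.
- apply: scontB; [apply: scontB|exact: scont_cst]; exact: (hol_scont_Re H').
- move=> v vcd; apply: le_trans (diff b' v a' v lb vcd la vcd).
  rewrite subrr -/w; apply: le_trans (Re_le_nrm _).
  have -> : complex.Re (F b' v - F a' v - l * (w +i* 0)) =
    complex.Re (F b' v) - complex.Re (F a' v) - p * w; last by [].
  by rewrite /p; case: (F b' v) (F a' v) (l) => ? ? [? ?] [? ?] /=; rewrite mulr0 subr0.
- apply: scontB; [apply: scontB|exact: scont_cst]; exact: (hol_scont_Im H').
- move=> u uab; apply: le_trans (diff u d' u c' uab ld uab lc).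
  rewrite subrr -/h; apply: le_trans (Im_le_nrm _).
  have -> : complex.Im (F u d' - F u c' - l * (0 +i* h)) =
    complex.Im (F u d') - complex.Im (F u c') - p * h; last by [].
  by rewrite /p; case: (F u d') (F u c') (l) => ? ? [? ?] [? ?] /=; rewrite mulr0 addr0.
Qed.

End Goursat.

Section Goursat_theorem.
Variable R : realType.
Implicit Types (a b c d : R) (F : R -> R -> R[i]).

Lemma half_pow_small (w r : R) : 0 < r -> exists n0, forall n, (n0 <= n)%N -> w / 2 ^+ n < r.
Proof.
move=> r0; exists (Num.bound (`|w| / r)) => n nn.
have p2 k : (0 : R) < 2 ^+ k by rewrite exprn_gt0.
rewrite ltr_pdivrMr// (le_lt_trans (ler_norm w))// mulrC -ltr_pdivrMr//.
have := archi_boundP (divr_ge0 (normr_ge0 w) (ltW r0)).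
move=> /lt_trans; apply; rewrite (@lt_le_trans _ _ (2 ^+ Num.bound (`|w| / r)))//.
  by rewrite -natrX ltr_nat ltn_expl.
by rewrite ler_weXn2l// ler1n.
Qed.

Lemma nested_point (w : R) (u : nat -> R) : 0 <= w ->
  (forall n, u n <= u n.+1) -> (forall n, u n.+1 + w / 2 ^+ n.+1 <= u n + w / 2 ^+ n) ->
  exists x, forall n, u n <= x <= u n + w / 2 ^+ n.
Proof.
move=> w0 uS vS; pose v n := u n + w / 2 ^+ n.
have uv n : u n <= v n by rewrite lerDl divr_ge0// exprn_ge0.
have um : forall n k, u n <= u (n + k)%N.
  by move=> n; elim=> [|k IH]; rewrite ?addn0// addnS (le_trans IH).
have vm : forall n k, v (n + k)%N <= v n.
  move=> n; elim=> [|k IH]; rewrite ?addn0// addnS (le_trans _ IH)//; exact: vS.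
have umn m n : u m <= v n.
  by rewrite (le_trans (um m n))// addnC (le_trans (uv _)).
have hs : has_sup (range u).
  by split; [exists (u 0%N); exists 0%N|exists (v 0%N) => _ [n _ <-]].
exists (sup (range u)) => n; apply/andP; split.
  by apply: sup_upper_bound => //; exists n.
by apply: ge_sup => [|_ [m _ <-]]; [case: hs|exact: umn].
Qed.

(** If [bint] exceeds [e * (w + h) ^+ 2] on a rectangle, it does so on one of the quarters, since
    [bint] is additive and the bound is divided by four. The common point of the nested rectangles
    contradicts [bint_local]. *)
Lemma goursat F a b c d : a <= b -> c <= d -> hol_rect a b c d F ->
  bint F a b c d = 0.
Proof.
move=> ab cd H; apply/eqP; apply/negPn/negP => J0.
have {}J0 : 0 < `|bint F a b c d| by rewrite normr_gt0.
set J := `|bint F a b c d| in J0.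
pose w := b - a; pose h := d - c.
have w0 : 0 <= w by rewrite subr_ge0.
have h0 : 0 <= h by rewrite subr_ge0.
(* The summand 1 keeps the denominator positive for a rectangle reduced to a point. *)
pose e := J / (2 * ((w + h) ^+ 2 + 1)).
have S0 : 0 < (w + h) ^+ 2 + 1 by rewrite ltr_wpDl// sqr_ge0.
have e0 : 0 < e by rewrite divr_gt0// mulr_gt0.
have eS : e * (w + h) ^+ 2 < J.
  rewrite /e mulrAC ltr_pdivrMr ?mulr_gt0// ltr_pM2l//.
  have := sqr_ge0 (w + h); lra.
pose W n := w / 2 ^+ n; pose L n := h / 2 ^+ n.
have p2 n : (0 : R) < 2 ^+ n by rewrite exprn_gt0.
have W0 n : 0 <= W n by rewrite divr_ge0// ltW.
have L0 n : 0 <= L n by rewrite divr_ge0// ltW.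
have WS n : W n = W n.+1 + W n.+1.
  by rewrite /W exprS; field; rewrite gt_eqF.
have LS n : L n = L n.+1 + L n.+1.
  by rewrite /L exprS; field; rewrite gt_eqF.
pose bad n (p : R * R) := [/\ a <= p.1, p.1 + W n <= b, c <= p.2, p.2 + L n <= d &
  e * (W n + L n) ^+ 2 < `|bint F p.1 (p.1 + W n) p.2 (p.2 + L n)|].
(* The implication is under the existential so that [choice] yields a total function, which can be
   iterated. *)
have step (np : nat * (R * R)) : exists q : R * R, bad np.1 np.2 ->
   [/\ bad np.1.+1 q, np.2.1 <= q.1, q.1 + W np.1.+1 <= np.2.1 + W np.1,
       np.2.2 <= q.2 & q.2 + L np.1.+1 <= np.2.2 + L np.1].
  case: np => n [x y] /=; apply/not_existsP => Hn.
  have [bxy|nb] := pselect (bad n (x, y)); last by apply: (Hn (x, y)).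
  case: (bxy) => /= x1 x2 y1 y2 bxyJ.
  have small x' y' : x' = x \/ x' = x + W n.+1 -> y' = y \/ y' = y + L n.+1 ->
      `|bint F x' (x' + W n.+1) y' (y' + L n.+1)| <= e * (W n.+1 + L n.+1) ^+ 2.
    have split2 (u u' v v' : R) : 0 <= v' -> v = v' + v' -> u' = u \/ u' = u + v' ->
        u <= u' /\ u' + v' <= u + v.
      by move=> v0 -> [->|->]; split; lra.
    move=> /(split2 _ _ _ _ (W0 n.+1) (WS n))[hx1 hx2].
    move=> /(split2 _ _ _ _ (L0 n.+1) (LS n))[hy1 hy2].
    rewrite leNgt; apply/negP => Hb; apply: (Hn (x', y')) => _; split => //=; split => //=.
    - exact: le_trans x1 hx1.
    - exact: le_trans hx2 x2.
    - exact: le_trans y1 hy1.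
    - exact: le_trans hy2 y2.
  have Hs : hol_rect x (x + W n) y (y + L n) F by apply: hol_rect_sub H.
  move: bxyJ; apply/negP; rewrite -leNgt.
  have wn := W0 n.+1; have ln := L0 n.+1.
  have ws := WS n; have ls := LS n.
  rewrite (@bint_splitx _ _ (x + W n.+1))//; last 2 first.
    by rewrite ws; apply/andP; split; lra.
    by rewrite lerDl.
  rewrite (@bint_splity _ _ (y + L n.+1) x)//; last 3 first.
    by rewrite ls; apply/andP; split; lra.
    by rewrite lerDl.
    by apply: (hol_rect_sub _ _ _ _ Hs) => //; rewrite ws; lra.
  rewrite (@bint_splity _ _ (y + L n.+1) (x + W n.+1))//; last 3 first.
    by rewrite ls; apply/andP; split; lra.
    by rewrite ws; lra.
    by apply: (hol_rect_sub _ _ _ _ Hs) => //; rewrite ?ws; lra.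
  have := small x y (or_introl erefl) (or_introl erefl).
  have := small (x + W n.+1) y (or_intror erefl) (or_introl erefl).
  have := small x (y + L n.+1) (or_introl erefl) (or_intror erefl).
  have := small (x + W n.+1) (y + L n.+1) (or_intror erefl) (or_intror erefl).
  have -> : x + W n.+1 + W n.+1 = x + W n by rewrite ws addrA.
  have -> : y + L n.+1 + L n.+1 = y + L n by rewrite ls addrA.
  move: (bint _ _ _ _ _) (bint _ _ _ _ _) (bint _ _ _ _ _) (bint _ _ _ _ _).
  move=> j1 j2 j3 j4 J1 J2 J3 J4.
  have -> : e * (W n + L n) ^+ 2 = 4 * (e * (W n.+1 + L n.+1) ^+ 2).
    by rewrite ws ls; ring.
  have := ler_normD (j1 + j3) (j2 + j4); have := ler_normD j1 j3; have := ler_normD j2 j4.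
  lra.
have [f Hf] := choice step.
pose s := fix s n := if n is m.+1 then f (m, s m) else (a, c).
have bs n : bad n (s n).
  elim: n => [|n IH]; last by have [] := Hf (n, s n) IH.
  by rewrite /bad /W /L /= expr0 !divr1 /w /h !subrKC.
have [x Hx] : exists x, forall n, (s n).1 <= x <= (s n).1 + W n.
  by apply: nested_point => // n; have [] := Hf (n, s n) (bs n).
have [y Hy] : exists y, forall n, (s n).2 <= y <= (s n).2 + L n.
  by apply: nested_point => // n; have [] := Hf (n, s n) (bs n).
have xab : a <= x <= b.
  by have := Hx 0%N; rewrite /= /W expr0 divr1 /w subrKC.
have ycd : c <= y <= d.
  by have := Hy 0%N; rewrite /= /L expr0 divr1 /h subrKC.
have [r r0 Hr] := bint_local H xab ycd e0.
have [n1 N1] := half_pow_small w r0; have [n2 N2] := half_pow_small h r0.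
have [x1 x2 y1 y2 big] := bs (n1 + n2)%N.
have := Hr _ _ _ _ x1 (Hx _) x2 y1 (Hy _) y2.
rewrite !(addrC _ (W _)) !(addrC _ (L _)) !addrK => /(_ (N1 _ _) (N2 _ _)).
rewrite leq_addr leq_addl => /(_ isT isT).
by rewrite !(addrC (W _) (s _).1) !(addrC (L _) (s _).2) leNgt big.
Qed.

End Goursat_theorem.

(** * Mean value and maximum modulus *)

Section Mean_value.
Variable R : realType.
Local Notation C := R[i].

Lemma is_derive_small (g : R -> R) (x l : R) : is_derive x 1 g l ->
  forall e : R, 0 < e -> exists2 r : R, 0 < r &
    forall h, `|h| < r -> `|g (x + h) - g x - l * h| <= e * `|h|.
Proof.
move=> [dg <-] e e0; have := derivableP dg.
move/cvg_ex : dg => [l0 /= Hl] [_ _].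
have -> : 'D_1 g x = l0 by apply/cvg_lim => //; exact: Rhausdorff.
have /Hl : nbhs l0 (ball l0 e) by exact: nbhsx_ballx.
move=> /nbhs_ballP[r r0 Hr]; exists r => // h hr.
have [->|h0] := eqVneq h 0; first by rewrite addr0 subrr mulr0 subrr normr0 mulr0.
have := Hr h; rewrite /ball/= sub0r normrN => /(_ hr h0); rewrite /ball/=.
rewrite [_ *: 1]mulr1 distrC [_ *: _]mulrC (addrC h) => H.
have -> : g (x + h) - g x - l0 * h = ((g (x + h) - g x) / h - l0) * h by field.
by rewrite normrM ler_pM2r ?normr_gt0// ltW.
Qed.

(** The complex exponential of x + iy. It wraps a rectangle of height 2 pi around an annulus. *)
Definition polar (x y : R) : C := (expR x * cos y) +i* (expR x * sin y).

Lemma polarD x y h k : polar (x + h) (y + k) = polar x y * polar h k.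
Proof.
rewrite /polar expRD cosD sinD; congr (_ +i* _); ring.
Qed.

Lemma nrm_polar x y : nrm (polar x y) = expR x.
Proof.
apply/eqP; rewrite -(@eqrXn2 _ 2) ?nrm_ge0 ?expR_ge0// nrm_sqr/=; apply/eqP.
have -> : (expR x * cos y) ^+ 2 + (expR x * sin y) ^+ 2 =
  expR x ^+ 2 * (cos y ^+ 2 + sin y ^+ 2) by ring.
by rewrite cos2Dsin2 mulr1.
Qed.

Lemma polar_small (e : R) : 0 < e -> exists2 r : R, 0 < r &
  forall h k, `|h| < r -> `|k| < r ->
    nrm (polar h k - 1 - (h +i* k)) <= e * (`|h| + `|k|).
Proof.
move=> e0; pose e1 := Num.min (e / 8) 1.
have e10 : 0 < e1 by rewrite lt_min divr_gt0//=.
have e11 : e1 <= 1 by rewrite ge_min lexx orbT.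
have e18 : 8 * e1 <= e.
  by rewrite mulrC -ler_pdivlMr// ge_min lexx.
have [r1 r10 H1] := is_derive_small (is_derive_expR 0) e10.
have [r2 r20 H2] := is_derive_small (is_derive_cos 0) e10.
have [r3 r30 H3] := is_derive_small (is_derive_sin 0) e10.
exists (Num.min (Num.min r1 (e1 / 2)) (Num.min r2 r3)).
  by rewrite !lt_min r10 r20 r30 divr_gt0.
move=> h k; rewrite !lt_min => /andP[/andP[/H1 h1 he] _] /andP[_ /andP[/H2 k2 /H3 k3]].
move: h1 k2 k3; rewrite !add0r expR0 cos0 sin0 oppr0 mul0r !mul1r oppr0 !addr0.
move=> h1 k2 k3; apply: (le_trans (nrm_le _)) => /=.
have ck : `|cos k| <= 1 by rewrite ler_norml cos_geN1 cos_le1.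
have sk : `|sin k| <= 2 * `|k|.
  have := ler_normD (sin k - k) k; rewrite subrK.
  have := normr_ge0 k; nra.
have eh : `|expR h - 1| <= e1.
  have := ler_normD (expR h - 1 - h) h; rewrite subrK.
  have := normr_ge0 h; nra.
have h1' : `|1 + h| <= 2.
  have := ler_normD 1 h; rewrite normr1; lra.
have -> : expR h * cos k - 1 - h = (expR h - 1 - h) * cos k + (1 + h) * (cos k - 1) by ring.
have -> : expR h * sin k - 0 - k = (expR h - 1) * sin k + (sin k - k) by ring.
have := ler_normD ((expR h - 1 - h) * cos k) ((1 + h) * (cos k - 1)).
have := ler_normD ((expR h - 1) * sin k) (sin k - k).
have : `|(expR h - 1 - h) * cos k| <= e1 * `|h| * 1 by rewrite normrM ler_pM.
have : `|(1 + h) * (cos k - 1)| <= 2 * (e1 * `|k|) by rewrite normrM ler_pM.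
have : `|(expR h - 1) * sin k| <= e1 * (2 * `|k|) by rewrite normrM ler_pM.
have := normr_ge0 h; have := normr_ge0 k.
have : 8 * e1 * `|h| <= e * `|h| by rewrite ler_wpM2r.
have : 8 * e1 * `|k| <= e * `|k| by rewrite ler_wpM2r.
have : 0 <= e1 * `|h| by rewrite mulr_ge0// ltW.
have : 0 <= e1 * `|k| by rewrite mulr_ge0// ltW.
lra.
Qed.

Lemma hol_polar (f : C -> C) (z0 : C) (a b c d : R) :
  (forall z, nrm (z - z0) <= expR b -> cdiff f z) ->
  hol_rect a b c d (fun x y => f (z0 + polar x y)).
Proof.
move=> df x y /andP[ax xb] _; pose w0 := z0 + polar x y.
have [|q cq [r1 r10 H1]] := df w0.
  by rewrite /w0 addrAC subrr add0r nrm_polar ler_expR.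
exists (q w0 * polar x y) => e e0.
pose n := expR x; have n0 : 0 < n := expR_gt0 x.
pose Q := nrm (q w0) + 1; have Q0 : 0 < Q by rewrite ltr_wpDl// nrm_ge0.
pose e1 := Num.min 1 (e / 2 / (Q * n)).
have e10 : 0 < e1 by rewrite lt_min ltr01 !divr_gt0// mulr_gt0.
have [r2 r20 H2] := polar_small e10.
have [r3 r30 H3] := cq (e / 2 / (3 * n)) (divr_gt0 (divr_gt0 e0 (ltr0Sn _ 1)) (mulr_gt0 (ltr0Sn _ 2) n0)).
have m0 : 0 < Num.min r1 r3 / (6 * n) by rewrite divr_gt0 ?lt_min ?r10// mulr_gt0.
exists (Num.min r2 (Num.min r1 r3 / (6 * n))); first by rewrite lt_min r20.
move=> x' y' _ _; rewrite !lt_min => /andP[hx hx'] /andP[hy hy'].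
set h := x' - x in hx hx' *; set k := y' - y in hy hy' *.
have E1 : polar x' y' = polar x y * polar h k by rewrite -polarD /h /k !subrKC.
have S := H2 h k hx hy.
set D := polar h k - 1 - (h +i* k) in S.
set s := `|h| + `|k| in S *.
have s0 : 0 <= s by rewrite addr_ge0.
pose w := z0 + polar x' y'.
have ww : w - w0 = polar x y * (D + (h +i* k)).
  rewrite /w /w0 E1 /D; ring.
have hk : nrm (h +i* k) <= s by exact: nrm_le.
have Ds : nrm D <= s.
  by rewrite (le_trans S)// ler_piMl// ge_min lexx.
have wws : nrm (w - w0) <= n * (2 * s).
  rewrite ww nrmM nrm_polar ler_pM2l//; have := nrmD D (h +i* k); lra.
have wwm : nrm (w - w0) < Num.min r1 r3.
  apply: le_lt_trans wws _.
  have : s < 2 * (Num.min r1 r3 / (6 * n)) by rewrite /s; lra.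
  have -> : 2 * (Num.min r1 r3 / (6 * n)) = Num.min r1 r3 / 3 / n by field; rewrite gt_eqF.
  rewrite ltr_pdivlMr// => sn.
  have : 0 < Num.min r1 r3 by rewrite lt_min r10.
  lra.
move: (wwm); rewrite lt_min => /andP[/H1 F1 /H3 F3].
have -> : f (z0 + polar x' y') - f (z0 + polar x y) - q w0 * polar x y * (h +i* k) =
   (q w - q w0) * (w - w0) + q w0 * polar x y * D.
  have PD : polar x y * D = (w - w0) - polar x y * (h +i* k) by rewrite ww; ring.
  by rewrite -/w -/w0 F1 -[q w0 * polar x y * D]mulrA PD; ring.
rewrite (le_trans (nrmD _ _))// !nrmM nrm_polar -/n.
have T1 : nrm (q w - q w0) * nrm (w - w0) <= e / 2 / (3 * n) * (n * (2 * s)).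
  by rewrite ler_pM ?nrm_ge0// ltW.
have T1' : e / 2 / (3 * n) * (n * (2 * s)) = e / 3 * s by field; rewrite gt_eqF.
have T2 : nrm (q w0) * n * nrm D <= Q * n * (e1 * s).
  apply: ler_pM => //; [|exact: nrm_ge0|by rewrite ler_pM2r// lerDl].
  by rewrite mulr_ge0 ?nrm_ge0// ltW.
have T3 : Q * n * (e1 * s) <= e / 2 * s.
  rewrite mulrA ler_wpM2r// mulrC -ler_pdivlMr ?mulr_gt0//.
  by rewrite ge_min lexx orbT.
have : 0 <= e * s by rewrite mulr_ge0// ltW.
lra.
Qed.

(** By periodicity the two horizontal sides of the rectangle contribute equally and cancel in
    [goursat]. Hence the mean over the circle of radius exp x does not depend on x, and it tends to
    the value at the centre as x decreases. *)
Lemma mean_value (f : C -> C) (z0 : C) (b : R) :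
  (forall z, nrm (z - z0) <= expR b -> cdiff f z) ->
  sint 0 (2 * pi) (fun t => complex.Re (f (z0 + polar b t))) = 2 * pi * complex.Re (f z0).
Proof.
move=> df; have p0 : (0 : R) <= 2 * pi by rewrite mulr_ge0// pi_ge0.
pose M x := sint 0 (2 * pi) (fun t => complex.Re (f (z0 + polar x t))).
have sc a : a <= b -> scont 0 (2 * pi) (fun t => complex.Re (f (z0 + polar a t))).
  move=> ab; apply: (@hol_scont_Re _ a b 0 (2 * pi) (fun x y => f (z0 + polar x y))).
    exact: hol_polar.
  by rewrite lexx.
have Mb a : a <= b -> M b = M a.
  move=> ab; have H := @hol_polar f z0 a b 0 (2 * pi) df.
  have E : M b - M a - (sint a b (fun x => complex.Im (f (z0 + polar x (2 * pi)))) -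
    sint a b (fun x => complex.Im (f (z0 + polar x 0)))) = 0.
    exact: etrans (esym (bintE ab p0 H)) (goursat ab p0 H).
  move: E.
  have -> : sint a b (fun x => complex.Im (f (z0 + polar x (2 * pi)))) =
            sint a b (fun x => complex.Im (f (z0 + polar x 0))).
    apply: sint_ext => x _; congr (complex.Im (f (z0 + _))).
    by rewrite /polar mulr2n mulrDl mul1r -[pi + pi]add0r addrA;
       rewrite !(cosDpi,sinDpi) !opprK.
  by rewrite subrr subr0 => /eqP; rewrite subr_eq0 => /eqP.
apply/eqP; rewrite -/(M b) -subr_eq0; apply/eqP/normr0_eq0/eqP.
rewrite eq_le normr_ge0 andbT; apply/ler_addgt0Pr => e e0; rewrite add0r.
have P0 : (0 : R) < 2 * pi + 1 by rewrite ltr_wpDl.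
have [|d d0 Hd] := cdiff_cont (df z0 _) (divr_gt0 e0 P0).
  by rewrite subrr nrm0 expR_ge0.
pose a := Num.min b (ln (d / 2)).
have ab : a <= b by rewrite ge_min lexx.
have ad : expR a < d.
  apply: (@le_lt_trans _ _ (d / 2)); last by lra.
  rewrite -[d / 2]lnK ?posrE ?divr_gt0// ler_expR.
  by rewrite ge_min lexx orbT.
rewrite (Mb a ab) /M.
have -> : 2 * pi * complex.Re (f z0) = sint 0 (2 * pi) (fun=> complex.Re (f z0)).
  by rewrite sint_cst// subr0 mulrC.
rewrite -sintB; [|exact: sc|exact: scont_cst].
apply: (@le_trans _ _ (e / (2 * pi + 1) * (2 * pi - 0))).
  apply: sint_bound => //; first by apply: scontB; [exact: sc|exact: scont_cst].
  move=> t _; apply: (@le_trans _ _ (nrm (f (z0 + polar a t) - f z0))).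
    by apply: le_trans (Re_le_nrm _); case: (f _) (f z0) => ? ? [].
  by apply/ltW/Hd; rewrite addrAC subrr add0r nrm_polar.
rewrite subr0 mulrAC ler_pdivrMr// ler_wpM2l ?(ltW e0)// lerDl//.
Qed.

(** Equality is asserted only at angle 0, the rightmost point of the circle, which is the point that
    [max_modulus] exploits. *)
Lemma mean_value_max (f : C -> C) (z0 : C) (r : R) : 0 < r ->
  (forall z, nrm (z - z0) <= r -> cdiff f z) ->
  (forall z, nrm (z - z0) = r -> complex.Re (f z) <= complex.Re (f z0)) ->
  complex.Re (f (z0 + r%:C)) = complex.Re (f z0).
Proof.
move=> r0 df fm; pose b := ln r.
have eb : expR b = r by rewrite lnK.
have p0 : (0 : R) < 2 * pi by rewrite mulr_gt0// pi_gt0.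
have pb : polar b 0 = r%:C by rewrite /polar eb cos0 sin0 mulr1 mulr0.
set m := complex.Re (f z0).
pose g t := complex.Re (f (z0 + polar b t)).
have gm t : g t <= m.
  by apply: fm; rewrite addrAC subrr add0r nrm_polar.
have sg : scont 0 (2 * pi) g.
  apply: (@hol_scont_Re _ b b 0 (2 * pi) (fun x y => f (z0 + polar x y))).
    by apply: hol_polar => z; rewrite eb; exact: df.
  by rewrite lexx.
have Eg : sint 0 (2 * pi) g = 2 * pi * m by apply: mean_value => z; rewrite eb; exact: df.
apply/eqP; rewrite -pb -/(g 0) eq_le gm/= leNgt; apply/negP => gl.
have e0 : 0 < (m - g 0) / 2 by rewrite divr_gt0// subr_gt0.
have [|d d0 Hd] := (scontP _ _ _).1 sg 0 _ _ e0; first by rewrite lexx ltW.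
(* A deficit at angle 0 persists on the whole of [0, v], with half its size, and pulls the mean
   strictly below m. *)
pose v := Num.min (d / 2) (2 * pi).
have v0 : 0 < v by rewrite lt_min divr_gt0.
have vp : v <= 2 * pi by rewrite ge_min lexx orbT.
have vd : v < d by rewrite gt_min; apply/orP; left; lra.
have le_sint (x y k : R) : x <= y -> scont x y g ->
    (forall t, x <= t <= y -> g t <= k) -> sint x y g <= k * (y - x).
  move=> xy sg' gk; rewrite -sint_cst//; apply: le_Rintegral => //.
  - exact: scont_integrable.
  - apply: scont_integrable; exact: scont_cst.
move: Eg; rewrite (@sint_split _ v) ?(ltW v0)//.
have := @le_sint 0 v ((m + g 0) / 2) (ltW v0).
have := @le_sint v (2 * pi) m vp.
move=> /(_ _ (fun t _ => gm t)) H1 H2 Eg.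
have := H1 (scont_sub (ltW v0) (lexx _) sg).
have {H2} := H2 (scont_sub (lexx _) vp sg).
have H3 t : 0 <= t <= v -> g t <= (m + g 0) / 2.
  move=> /andP[t0 tv]; have := Hd t; rewrite t0 (le_trans tv)// subr0 ger0_norm//.
  move=> /(_ isT (le_lt_trans tv vd)); rewrite ltr_norml => /andP[_]; lra.
move=> /(_ H3) H4 H5.
have : 0 < (m - g 0) * v by rewrite mulr_gt0// subr_gt0.
lra.
Qed.

End Mean_value.

Section Max_modulus.
Variable R : realType.
Local Notation C := R[i].
Implicit Types (K : set C) (f : C -> C) (z w s : C).

Definition bounded_closed K := (exists M : R, forall z, K z -> nrm z <= M) /\
  (forall z, (forall d : R, 0 < d -> exists2 w, K w & nrm (w - z) < d) -> K z).

Lemma bounded_closed_compact K : bounded_closed K -> compact K.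
Proof. by move=> [[M KM] Kc]; exact: (compact_bounded_closed KM). Qed.

Lemma ccont_nrm K f : (forall z, K z -> ccont f z) -> forall z, K z -> forall e : R, 0 < e ->
  exists2 d : R, 0 < d & forall w, K w -> nrm (w - z) < d -> `|nrm (f w) - nrm (f z)| < e.
Proof.
move=> cf z Kz e e0; have [d d0 H] := cf z Kz e e0; exists d => // w Kw wz.
by apply: le_lt_trans (nrm_dist _ _) _; exact: H.
Qed.

Lemma Re_conjM z : complex.Re ((z^*)%C * z) = nrm z ^+ 2.
Proof. by rewrite nrm_sqr; case: z => a b /=; ring. Qed.

Lemma Re_realM (x : R) z : complex.Re (x%:C * z) = x * complex.Re z.
Proof. by case: z => a b /=; ring. Qed.

Lemma max_modulus K f : bounded_closed K -> (forall z, K z -> ccont f z) ->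
  (forall z, K z -> nrm (f z) <= 1 \/
    exists2 d : R, 0 < d & forall w, nrm (w - z) < d -> K w /\ cdiff f w) ->
  forall z, K z -> nrm (f z) <= 1.
Proof.
move=> bK cf H z1 Kz1; rewrite leNgt; apply/negP => f1.
have cK := bounded_closed_compact bK.
have [|c Kc Hc] := compact_max cK _ (ccont_nrm cf); first by exists z1.
set m := nrm (f c) in Hc; have m1 : 1 < m by apply: lt_le_trans f1 (Hc _ Kz1).
pose K' : set C := [set z | K z /\ nrm (f z) = m].
have cK' : compact K'.
  have [[M KM] Kcl] := bK; apply: (@compact_bounded_closed _ _ M).
    by move=> z [/KM].
  move=> z Hz; have Kz : K z by apply: Kcl => d /Hz[w [Kw _] wz]; exists w.
  split => //; apply/eqP/negPn/negP => neq.
  have e0 : 0 < `|m - nrm (f z)| by rewrite normr_gt0 subr_eq0 eq_sym.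
  have [d d0 dH] := ccont_nrm cf Kz e0.
  have [w [Kw fw] wz] := Hz d d0.
  by have := dH w Kw wz; rewrite fw ltxx.
(* Among the points where |f| is maximal, the one with the largest real part. If it were interior,
   [mean_value_max] would produce another one further to the right. *)
have [||z0 [Kz0 fz0] Hz0] := @compact_max _ K' (fun z => complex.Re z) cK'.
- by exists c.
- apply: (@lipschitz_cont _ _ _ 1) => w z _ _; rewrite mul1r.
  by apply: le_trans (Re_le_nrm _); case: w z => ? ? [].
have [|[d d0 Hd]] := H z0 Kz0; first by rewrite fz0 leNgt m1.
pose r := d / 2; have r0 : 0 < r by rewrite divr_gt0.
have rd : r < d by rewrite /r; lra.
have mp : 0 < m by apply: lt_trans m1.
(* The unimodular factor that turns [f z0] into the positive number m, so that |f| can be compared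
   with a real part. *)
pose u : C := (m^-1)%:C * (f z0)^*%C.
have nu : nrm u = 1.
  rewrite /u nrmM nrm_real nrm_conj fz0 gtr0_norm ?invr_gt0// mulVf// gt_eqF//.
have gz0 : complex.Re (u * f z0) = m.
  by rewrite /u -mulrA Re_realM Re_conjM fz0 expr2 mulKf// gt_eqF.
have gle z : K z -> complex.Re (u * f z) <= nrm (f z).
  move=> Kz; rewrite (le_trans (ler_norm _))// (le_trans (Re_le_nrm _))//.
  by rewrite nrmM nu mul1r.
have := @mean_value_max R (fun z => u * f z) z0 r r0.
rewrite gz0 => /(_ _ _) E.
have Kr : K (z0 + r%:C).
  by apply: (Hd _ _).1; rewrite addrAC subrr add0r nrm_real gtr0_norm.
have {}E : complex.Re (u * f (z0 + r%:C)) = m.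
  apply: E => z zr.
    apply: cdiffM; first exact: cdiff_cst.
    by apply: (Hd _ _).2; exact: le_lt_trans rd.
  have Kz : K z by apply: (Hd _ _).1; rewrite zr.
  by apply: le_trans (gle _ Kz) (Hc _ Kz).
have : K' (z0 + r%:C).
  by split => //; apply/eqP; rewrite eq_le Hc//= -E gle.
move=> /Hz0; case: (z0) => x y /=; rewrite gerDl leNgt r0 //.
Qed.

Lemma ge1_expn_unbounded (x A : R) : (forall n, x ^+ n <= A) -> x <= 1.
Proof.
move=> H; rewrite leNgt; apply/negP => x1.
have y0 : 0 < x - 1 by rewrite subr_gt0.
have bern n : 1 + n%:R * (x - 1) <= x ^+ n.
  elim: n => [|n IH]; first by rewrite mul0r addr0 expr0.
  rewrite exprS; have : x * (1 + n%:R * (x - 1)) <= x * x ^+ n.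
    by rewrite ler_pM2l//; lra.
  apply: le_trans; rewrite -natr1.
  have : 0 <= n%:R * (x - 1) * (x - 1) by rewrite !mulr_ge0 ?(ltW y0).
  lra.
pose n := Num.bound (`|A| / (x - 1)).
have := archi_boundP (divr_ge0 (normr_ge0 A) (ltW y0)).
rewrite -/n ltr_pdivrMr// => An; have := bern n; have := H n.
have := ler_norm A; lra.
Qed.

(* Removable point s: apply the maximum principle to f^n (z - s) and let n grow. *)
Lemma max_modulus_removable K f s : bounded_closed K -> (forall z, K z -> ccont f z) -> ccont f s ->
  (forall z, K z -> nrm (f z) <= 1 \/ exists2 d : R, 0 < d &
      forall w, nrm (w - z) < d -> K w /\ (w != s -> cdiff f w)) ->
  forall z, K z -> z != s -> nrm (f z) <= 1.
Proof.
move=> bK cf cfs H z Kz zs.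
have [[M KM] _] := bK.
pose D := `|M| + nrm s + 1.
have D0 : 0 < D by rewrite ltr_wpDl// addr_ge0// nrm_ge0.
have Dz w : K w -> nrm (w - s) <= D.
  move=> Kw; have := nrm_sub w s; have := KM _ Kw; have := ler_norm M.
  rewrite /D; lra.
have Dg : D%:C != 0 :> C by rewrite -nrm_gt0 nrm_real gtr0_norm.
apply: (@ge1_expn_unbounded _ (D / nrm (z - s))) => n.
have zs0 : 0 < nrm (z - s) by rewrite nrm_gt0 subr_eq0.
rewrite ler_pdivlMr//.
pose g w := (D^-1)%:C * (f w ^+ n * (w - s)).
have ng w : nrm (g w) = nrm (f w) ^+ n * nrm (w - s) / D.
  by rewrite /g !nrmM nrm_real nrmX gtr0_norm ?invr_gt0// mulrC.
have cX w : cdiff f w -> cdiff g w.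
  move=> df; apply: cdiffM; first exact: cdiff_cst.
  apply: cdiffM; first exact: cdiffX.
  by apply: cdiffD; [exact: cdiff_id|exact: cdiff_cst].
have cfX w : ccont f w -> ccont (fun w => f w ^+ n) w.
  move=> cw; elim: n {g ng cX} => [|n IH].
    by apply: (ccont_ext ltr01 _ (@ccont_cst _ 1 w)) => u _; rewrite expr0.
  by apply: (ccont_ext ltr01 _ (ccontM cw IH)) => u _; rewrite exprS.
(* At s the factor w - s makes g differentiable: up to a constant, its difference quotient is f^n,
   which is continuous there. *)
have cs : cdiff g s.
  apply: cdiffM; first exact: cdiff_cst.
  exists (fun w => f w ^+ n); first exact: cfX.
  by exists 1 => // w _; rewrite subrr mulr0 subr0.
suff : nrm (g z) <= 1 by rewrite ng ler_pdivrMr// mul1r.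
apply: (max_modulus bK) Kz => [w Kw|w Kw].
  apply: ccontM; first exact: ccont_cst.
  apply: ccontM; first by apply/cfX/cf.
  by apply: ccontD; [exact: ccont_id|exact: ccont_cst].
have [f1|[d d0 Hd]] := H w Kw; [left|right].
  rewrite ng ler_pdivrMr// mul1r (le_trans _ (Dz _ Kw))//.
  by rewrite ler_piMl ?nrm_ge0// exprn_ile1 ?nrm_ge0.
exists d => // u /Hd[Ku df]; split => //.
by have [->//|us] := eqVneq u s; apply/cX/df.
Qed.

End Max_modulus.

(** * Holomorphy of the inverse of an injective map *)

Section Conformal_inverse.
Variable R : realType.
Local Notation C := R[i].
Implicit Types (f phi : C -> C) (z w s : C) (r : R).

Lemma bounded_closed_ball z0 r : bounded_closed [set z : C | nrm (z - z0) <= r].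
Proof.
split.
  exists (nrm z0 + r) => z /= zr; have := nrm_lb z z0; lra.
move=> z H /=; apply/ler_addgt0Pr => d d0; have [w /= wr wz] := H d d0.
have := nrm_tri w z z0; rewrite (nrmB z w); lra.
Qed.

Lemma bounded_closed_circle z0 r : bounded_closed [set z : C | nrm (z - z0) = r].
Proof.
have [[M HM] Hc] := bounded_closed_ball z0 r; split.
  by exists M => z /= zr; apply: HM; rewrite /= zr.
move=> z H /=; apply/eqP; rewrite eq_le; apply/andP; split.
  by apply: Hc => d d0; have [w /= wr wz] := H d d0; exists w; rewrite //= wr.
apply/ler_addgt0Pr => d d0; have [w /= wr wz] := H d d0.
have := nrm_tri z w z0; lra.
Qed.

Lemma circle_min f z0 r : 0 < r -> (forall z, nrm (z - z0) = r -> ccont f z) ->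
  exists2 c, nrm (c - z0) = r & forall z, nrm (z - z0) = r -> nrm (f c) <= nrm (f z).
Proof.
move=> r0 cf.
have cK := bounded_closed_compact (bounded_closed_circle z0 r).
have [||c Kc H] := @compact_min _ _ (fun z => nrm (f z)) cK.
- by exists (z0 + r%:C); rewrite /= addrAC subrr add0r nrm_real gtr0_norm.
- by apply: ccont_nrm => z; exact: cf.
by exists c.
Qed.

Lemma ccont_comp f (g : C -> C) z : ccont g z -> ccont f (g z) -> ccont (fun w => f (g w)) z.
Proof.
move=> cg cf e e0; have [d d0 H] := cf e e0; have [d1 d10 H1] := cg d d0.
by exists d1 => // w wz; apply/H/H1.
Qed.

Lemma small_is_derive (g : R -> R) (x : R) :
  (forall e : R, 0 < e -> exists2 r : R, 0 < r & forall h, `|h| < r -> `|g (x + h) - g x| <= e * `|h|) ->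
  is_derive x 1 g 0.
Proof.
move=> H.
have cg : (fun h => h^-1 *: (g (h *: 1 + x) - g x)) @ (0 : R)^' --> (0 : R).
  move=> B /nbhs_ballP[e /= e0 eB].
  have [r r0 Hr] := H (e / 2) (divr_gt0 e0 (ltr0Sn _ 1)).
  apply/nbhs_ballP; exists r => //= h; rewrite /ball/= sub0r normrN => hr h0.
  apply: eB; rewrite /ball/= sub0r normrN [_ *: 1]mulr1 (addrC h).
  rewrite [_ *: _]mulrC normrM normfV ltr_pdivrMr ?normr_gt0//.
  apply: le_lt_trans (Hr h hr) _; rewrite ltr_pM2r ?normr_gt0//; lra.
by split; [apply/cvg_ex; exists 0|apply/cvg_lim => //; exact: Rhausdorff].
Qed.

Lemma zero_derivative_cst f z0 r :
  (forall w, nrm (w - z0) < r -> exists2 q : C -> C, ccont q w & q w = 0 /\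
    exists2 d : R, 0 < d & forall u, nrm (u - w) < d -> f u - f w = q u * (u - w)) ->
  forall w, nrm (w - z0) < r -> f w = f z0.
Proof.
move=> H w wr; set v := w - z0 in wr.
(* With this factor the increment of g over [0, 1] is the square of [nrm (f w - f z0)], so the mean
   value theorem of the real line is enough. *)
pose u : C := ((f w - f z0)^*)%C.
pose g t := complex.Re (u * f (z0 + t%:C * v)).
have dg (t : R) : 0 <= t <= 1 -> is_derive t 1 g 0.
  move=> /andP[t0 t1]; apply: small_is_derive => e e0.
  have [|q cq [q0 [d d0 Hd]]] := H (z0 + t%:C * v).
    rewrite addrAC subrr add0r nrmM nrm_real ger0_norm//.
    by apply: le_lt_trans _ wr; rewrite ler_piMl// nrm_ge0.
  have k0 : 0 < nrm u * nrm v + 1 by rewrite ltr_wpDl// mulr_ge0// nrm_ge0.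
  have [d1 d10 H1] := cq (e / (nrm u * nrm v + 1)) (divr_gt0 e0 k0).
  have v0 : 0 < nrm v + 1 by rewrite ltr_wpDl// nrm_ge0.
  exists (Num.min d d1 / (nrm v + 1)); first by rewrite divr_gt0// lt_min d0.
  move=> h; rewrite ltr_pdivlMr// => hh.
  set p := z0 + (t + h)%:C * v; set p0 := z0 + t%:C * v.
  have pp : p - p0 = h%:C * v.
    by rewrite /p /p0 rmorphD/=; ring.
  have : nrm (p - p0) < Num.min d d1.
    apply: le_lt_trans _ hh; rewrite pp nrmM nrm_real ler_wpM2l//.
    by rewrite lerDl.
  rewrite lt_min => /andP[/Hd F /H1 Q].
  rewrite /g -/p -/p0.
  have -> : complex.Re (u * f p) - complex.Re (u * f p0) = complex.Re (u * (f p - f p0)).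
    by case: (u) (f p) (f p0) => [? ?] [? ?] [? ?] /=; ring.
  apply: le_trans (Re_le_nrm _) _; rewrite F pp !nrmM nrm_real.
  move: Q; rewrite q0 subr0 ltr_pdivlMr// => /ltW Q.
  have -> : nrm u * (nrm (q p) * (`|h| * nrm v)) = (nrm (q p) * (nrm u * nrm v)) * `|h| by ring.
  rewrite ler_wpM2r//; apply: le_trans _ Q; rewrite ler_wpM2l ?nrm_ge0// lerDl//.
have [||c _] := @MVT_segment R g (fun=> 0) 0 1 ler01.
- move=> x; rewrite in_itv/= => /andP[x0 x1]; apply: dg; rewrite !ltW//.
- apply: derivable_within_continuous => x; rewrite in_itv/= => x01.
  by have [] := dg x x01.
rewrite mul0r /g rmorph1 rmorph0 mul1r mul0r addr0 /v subrKC => E.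
apply/eqP; rewrite -subr_eq0 -nrm_eq0 -sqrf_eq0 -Re_conjM -/u; apply/eqP.
by rewrite -[RHS]E; case: (u) (f w) (f z0) => [? ?] [? ?] [? ?] /=; ring.
Qed.

Variables (G : set C) (phi : C -> C).
Hypothesis dphi : forall z, G z -> cdiff phi z.
Hypothesis iphi : forall z w, G z -> G w -> phi z = phi w -> z = w.

(** By injectivity |phi - phi z0| has a positive minimum m on the circle. If a value w within m / 2
    of phi z0 were omitted, 1 / (phi - w) would be larger at the centre than on the circle. *)
Lemma open_mapping z0 r : 0 < r -> (forall z, nrm (z - z0) <= r -> G z) ->
  exists2 e : R, 0 < e & forall w, nrm (w - phi z0) < e ->
    exists2 z, nrm (z - z0) <= r & phi z = w.
Proof.
move=> r0 Gr.
have sub z (c : C) : G z -> cdiff (fun w => phi w + c) z.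
  by move=> Gz; apply: cdiffD; [exact: dphi|exact: cdiff_cst].
have [|c cr Hc] := @circle_min (fun z => phi z + (- phi z0)) z0 r r0.
  by move=> z zr; apply/cdiff_cont/sub/Gr; rewrite zr.
set m := nrm _ in Hc.
have m0 : 0 < m.
  rewrite nrm_gt0 subr_eq0; apply/eqP => /iphi E.
  have : c = z0 by apply: E; apply: Gr; rewrite ?cr ?subrr ?nrm0 ?(ltW r0).
  by move=> cz; move: cr; rewrite cz subrr nrm0 => r00; rewrite -r00 ltxx in r0.
exists (m / 2); first by rewrite divr_gt0.
move=> w wm; have [//|nw] := pselect (exists2 z, nrm (z - z0) <= r & phi z = w).
have nz z : nrm (z - z0) <= r -> phi z + - w != 0.
  by move=> zr; rewrite subr_eq0; apply/eqP => zw; apply: nw; exists z.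
pose f z := (m / 2)%:C * (phi z + (- w))^-1.
have m20 : 0 < m / 2 by rewrite divr_gt0.
have df z : nrm (z - z0) <= r -> cdiff f z.
  move=> zr; apply: cdiffM; first exact: cdiff_cst.
  by apply: cdiffV; [exact/sub/Gr|exact: nz].
have nf z : nrm (f z) = m / 2 / nrm (phi z - w).
  by rewrite /f nrmM nrm_real nrmV gtr0_norm.
have : nrm (f z0) <= 1.
  apply: (max_modulus (bounded_closed_ball z0 r)) => /=.
  - by move=> z zr; exact/cdiff_cont/df.
  - move=> z zr; have [zr1|zr1] := eqVneq (nrm (z - z0)) r; [left|right].
      rewrite nf ler_pdivrMr; last by rewrite nrm_gt0 nz.
      have := Hc z zr1; have := nrm_tri w (phi z) (phi z0); rewrite -/(phi z - phi z0); lra.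
    exists (r - nrm (z - z0)); first by rewrite subr_gt0 lt_neqAle zr1.
    move=> u uz; have ur : nrm (u - z0) <= r by have := nrm_tri z u z0; lra.
    by split => //; exact: df.
  - by rewrite subrr nrm0 ltW.
rewrite nf nrmB ler_pdivrMr ?mul1r; first by rewrite leNgt wm.
by rewrite nrmB nrm_gt0 nz// subrr nrm0 ltW.
Qed.


Hypothesis Gopen : forall z, G z -> exists2 d : R, 0 < d & forall w, nrm (w - z) < d -> G w.

Lemma open_ball z0 : G z0 -> exists2 r : R, 0 < r & forall z, nrm (z - z0) <= r -> G z.
Proof.
move=> /Gopen[d d0 H]; exists (d / 2); first by rewrite divr_gt0.
by move=> z zd; apply: H; lra.
Qed.

(* If q z0 = 0, then for z' near z0 the quotient Q z = (phi z - phi z') / (z - z') is small at z0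
   but not on a circle around z0, so it vanishes inside, which by injectivity happens only at z',
   where its value is the derivative of phi. *)
Lemma injective_deriv_neq0 z0 (q : C -> C) (d0 : R) : G z0 -> ccont q z0 -> 0 < d0 ->
  (forall w, nrm (w - z0) < d0 -> phi w - phi z0 = q w * (w - z0)) -> q z0 != 0.
Proof.
move=> Gz0 cq d00 Hq; apply/eqP => q0.
have [r r0 Gr] := open_ball Gz0.
have rG z : nrm (z - z0) = r -> G z by move=> zr; apply: Gr; rewrite zr.
have [|c cr Hc] := @circle_min (fun z => phi z + (- phi z0)) z0 r r0.
  move=> z zr; apply: cdiff_cont; apply: cdiffD; [exact/dphi/rG|exact: cdiff_cst].
set m := nrm _ in Hc.
have m0 : 0 < m.
  rewrite nrm_gt0 subr_eq0; apply/eqP => /iphi E.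
  have : c = z0 by apply: E; apply: Gr; rewrite ?cr ?subrr ?nrm0 ?(ltW r0).
  by move=> cz; move: cr; rewrite cz subrr nrm0 => r00; rewrite -r00 ltxx in r0.
have [d1 d10 H1] := cdiff_cont (dphi Gz0) (divr_gt0 m0 (ltr0Sn _ 1)).
(* A lower bound for |Q| on the circle: its numerator is at least m / 2 and |z - w| is at most 2
   r. *)
pose k := m / (4 * r); have k0 : 0 < k by rewrite divr_gt0// mulr_gt0.
have [d2 d20 H2] := cq k k0.
pose rho := Num.min (Num.min d0 d1) (Num.min d2 r).
have rho0 : 0 < rho by rewrite !lt_min d00 d10 d20.
(* Once phi' vanishes on a whole disk around z0, phi is constant there, against injectivity. *)
suff Z w : nrm (w - z0) < rho -> exists2 p : C -> C, ccont p w & p w = 0 /\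
    exists2 d : R, 0 < d & forall u, nrm (u - w) < d -> phi u - phi w = p u * (u - w).
  have := zero_derivative_cst Z.
  pose w := z0 + (rho / 2)%:C.
  have rho2 : 0 < rho / 2 by rewrite divr_gt0.
  have wr : nrm (w - z0) = rho / 2 by rewrite addrAC subrr add0r nrm_real gtr0_norm.
  move=> /(_ w); rewrite wr => /(_ _)/iphi E.
  have : w = z0.
    apply: E => //; last by lra.
    apply: Gr; rewrite wr; have : rho <= r by rewrite !ge_min lexx !orbT.
    lra.
  by move=> wz; rewrite wz subrr nrm0 in wr; rewrite -wr ltxx in rho2.
rewrite !lt_min => /andP[/andP[w0 w1] /andP[w2 wr]].
have Gw : G w by apply: Gr; exact: ltW.
have [p cp [d d0' Hp]] := dphi Gw.
exists p => //; split; last by exists d.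
(* At w = z0 both p and q are difference quotients of phi: they agree off z0, hence at z0 by
   continuity. *)
have [wz|wz] := eqVneq w z0.
  pose mm := Num.min d d0.
  apply/eqP; rewrite -nrm_eq0 eq_le nrm_ge0 andbT; apply/ler_addgt0Pr => e e0.
  have e20 : 0 < e / 2 by rewrite divr_gt0.
  have [d3 d30 H3] := cq _ e20; have [d4 d40 H4] := cp _ e20.
  pose t := Num.min (Num.min d d0) (Num.min d3 d4).
  have t0 : 0 < t by rewrite !lt_min d0' d00 d30.
  have tt : nrm (t / 2)%:C = t / 2 by rewrite nrm_real gtr0_norm ?divr_gt0.
  have : t / 2 < t by lra.
  rewrite {2}/t !lt_min -tt => /andP[/andP[td td0] /andP[td3 td4]].
  pose u := z0 + (t / 2)%:C.
  have uz : u - z0 = (t / 2)%:C by rewrite addrAC subrr add0r.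
  have := Hp u; rewrite wz uz => /(_ td); rewrite Hq uz// => /mulIf E.
  have {}E : q u = p u by apply: E; rewrite -nrm_eq0 tt gt_eqF// divr_gt0.
  have := H3 u; rewrite uz q0 subr0 => /(_ td3); have := H4 u.
  rewrite wz uz => /(_ td4); rewrite -E (nrmB (q u)); have := nrm_lb (p z0) (q u); lra.
apply/eqP/negPn/negP => pw.
pose Q z := if z == w then p w else (phi z - phi w) / (z - w).
have Qn z : nrm (z - z0) <= r -> Q z != 0.
  move=> zr; rewrite /Q; have [//|zw] := eqVneq z w.
  apply: mulf_neq0; rewrite ?invr_neq0 ?subr_eq0//.
  by apply: contraNN zw => /eqP/iphi->//; exact: Gr.
have dQ z : nrm (z - z0) <= r -> z != w -> cdiff Q z.
  move=> zr zw; have zw0 : 0 < nrm (z - w) by rewrite nrm_gt0 subr_eq0.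
  apply: (@cdiff_ext _ (fun u => (phi u + (- phi w)) * (u + (- w))^-1) _ _ _ zw0).
    move=> u uz; rewrite /Q; have [uw|//] := eqVneq u w.
    by move: uz; rewrite uw nrmB ltxx.
  apply: cdiffM; first by apply: cdiffD; [exact/dphi/Gr|exact: cdiff_cst].
  apply: cdiffV; last by rewrite subr_eq0.
  by apply: cdiffD; [exact: cdiff_id|exact: cdiff_cst].
have cQw : ccont Q w.
  apply: (ccont_ext d0' _ cp) => u uw; rewrite /Q; have [->//|nuw] := eqVneq u w.
  by rewrite Hp// mulfK// subr_eq0.
pose f z := k%:C * (Q z)^-1.
have nf z : nrm (f z) = k / nrm (Q z) by rewrite nrmM nrm_real nrmV gtr0_norm.
have wrr : nrm (w - z0) <= r by exact: ltW.
have cf z : nrm (z - z0) <= r -> ccont f z.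
  move=> zr; apply: ccontM; first exact: ccont_cst.
  apply: ccontV; last exact: Qn.
  by have [->//|zw] := eqVneq z w; exact/cdiff_cont/dQ.
have : nrm (f z0) <= 1.
  apply: (max_modulus_removable (s := w) (bounded_closed_ball z0 r)) => //=.
  - exact: cf.
  - move=> z zr; have [zr1|zr1] := eqVneq (nrm (z - z0)) r; [left|right].
      rewrite nf ler_pdivrMr; last by rewrite nrm_gt0 Qn.
      have zw : z != w by apply/eqP => zw; move: wr; rewrite -zw zr1 ltxx.
      rewrite mul1r /Q (negbTE zw) nrmM nrmV ler_pdivlMr ?nrm_gt0 ?subr_eq0//.
      have M1 : m / 2 <= nrm (phi z - phi w).
        have := Hc z zr1; have := H1 w w1; have := nrm_tri (phi w) (phi z) (phi z0).
        rewrite -/(phi z - phi z0); lra.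
      apply: le_trans _ M1; have M2 : nrm (z - w) <= 2 * r.
        have := nrm_tri z0 z w; rewrite zr1 (nrmB z0); lra.
      apply: (@le_trans _ _ (k * (2 * r))); first by rewrite ler_pM2l.
      by rewrite /k le_eqVlt; apply/orP; left; apply/eqP; field; rewrite gt_eqF.
    exists (r - nrm (z - z0)); first by rewrite subr_gt0 lt_neqAle zr1.
    move=> u uz; have ur : nrm (u - z0) <= r by have := nrm_tri z u z0; lra.
    split => // uw; apply: cdiffM; first exact: cdiff_cst.
    by apply: cdiffV; [exact: dQ|exact: Qn].
  - by rewrite subrr nrm0 ltW.
  - by rewrite eq_sym.
rewrite nf ler_pdivrMr ?nrm_gt0 ?Qn ?subrr ?nrm0 ?(ltW r0)// mul1r.
rewrite /Q eq_sym (negbTE wz) nrmM nrmV ler_pdivlMr ?nrm_gt0 ?subr_eq0 1?eq_sym//.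
rewrite nrmB (nrmB (phi z0)) Hq// nrmM leNgt ltr_pM2r ?nrm_gt0 ?subr_eq0//.
by have := H2 w w2; rewrite q0 subr0 => ->.
Qed.

(** The difference quotient of psi is the reciprocal of q o psi. [open_mapping] makes psi continuous
    and a right inverse of phi near [phi z0]. *)
Lemma inverse_cdiff (psi : C -> C) z0 : G z0 ->
  (forall z, G z -> psi (phi z) = z) -> cdiff psi (phi z0).
Proof.
move=> Gz0 psiK.
have [q cq [d d0 Hq]] := dphi Gz0.
have q0 := injective_deriv_neq0 Gz0 cq d0 Hq.
have im (e : R) : 0 < e -> exists2 d1 : R, 0 < d1 &
    forall w, nrm (w - phi z0) < d1 -> [/\ nrm (psi w - z0) < e, G (psi w) & phi (psi w) = w].
  move=> e0; have [r r0 Gr] := open_ball Gz0.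
  have m0 : 0 < Num.min r (e / 2) by rewrite lt_min r0 divr_gt0.
  have [z|d1 d10 Hd] := open_mapping (z0 := z0) m0.
    by rewrite le_min => /andP[/Gr].
  exists d1 => // w /Hd[z]; rewrite le_min => /andP[zr ze] <-.
  by rewrite psiK; [split => //; [lra|exact: Gr]|exact: Gr].
have cpsi : ccont psi (phi z0).
  by move=> e /im[d1 d10 H]; exists d1 => // w /H[]; rewrite psiK.
have cqpsi : ccont (fun w => q (psi w)) (phi z0).
  by apply: ccont_comp => //; rewrite psiK.
exists (fun w => (q (psi w))^-1); first by apply: ccontV => //; rewrite psiK.
have [d1 d10 H1] := im d d0.
have n0 : 0 < nrm (q z0) by rewrite nrm_gt0.
have [d2 d20 H2] := cqpsi _ n0.
exists (Num.min d1 d2); first by rewrite lt_min d10.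
move=> w; rewrite lt_min => /andP[/H1[wd Gw pw] /H2]; rewrite psiK// => w2.
have qn : q (psi w) != 0.
  by apply: contraTneq w2 => ->; rewrite sub0r nrmN ltxx.
by have := Hq _ wd; rewrite pw => ->; rewrite mulKf.
Qed.

End Conformal_inverse.

(** * Small sets crossing circles around a boundary point *)

Section Kernel_estimates.
Variable R : realType.
Implicit Types (x y t h u delta : R).

Lemma ln1D_le y : 0 <= y -> ln (1 + y) <= y.
Proof.
move=> y0; rewrite -[leRHS]expRK ler_ln ?posrE ?expR_gt0 ?expR_ge1Dx//; lra.
Qed.

Lemma ln1D_ge y : 0 <= y -> y <= 1 -> y / 2 <= ln (1 + y).
Proof.
move=> y0 y1; rewrite -[leLHS]expRK ler_ln ?posrE ?expR_gt0//; last by lra.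
have := expR_ge1Dx (- (y / 2)); rewrite expRN => H.
have e0 := expR_gt0 (y / 2).
have : (1 - y / 2) * expR (y / 2) <= 1.
  by rewrite -ler_pdivlMr// mul1r.
move=> H1; nra.
Qed.

(* The fourth power makes the bound integrable against the scale t^2. *)
Lemma ln1D_le4 y u : 0 <= y -> 0 <= u -> y <= u ^+ 4 -> ln (1 + y) <= 4 * u.
Proof.
move=> y0 u0 yu; have u1 : 0 < 1 + u by lra.
apply: (@le_trans _ _ (ln ((1 + u) ^+ 4))).
  rewrite ler_ln ?posrE ?exprn_gt0//; last by lra.
  have -> : (1 + u) ^+ 4 = 1 + u ^+ 4 + u * (4 + 6 * u + 4 * u ^+ 2) by ring.
  have : 0 <= u * (4 + 6 * u + 4 * u ^+ 2).
    by rewrite mulr_ge0// !addr_ge0// ?mulr_ge0// sqr_ge0.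
  lra.
by rewrite lnXn// -[leLHS]mulr_natl ler_pM2l// ln1D_le.
Qed.

Lemma log_kernel_bound delta deltaj d t : 0 < delta -> 0 < deltaj -> 0 < t ->
  `|delta - deltaj| <= d -> t ^+ 2 * delta <= d ->
  ln (1 + 4 * delta * deltaj / d ^+ 2) / deltaj <= 64 / (delta * (t * (1 + t) ^+ 2)).
Proof.
move=> D0 J0 t0 dj dt.
have t20 : 0 < t ^+ 2 by rewrite exprn_gt0.
have d0 : 0 < d by apply: lt_le_trans dt; rewrite mulr_gt0.
have d2 : (t ^+ 2 * delta) ^+ 2 <= d ^+ 2.
  apply: lerXn2r => //; rewrite nnegrE ?(ltW d0)//.
  by apply: mulr_ge0; exact: ltW.
have q0 : 0 < t * (1 + t) ^+ 2 by rewrite mulr_gt0// exprn_gt0// addr_gt0.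
have y0 : 0 <= 4 * delta * deltaj / d ^+ 2.
  by rewrite divr_ge0 ?exprn_ge0 ?mulr_ge0 ?(ltW J0) ?(ltW D0) ?(ltW d0).
have B1 : ln (1 + 4 * delta * deltaj / d ^+ 2) / deltaj <= 4 * delta / d ^+ 2.
  rewrite ler_pdivrMr// (le_trans (ln1D_le y0))// le_eqVlt; apply/orP; left; apply/eqP; ring.
have key a : a <= 64 / (t * (1 + t) ^+ 2) -> ln (1 + 4 * delta * deltaj / d ^+ 2) / deltaj <= a / delta ->
    ln (1 + 4 * delta * deltaj / d ^+ 2) / deltaj <= 64 / (delta * (t * (1 + t) ^+ 2)).
  move=> a1 /le_trans; apply; rewrite invfM mulrA mulrAC ler_pM2r ?invr_gt0//.
have [t1|t1] := leP 1 t.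
  apply: (key (4 / t ^+ 4)).
    rewrite ler_pdivrMr ?exprn_gt0// mulrAC ler_pdivlMr//.
    have t14 : t <= t ^+ 4 by rewrite -{1}[t]expr1 ler_weXn2l.
    have t24 : t ^+ 2 <= t ^+ 4 by rewrite ler_weXn2l.
    have t34 : t ^+ 3 <= t ^+ 4 by rewrite ler_weXn2l.
    have -> : 4 * (t * (1 + t) ^+ 2) = 4 * t + 8 * t ^+ 2 + 4 * t ^+ 3 by ring.
    have : 0 < t ^+ 4 by rewrite exprn_gt0.
    lra.
  apply: (le_trans B1).
  rewrite ler_pdivrMr ?exprn_gt0//.
  have -> : 4 / t ^+ 4 / delta * d ^+ 2 = 4 / (t ^+ 4 * delta) * d ^+ 2.
    by field; rewrite !gt_eqF.
  rewrite mulrAC ler_pdivlMr ?mulr_gt0 ?exprn_gt0//.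
  have -> : 4 * delta * (t ^+ 4 * delta) = 4 * (t ^+ 2 * delta) ^+ 2 by ring.
  by rewrite ler_pM2l.
have t14 : (1 + t) ^+ 2 <= 4.
  have -> : (4 : R) = 2 ^+ 2 by rewrite expr2 -natrM.
  by rewrite ler_sqr ?nnegrE; lra.
have [jd|jd] := ltP deltaj (delta / 2).
  apply: (key 16).
    rewrite ler_pdivlMr//; have : t * (1 + t) ^+ 2 <= 1 * 4 by apply: ler_pM; rewrite ?exprn_ge0 ?(ltW t0) ?(ltW t1)//; lra.
    lra.
  apply: (le_trans B1).
  have dd : delta / 2 <= d by apply: le_trans dj; rewrite ler_normr; apply/orP; left; lra.
  have dd2 : (delta / 2) ^+ 2 <= d ^+ 2 by rewrite ler_sqr ?nnegrE ?(ltW d0)// divr_ge0// ltW.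
  rewrite ler_pdivrMr ?exprn_gt0// mulrAC ler_pdivlMr//.
  have -> : 4 * delta * delta = 16 * (delta / 2) ^+ 2 by field.
  by rewrite ler_pM2l.
pose rho := deltaj / delta.
have r2 : 1 / 2 <= rho by rewrite /rho ler_pdivlMr// mulrC mul1r.
have r0 : 0 < rho by rewrite divr_gt0.
(* The factor 3 is large enough because rho >= 1 / 2 gives 4 rho <= (3 rho)^4. *)
have Bu : ln (1 + 4 * delta * deltaj / d ^+ 2) <= 4 * (3 * rho / t).
  apply: ln1D_le4 => //; first by rewrite ltW// divr_gt0// mulr_gt0.
  apply: (@le_trans _ _ (4 * rho / t ^+ 4)).
    rewrite /rho ler_pdivrMr ?exprn_gt0//.
    have -> : 4 * (deltaj / delta) / t ^+ 4 * d ^+ 2 = (4 * deltaj / (delta * t ^+ 4)) * d ^+ 2.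
      by field; rewrite !gt_eqF.
    rewrite [leRHS]mulrAC ler_pdivlMr ?mulr_gt0 ?exprn_gt0//.
    have -> : 4 * delta * deltaj * (delta * t ^+ 4) = 4 * deltaj * (t ^+ 2 * delta) ^+ 2 by ring.
    by rewrite ler_pM2l ?mulr_gt0.
  have -> : (3 * rho / t) ^+ 4 = 81 * rho ^+ 4 / t ^+ 4 by field; rewrite gt_eqF.
  rewrite ler_pM2r ?invr_gt0 ?exprn_gt0//.
  have r3 : (1 / 2) ^+ 3 <= rho ^+ 3 by rewrite lerXn2r ?nnegrE ?(ltW r0)// divr_ge0.
  have -> : 81 * rho ^+ 4 = 81 * rho ^+ 3 * rho by ring.
  rewrite ler_pM2r//; lra.
apply: (key (12 / t)).
  have -> : 64 / (t * (1 + t) ^+ 2) = 64 / (1 + t) ^+ 2 / t.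
    by field; rewrite !gt_eqF// addr_gt0.
  rewrite ler_pM2r ?invr_gt0// ler_pdivlMr ?exprn_gt0 ?addr_gt0//; lra.
rewrite ler_pdivrMr//; apply: (le_trans Bu).
by rewrite le_eqVlt; apply/orP; left; apply/eqP; rewrite /rho; field; rewrite !gt_eqF.
Qed.

(* An antiderivative, up to a factor, of 1 / (sqrt y (1 + sqrt y)^2). *)
Definition Qk y := Num.sqrt y / (1 + Num.sqrt y).

Lemma Qk_ge0 y : 0 <= Qk y.
Proof. by rewrite divr_ge0 ?addr_ge0 ?sqrtr_ge0. Qed.

Lemma Qk_le1 y : Qk y <= 1.
Proof.
rewrite ler_pdivrMr ?mul1r ?lerDr// ltr_pwDl// sqrtr_ge0.
Qed.

Lemma Qk_mono y y' : y <= y' -> Qk y <= Qk y'.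
Proof.
move=> yy; have := ler_wsqrtr yy; rewrite /Qk.
have := sqrtr_ge0 y; have := sqrtr_ge0 y'; move: (Num.sqrt y) (Num.sqrt y') => a b b0 a0 ab.
rewrite ler_pdivrMr; last by lra.
rewrite mulrAC ler_pdivlMr; last by lra.
lra.
Qed.

(** [Qk] is concave on the positive axis, with derivative 1 / (2 sqrt y (1 + sqrt y)^2), so a
    backward difference dominates h times the derivative at its right end. *)
Lemma Qk_step y h : 0 < h -> h <= y ->
  h / (2 * (Num.sqrt y * (1 + Num.sqrt y) ^+ 2)) <= Qk y - Qk (y - h).
Proof.
move=> h0 hy; have y0 : 0 < y by lra.
have a2 := sqr_sqrtr (ltW y0).
have yh : 0 <= y - h by lra.
have b2 := sqr_sqrtr yh.
have ba : Num.sqrt (y - h) <= Num.sqrt y by apply: ler_wsqrtr; lra.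
have a0 : 0 < Num.sqrt y by rewrite sqrtr_gt0.
have b0 := sqrtr_ge0 (y - h).
rewrite /Qk; move: (Num.sqrt y) (Num.sqrt (y - h)) a2 b2 ba a0 b0 => a b a2 b2 ba a0 b0.
have hE : h = (a - b) * (a + b) by rewrite -subr_sqr a2 b2; ring.
have -> : a / (1 + a) - b / (1 + b) = (a - b) / ((1 + a) * (1 + b)).
  by field; rewrite !gt_eqF; lra.
rewrite ler_pdivrMr; last by rewrite mulr_gt0// mulr_gt0// exprn_gt0; lra.
rewrite mulrAC ler_pdivlMr; last by rewrite mulr_gt0; lra.
rewrite hE -mulrA ler_wpM2l ?subr_ge0//.
have H1 : (a + b) * (1 + b) <= 2 * a * (1 + a) by apply: ler_pM; lra.
have -> : (a + b) * ((1 + a) * (1 + b)) = (1 + a) * ((a + b) * (1 + b)) by ring.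
have -> : 2 * (a * (1 + a) ^+ 2) = (1 + a) * (2 * a * (1 + a)) by ring.
by rewrite ler_wpM2l//; lra.
Qed.

(** The odd extension of [Qk], since the square root of a negative number is 0. It treats radii on
    both sides of that of z at once. *)
Definition Pk y := Qk y - Qk (- y).

Lemma Pk_mono y y' : y <= y' -> Pk y <= Pk y'.
Proof. by move=> yy; rewrite /Pk lerB// Qk_mono// lerN2. Qed.

Lemma Pk_le1 y : `|Pk y| <= 1.
Proof.
rewrite /Pk ler_norml; have := Qk_le1 y; have := Qk_le1 (- y).
by have := Qk_ge0 y; have := Qk_ge0 (- y) => *; apply/andP; split; lra.
Qed.

Lemma Qk0 y : y <= 0 -> Qk y = 0.
Proof. by move=> y0; rewrite /Qk ler0_sqrtr// mul0r. Qed.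

(** For |x| >= h this is [log_kernel_bound] followed by [Qk_step]. For |x| < h, next to the
    singularity, the term is only known to be at most 1, and the increment of [Pk] at scale h, which
    is at least 1 / 2, pays for it. *)
Lemma kernel_term_bound delta deltaj d h x y : 0 < delta -> 0 < deltaj -> 0 < h ->
  `|delta - deltaj| <= d -> `|x| <= d -> 0 <= y ->
  y <= 4 * delta * deltaj / d ^+ 2 -> (h / deltaj) * ln (1 + y) <= 1 ->
  (h / deltaj) * ln (1 + y) <=
    128 * (Pk ((x + h) / delta) - Pk ((x - h) / delta)) + 2 * (Pk ((x + h) / h) - Pk ((x - h) / h)).
Proof.
move=> D0 J0 h0 dj xd y0 yd T1.
have mono c : 0 < c -> 0 <= Pk ((x + h) / c) - Pk ((x - h) / c).
  by move=> c0; rewrite subr_ge0 Pk_mono// ler_pM2r ?invr_gt0//; lra.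
have m1 := mono _ D0; have m2 := mono _ h0.
have [xh|xh] := ltP `|x| h.
  suff : 1 / 2 <= Pk ((x + h) / h) - Pk ((x - h) / h) by lra.
  move: xh; rewrite ltr_norml => /andP[x1 x2].
  have Q1 : Qk 1 = 1 / 2 by rewrite /Qk sqrtr1.
  have A1 : 0 <= (x + h) / h by rewrite divr_ge0; lra.
  have A2 : 0 <= - ((x - h) / h) by rewrite -mulNr divr_ge0; lra.
  rewrite /Pk (@Qk0 (- ((x + h) / h))); last by lra.
  rewrite (@Qk0 ((x - h) / h)); last by lra.
  have [x0|x0] := leP 0 x.
    have := @Qk_mono 1 ((x + h) / h); rewrite Q1 ler_pdivlMr//.
    have := Qk_ge0 (- ((x - h) / h)); have : 1 * h <= x + h by lra.
    move=> -> ? /(_ isT); lra.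
  have := @Qk_mono 1 (- ((x - h) / h)); rewrite Q1 -mulNr ler_pdivlMr//.
  have := Qk_ge0 ((x + h) / h); have : 1 * h <= - (x - h) by lra.
  move=> -> ? /(_ isT); lra.
pose sg := `|x| / delta.
have sg0 : 0 < sg by rewrite divr_gt0//; lra.
pose t := Num.sqrt sg; have t0 : 0 < t by rewrite sqrtr_gt0.
have t2 : t ^+ 2 * delta = `|x| by rewrite sqr_sqrtr ?(ltW sg0)// divfK// gt_eqF.
have LK := @log_kernel_bound delta deltaj d t D0 J0 t0 dj; rewrite t2 in LK.
have {}LK := LK xd.
have T2 : (h / deltaj) * ln (1 + y) <= h * (64 / (delta * (t * (1 + t) ^+ 2))).
  rewrite -mulrA ler_pM2l// mulrC; apply: le_trans LK.
  rewrite ler_pM2r ?invr_gt0// ler_ln ?posrE ?lerD2l//; lra.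
have hs : h / delta <= sg by rewrite ler_pM2r ?invr_gt0.
have := Qk_step (divr_gt0 h0 D0) hs; rewrite -/t => S.
have T3 : h * (64 / (delta * (t * (1 + t) ^+ 2))) =
    128 * (h / delta / (2 * (t * (1 + t) ^+ 2))).
  by field; rewrite !gt_eqF//; lra.
suff : Qk sg - Qk (sg - h / delta) <= Pk ((x + h) / delta) - Pk ((x - h) / delta).
  by lra.
rewrite /sg -mulrBl; have [x0|x0] := leP 0 x.
  rewrite ger0_norm// in xh *.
  have : Pk ((x - h) / delta) <= Qk ((x - h) / delta) by rewrite /Pk gerBl Qk_ge0.
  have : Qk (x / delta) <= Pk ((x + h) / delta).
    rewrite /Pk (@Qk0 (- _)); last by rewrite oppr_le0 divr_ge0; lra.
    by rewrite subr0 Qk_mono// ler_pM2r ?invr_gt0//; lra.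
  lra.
rewrite ltr0_norm// in xh *.
have : Pk ((x - h) / delta) <= - Qk (- x / delta).
  rewrite /Pk (@Qk0 ((x - h) / delta)); last first.
    by rewrite pmulr_lle0 ?invr_gt0//; lra.
  by rewrite sub0r lerN2 -mulNr Qk_mono// ler_pM2r ?invr_gt0//; lra.
have : - Qk ((- x - h) / delta) <= Pk ((x + h) / delta).
  have E : - ((x + h) / delta) = (- x - h) / delta by ring.
  by rewrite /Pk E; have := Qk_ge0 ((x + h) / delta); lra.
lra.
Qed.

Lemma telescope2 (p : nat -> R) N : (forall i, `|p i| <= 1) ->
  \sum_(i < N) (p i - p i.+2) <= 4.
Proof.
move=> p1.
have -> : \sum_(i < N) (p i - p i.+2) = p 0%N + p 1%N - p N - p N.+1.
  elim: N => [|N IH]; first by rewrite big_ord0; ring.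
  by rewrite big_ord_recr /= IH; ring.
have a (i : nat) : -1 <= p i <= 1 by rewrite -ler_norml.
by case/andP: (a 0%N); case/andP: (a 1%N); case/andP: (a N); case/andP: (a N.+1); lra.
Qed.

End Kernel_estimates.

Section Crossing.
Variable R : realType.
Local Notation C := R[i].
Implicit Types (z w zeta : C) (f : C -> C).

(* The reciprocal of a Blaschke factor with zero w. *)
Definition invblaschke w z : C := (1 - (w^*)%C * z) / (z - w).

(** [ln (1 + bpair z w)] is twice the Green function of the disk with pole [w]. *)
Definition bpair z w : R := (1 - nrm z ^+ 2) * (1 - nrm w ^+ 2) / nrm (z - w) ^+ 2.

Lemma nrm_invblaschke w z : z != w -> nrm (invblaschke w z) ^+ 2 = 1 + bpair z w.
Proof.
move=> zw; have d0 : nrm (z - w) ^+ 2 != 0 by rewrite sqrf_eq0 nrm_eq0 subr_eq0.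
have E : nrm (1 - (w^*)%C * z) ^+ 2 = nrm (z - w) ^+ 2 + (1 - nrm z ^+ 2) * (1 - nrm w ^+ 2).
  by rewrite !nrm_sqr; case: (z) (w) => [? ?] [? ?] /=; ring.
rewrite /invblaschke nrmM nrmV exprMn E /bpair exprVn; field.
by rewrite -sqrf_eq0.
Qed.

Lemma cdiff_invblaschke w z : z != w -> cdiff (invblaschke w) z.
Proof.
move=> zw; apply: cdiffM.
  apply: (cdiff_ext ltr01 _ (cdiffD (cdiff_cst 1 z) (cdiffM (cdiff_cst (- (w^*)%C) z) (cdiff_id z)))).
  by move=> u _; rewrite mulNr.
apply: cdiffV; last by rewrite subr_eq0.
by apply: cdiffD; [exact: cdiff_id|exact: cdiff_cst].
Qed.

Lemma cdiff_prod N (g : nat -> C -> C) z : (forall j, (j < N)%N -> cdiff (g j) z) ->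
  cdiff (fun u => \prod_(j < N) g j u) z.
Proof.
elim: N => [|N IH] H.
  by apply: (cdiff_ext ltr01 _ (cdiff_cst 1 z)) => u _; rewrite big_ord0.
have dN : cdiff (fun u => \prod_(j < N) g j u) z.
  by apply: IH => j jN; apply: H; rewrite (ltn_trans jN).
apply: (cdiff_ext ltr01 _ (cdiffM dN (H N (ltnSn N)))) => u _.
by rewrite big_ord_recr.
Qed.

Lemma nrm_sqr_lt1 z : nrm z < 1 -> 0 < 1 - nrm z ^+ 2.
Proof. by move=> z1; rewrite subr_gt0 expr_lt1 ?nrm_ge0. Qed.

Lemma bpair_ge0 z w : nrm z < 1 -> nrm w < 1 -> 0 <= bpair z w.
Proof.
move=> z1 w1; rewrite /bpair divr_ge0 ?sqr_ge0// mulr_ge0// ltW// nrm_sqr_lt1//.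
Qed.

Lemma one_sub_sqr (x : R) : 0 <= x -> x < 1 -> 0 <= 1 - x ^+ 2 <= 2 * (1 - x).
Proof.
move=> x0 x1; have -> : 1 - x ^+ 2 = (1 + x) * (1 - x) by ring.
by apply/andP; split; [rewrite mulr_ge0; lra|rewrite ler_wpM2r; lra].
Qed.

Lemma bpair_le z w : nrm z < 1 -> nrm w < 1 ->
  bpair z w <= 4 * (1 - nrm z) * (1 - nrm w) / nrm (z - w) ^+ 2.
Proof.
move=> z1 w1; have z0 := nrm_ge0 z; have w0 := nrm_ge0 w.
rewrite /bpair ler_wpM2r ?invr_ge0 ?sqr_ge0//.
have -> : 4 * (1 - nrm z) * (1 - nrm w) = 2 * (1 - nrm z) * (2 * (1 - nrm w)) by ring.
have /andP[a1 a2] := one_sub_sqr z0 z1; have /andP[b1 b2] := one_sub_sqr w0 w1.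
exact: ler_pM.
Qed.

(** The distances of the w j from zeta are in arithmetic progression of step h, so the increments of
    [Pk] from x - h to x + h skip one index each and telescope to four terms. Hence A is
    absolute. *)
Lemma bpair_sum_le : exists2 A : R, 0 < A & forall zeta (s h : R) N (w : nat -> C) z, 0 < h ->
  (forall j, (j < N)%N -> nrm (w j) < 1 /\ nrm (w j - zeta) = s + j.+1%:R * h) ->
  nrm z < 1 ->
  (forall j, (j < N)%N -> h / (1 - nrm (w j)) * ln (1 + bpair z (w j)) <= 1) ->
  \sum_(j < N) h / (1 - nrm (w j)) * ln (1 + bpair z (w j)) <= A.
Proof.
exists (4 * 128 + 8); first lra.
move=> zeta s h N w z h0 Hw z1 small; have D0 : 0 < 1 - nrm z by rewrite subr_gt0.
set base := nrm (z - zeta) - s.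
pose p (c : R) (i : nat) := Pk ((base - i%:R * h) / c).
have Sp c : \sum_(i < N) (p c i - p c i.+2) <= 4 by apply: telescope2 => i; exact: Pk_le1.
apply: (@le_trans _ _ (\sum_(j < N) (128 * (p (1 - nrm z) j - p (1 - nrm z) j.+2) +
    2 * (p h j - p h j.+2)))).
  apply: ler_sum => j _; have [w1 wz] := Hw j (ltn_ord j).
  have W0 : 0 < 1 - nrm (w j) by rewrite subr_gt0.
  pose x := nrm (z - zeta) - nrm (w j - zeta).
  have xp : x + h = base - j%:R * h by rewrite /x wz /base -natr1; ring.
  have xm : x - h = base - j.+2%:R * h by rewrite /x wz /base -!natr1; ring.
  rewrite /p -xp -xm; apply: (@kernel_term_bound _ _ _ (nrm (z - w j))) => //.
  - have -> : 1 - nrm z - (1 - nrm (w j)) = - (nrm z - nrm (w j)) by ring.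
    by rewrite normrN nrm_dist.
  - apply: (le_trans (nrm_dist _ _)).
    by have -> : z - zeta - (w j - zeta) = z - w j by ring.
  - exact: bpair_ge0.
  - exact: bpair_le.
  - exact: small.
rewrite big_split /= -!mulr_sumr; have := Sp (1 - nrm z); have := Sp h; lra.
Qed.

(** All w j are within 3 s of z, so each logarithm is at least a multiple of (1 - |z|) (1 - |w j|) /
    s^2. The weight cancels 1 - |w j|, and the N steps of length h add up to s. *)
Lemma bpair_sum_ge zeta (s h : R) N (w : nat -> C) z : 0 < h -> N%:R * h = s ->
  (forall j, (j < N)%N -> nrm (w j) < 1 /\ nrm (w j - zeta) = s + j.+1%:R * h) ->
  nrm zeta = 1 -> nrm z < 1 -> nrm (z - zeta) <= s ->
  (forall j, (j < N)%N -> z != w j) ->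
  (1 - nrm z) / (18 * s) <= \sum_(j < N) h / (1 - nrm (w j)) * ln (1 + bpair z (w j)).
Proof.
move=> h0 Nh Hw zeta1 z1 zs zw.
have D0 : 0 < 1 - nrm z by rewrite subr_gt0.
have Ds : 1 - nrm z <= s.
  by apply: le_trans zs; rewrite -zeta1 nrmB nrm_lb.
have s0 : 0 < s by lra.
apply: (@le_trans _ _ (\sum_(j < N) h * ((1 - nrm z) / (18 * s ^+ 2)))).
  rewrite sumr_const card_ord -[leRHS]mulr_natl mulrA Nh.
  by rewrite le_eqVlt; apply/orP; left; apply/eqP; field; rewrite gt_eqF.
apply: ler_sum => j _; have [w1 wz] := Hw j (ltn_ord j).
have W0 : 0 < 1 - nrm (w j) by rewrite subr_gt0.
have w2s : nrm (w j - zeta) <= 2 * s.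
  rewrite wz; have : j.+1%:R * h <= N%:R * h by rewrite ler_pM2r// ler_nat ltn_ord.
  lra.
have W2s : 1 - nrm (w j) <= 2 * s.
  by apply: le_trans w2s; rewrite -zeta1 nrmB nrm_lb.
have d3 : nrm (z - w j) <= 3 * s.
  have := nrm_tri zeta z (w j); rewrite (nrmB zeta); lra.
have d0 : 0 < nrm (z - w j) by rewrite nrm_gt0 subr_eq0 zw.
pose y := (1 - nrm z) * (1 - nrm (w j)) / (9 * s ^+ 2).
have s20 : 0 < 9 * s ^+ 2 by rewrite mulr_gt0// exprn_gt0.
have y0 : 0 <= y by rewrite divr_ge0 ?mulr_ge0// ltW.
have y1 : y <= 1.
  rewrite ler_pdivrMr// mul1r; apply: (@le_trans _ _ (s * (2 * s))).
    by apply: ler_pM => //; exact: ltW.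
  have -> : s * (2 * s) = 2 * s ^+ 2 by ring.
  by rewrite ler_pM2r ?exprn_gt0//; lra.
have yb : y <= bpair z (w j).
  rewrite /y /bpair; apply: ler_pM.
  - by rewrite mulr_ge0// ltW.
  - by rewrite invr_ge0 ltW.
  - have A (x : R) : 0 <= x -> x < 1 -> 1 - x <= 1 - x ^+ 2.
      move=> x0 x1; have : x * x <= x * 1 by rewrite ler_wpM2l// ltW.
      rewrite expr2; lra.
    by apply: ler_pM; rewrite ?(ltW D0) ?(ltW W0) ?A ?nrm_ge0.
  - rewrite lef_pV2 ?posrE ?exprn_gt0//.
    have -> : 9 * s ^+ 2 = (3 * s) ^+ 2 by ring.
    by rewrite lerXn2r ?nnegrE ?nrm_ge0//; lra.
have l1 : y / 2 <= ln (1 + bpair z (w j)).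
  apply: (le_trans (ln1D_ge y0 y1)); rewrite ler_ln ?posrE; lra.
apply: (@le_trans _ _ (h / (1 - nrm (w j)) * (y / 2))).
  by rewrite le_eqVlt; apply/orP; left; apply/eqP; rewrite /y; field; rewrite !gt_eqF.
by rewrite ler_wpM2l// divr_ge0 ?ltW.
Qed.

Lemma finite_min (g : nat -> R) N : (forall j, (j < N)%N -> 0 < g j) ->
  exists2 d : R, 0 < d & forall j, (j < N)%N -> d <= g j.
Proof.
elim: N => [|N IH] H; first by exists 1.
have [|d d0 Hd] := IH; first by move=> j jN; apply: H; rewrite (ltn_trans jN).
exists (Num.min d (g N)); first by rewrite lt_min d0 H.
move=> j; rewrite ltnS leq_eqVlt => /predU1P[->|jN]; first by rewrite ge_min lexx orbT.
by rewrite ge_min Hd.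
Qed.

End Crossing.

Section Crossing_theorem.
Variable R : realType.
Local Notation C := R[i].
Implicit Types (z w zeta : C) (f : C -> C).

Lemma prod_invblaschke N (w : nat -> C) (m : nat -> nat) z :
  nrm z < 1 -> (forall j, (j < N)%N -> nrm (w j) < 1 /\ z != w j) ->
  nrm (\prod_(j < N) invblaschke (w j) z ^+ m j) ^+ 2 =
  expR (\sum_(j < N) (m j)%:R * ln (1 + bpair z (w j))).
Proof.
move=> z1; elim: N => [|N IH] H; first by rewrite !big_ord0 nrm1 expr1n expR0.
rewrite !big_ord_recr /= nrmM exprMn expRD IH; last first.
  by move=> j jN; apply: H; rewrite (ltn_trans jN).
have [w1 zw] := H N (ltnSn N).
congr (_ * _); rewrite nrmX -exprM mulnC exprM nrm_invblaschke//.
by rewrite expRM_natl lnK// posrE; have := bpair_ge0 z1 w1; lra.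
Qed.

(* Compare f with a product of Blaschke factors whose zeros are spread along E and weighted so
   that its logarithm is bounded off the zeros, but comparable to (1 - |z0|) / s at z0. *)
Theorem crossing_small (k tau : R) : 0 < k -> 0 < tau -> exists2 eps : R, 0 < eps &
  forall f zeta s (E : set C) z0,
  (forall z, nrm z < 1 -> cdiff f z /\ nrm (f z) <= 1) ->
  nrm zeta = 1 -> 0 < s -> bounded_closed E ->
  (forall z, E z -> nrm z < 1 /\ nrm (f z) < eps) ->
  (forall r, s <= r <= 2 * s -> exists2 w, E w & nrm (w - zeta) = r) ->
  nrm z0 < 1 -> nrm (z0 - zeta) <= s -> k * s <= 1 - nrm z0 ->
  nrm (f z0) <= tau.
Proof.
move=> k0 tau0; pose T := `|ln tau| + 1.
have T0 : 0 < T by rewrite ltr_wpDl.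
have eT : expR (- T) <= tau.
  rewrite -[leRHS]lnK ?posrE// ler_expR /T; have := ler_norm (- ln tau); rewrite normrN; lra.
have [A A0 HA] := bpair_sum_le R.
(* With L >= 144 A T / k the cost A K T / L is at most K k / 144, a fraction of the gain K k / 18 at
   z0. L may involve only A, k and tau, since eps = exp (- L) is fixed before f, s and E. *)
have [q q0 qE] : exists2 q : R, 0 < q & q = 144 * A by exists (144 * A) => //; lra.
pose L := q * T / k + T.
have qT0 : 0 < q * T / k by rewrite divr_gt0// mulr_gt0.
have L1 : q * T / k <= L by rewrite lerDl ltW.
have L0 : 0 < L by rewrite addr_gt0.
exists (expR (- L)); first exact: expR_gt0.
move=> f zeta s E z0 df zeta1 s0 bE Ef hit z01 z0s z0k.
have [||c Ec Hc] := @compact_max _ E (fun z => nrm z) (bounded_closed_compact bE).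
- by have [|w Ew _] := hit s; [rewrite lexx; lra|exists w].
- apply: (@lipschitz_cont _ _ _ 1) => w z _ _; rewrite mul1r; exact: nrm_dist.
pose dm := 1 - nrm c; have dm0 : 0 < dm by rewrite subr_gt0; have [] := Ef c Ec.
pose bad : set C := [set z | ~ (nrm z < 1 /\ nrm (f z) < expR (- L))].
have [||d d0 Hd] := @compact_closed_dist _ E bad (bounded_closed_compact bE).
- move=> u Hu [u1 fu].
  have u10 : 0 < 1 - nrm u by rewrite subr_gt0.
  have fu0 : 0 < expR (- L) - nrm (f u) by rewrite subr_gt0.
  have [d1 d10 H1] := cdiff_cont (df u u1).1 fu0.
  have [|v bv] := Hu (Num.min (1 - nrm u) d1); first by rewrite lt_min u10.
  rewrite lt_min => /andP[v1 /H1 v2]; apply: bv; split.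
    by have := nrm_lb v u; move: v1; clear; lra.
  by have := nrm_lb (f v) (f u); move: v2; clear; lra.
- by rewrite -subset0 => z [Ez]; apply; exact: Ef.
pose eta := d / 2; have eta0 : 0 < eta by rewrite divr_gt0.
have near_E w z : E w -> nrm (z - w) <= eta -> nrm (f z) < expR (- L).
  move=> Ew zw; have [[]//|bz] := pselect (nrm z < 1 /\ nrm (f z) < expR (- L)).
  have := Hd w z Ew bz; rewrite nrmB; rewrite /eta in zw; move: zw d0; clear; lra.
(* B bounds each logarithm at distance at least eta from the zeros. N is then so large that the
   weights, at most h / dm, bring every term below 1, as [bpair_sum_le] requires. *)
pose B := ln (1 + 4 / eta ^+ 2).
pose N := (Num.bound (s * B / dm)).+1.
have B0 : 0 <= B by rewrite ln_ge0// lerDl divr_ge0// sqr_ge0.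
have NB : s * B / dm <= N%:R.
  apply: ltW; apply: lt_le_trans (archi_boundP _) _; last by rewrite ler_nat.
  by rewrite divr_ge0 ?mulr_ge0// ltW.
have N0 : (0 : R) < N%:R by rewrite ltr0n.
clearbody N.
pose h := s / N%:R; have h0 : 0 < h by rewrite divr_gt0.
have Nh : N%:R * h = s by rewrite /h mulrC divfK// gt_eqF.
have hB : h / dm * B <= 1.
  rewrite /h -mulrA mulrAC ler_pdivrMr// mul1r.
  by apply: le_trans NB; rewrite le_eqVlt; apply/orP; left; apply/eqP; ring.
have /choice[w Hw] (j : nat) : exists w, (j < N)%N -> E w /\ nrm (w - zeta) = s + j.+1%:R * h.
  have [jN|_] := ltnP j N; last by exists 0.
  have [|w Ew wr] := hit (s + j.+1%:R * h); last by exists w.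
  have : j.+1%:R * h <= N%:R * h by rewrite ler_pM2r// ler_nat.
  have : 0 <= j.+1%:R * h by rewrite mulr_ge0// ltW.
  by rewrite Nh; clear => *; apply/andP; split; lra.
have Hw' j : (j < N)%N -> nrm (w j) < 1 /\ nrm (w j - zeta) = s + j.+1%:R * h.
  by move=> /Hw[/Ef[w1 _] wz].
have W0 j : (j < N)%N -> 0 < 1 - nrm (w j) by move=> /Hw'[]; rewrite subr_gt0.
have wdm j : (j < N)%N -> dm <= 1 - nrm (w j).
  by move=> /Hw[/Hc wc _]; rewrite lerD2l lerN2.
(* Multiplicities are integers, obtained by rounding K h / (1 - |w j|) up. The first summand makes
   this number at least 1, so rounding at most doubles it; the second makes the gain at z0 exceed
   the constant losses 2 + 2 T. *)
pose K := h^-1 + 48 * (2 + 2 * T) / k.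
have K1 : h^-1 <= K by rewrite lerDl divr_ge0 ?mulr_ge0// ?ltW// addr_gt0// mulr_gt0.
have Kk : 48 * (2 + 2 * T) < K * k.
  have -> : K * k = h^-1 * k + 48 * (2 + 2 * T) by rewrite /K; field; rewrite !gt_eqF.
  by rewrite ltrDr mulr_gt0// invr_gt0.
have K0 : 0 < K by apply: lt_le_trans K1; rewrite invr_gt0.
pose m j := (Num.truncn (K * (h / (1 - nrm (w j))))).+1.
have mlo j : (j < N)%N -> K * (h / (1 - nrm (w j))) <= (m j)%:R.
  by move=> jN; rewrite ltW// truncnS_gt.
have mhi j : (j < N)%N -> (m j)%:R <= 2 * K * (h / (1 - nrm (w j))).
  move=> jN; have W := W0 j jN.
  have Y1 : 1 <= K * (h / (1 - nrm (w j))).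
    rewrite mulrA ler_pdivlMr// mul1r.
    have : 1 <= K * h by rewrite -ler_pdivrMr// div1r.
    have := nrm_ge0 (w j); clear; lra.
  have Y0 : 0 <= K * (h / (1 - nrm (w j))) by apply: le_trans Y1; exact: ler01.
  have := truncn_le (K * (h / (1 - nrm (w j)))); rewrite Y0 /m -natr1 -mulrA; move: Y1; clear; lra.
(* Just enough powers of f, each at most exp (- L) near E, to absorb the product on the circles
   around the zeros. *)
pose n := (Num.truncn (A * K / L)).+1.
have nlo : A * K <= n%:R * L by rewrite -ler_pdivrMr// ltW// truncnS_gt.
have nhi : n%:R <= A * K / L + 1.
  have Y0 : 0 <= A * K / L by rewrite divr_ge0 ?mulr_ge0// ltW.
  by have := truncn_le (A * K / L); rewrite Y0 /n -natr1; clear; lra.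
clearbody n m.
pose M := \sum_(j < N) ((m j)%:R : R).
have M0 : 0 <= M by rewrite sumr_ge0.
(* The comparison takes place outside the disks of radius eta around the zeros; inside them f is
   small directly by [near_E]. *)
have [z0w|z0w] := pselect (exists2 j, (j < N)%N & nrm (z0 - w j) <= eta).
  have [j jN zj] := z0w; apply: (le_trans _ eT).
  have [Ew _] := Hw j jN; apply: (le_trans (ltW (near_E _ _ Ew zj))).
  by rewrite ler_expR lerN2 lerDr ltW.
have {}z0w j : (j < N)%N -> eta < nrm (z0 - w j).
  by move=> jN; rewrite ltNge; apply/negP => zj; apply: z0w; exists j.
(* So close to 1 that on |z| = rho each logarithm is at most 1 / (M + 1), hence their sum with
   multiplicities at most 1; the maximum keeps z0 in the region. *)
pose rho := Num.max (nrm z0) (1 - eta ^+ 2 / (2 * (M + 1))).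
have M11 : 0 < M + 1 by rewrite ltr_wpDl.
have M10 : 0 < 2 * (M + 1) by rewrite mulr_gt0.
have rho1 : rho < 1.
  by rewrite gt_max z01 /= ltrBlDr ltrDl divr_gt0// exprn_gt0.
pose Kr : set C := [set z | nrm z <= rho /\ forall j, (j < N)%N -> eta <= nrm (z - w j)].
have bKr : bounded_closed Kr.
  split; first by exists rho => z [].
  move=> z Hz; split.
    by have [_ Hcl] := bounded_closed_ball (0 : C) rho; have := Hcl z; rewrite /= subr0; apply => e /Hz[u [ur _] uz]; exists u => //=; rewrite subr0.
  move=> j jN; apply/ler_addgt0Pr => e /Hz[u [_ /(_ j jN) uw] uz].
  have := nrm_tri z u (w j); move: uw uz; clear; lra.
have Kr1 z : Kr z -> nrm z < 1 by move=> [zr _]; exact: le_lt_trans rho1.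
have Krw z j : Kr z -> (j < N)%N -> z != w j.
  move=> [_ Kz] jN; rewrite -subr_eq0 -nrm_gt0; exact: lt_le_trans (Kz j jN).
have lnX0 z j : Kr z -> (j < N)%N -> 0 <= ln (1 + bpair z (w j)).
  by move=> /Kr1 z1 /Hw'[w1 _]; rewrite ln_ge0// lerDl bpair_ge0.
pose S z := \sum_(j < N) (m j)%:R * ln (1 + bpair z (w j)).
have Shi z : Kr z -> S z <= 2 * A * K.
  move=> Kz; have z1 := Kr1 z Kz.
  have U := HA zeta s h N w z h0 Hw' z1.
  have {}U : \sum_(j < N) h / (1 - nrm (w j)) * ln (1 + bpair z (w j)) <= A.
    apply: U => j jN; apply: le_trans hB; have [w1 _] := Hw' j jN.
    apply: ler_pM.
    - by rewrite divr_ge0// ltW// W0.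
    - exact: lnX0.
    - by rewrite ler_pM2l// lef_pV2 ?posrE ?wdm ?W0.
    rewrite /B ler_ln ?posrE; last 2 first.
    - by have := bpair_ge0 z1 w1; clear; lra.
    - by rewrite ltr_pwDl// divr_ge0// sqr_ge0.
    rewrite lerD2l; apply: (le_trans (bpair_le z1 w1)).
    have zw : eta <= nrm (z - w j) by case: Kz => _; exact.
    apply: ler_pM.
    - by rewrite !mulr_ge0// subr_ge0 ltW.
    - by rewrite invr_ge0 sqr_ge0.
    - have := nrm_ge0 z; have := nrm_ge0 (w j); have := W0 j jN; move: z1; clear => *; nra.
    - by rewrite lef_pV2 ?posrE ?exprn_gt0//; [rewrite lerXn2r ?nnegrE ?nrm_ge0// ltW|exact: lt_le_trans zw].
  apply: (@le_trans _ _ (\sum_(j < N) 2 * K * (h / (1 - nrm (w j)) * ln (1 + bpair z (w j))))).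
    by apply: ler_sum => j _; rewrite mulrA ler_wpM2r ?lnX0 ?mhi.
  rewrite -mulr_sumr; have : 2 * K * A = 2 * A * K by ring.
  by move=> <-; rewrite ler_pM2l// mulr_gt0.
pose F z := (expR (-1))%:C * (f z ^+ n * \prod_(j < N) invblaschke (w j) z ^+ m j).
have nF z : Kr z -> nrm (F z) ^+ 2 = expR (-2) * ((nrm (f z) ^+ 2) ^+ n * expR (S z)).
  move=> Kz; rewrite /F !nrmM nrm_real ger0_norm ?expR_ge0// !exprMn.
  rewrite prod_invblaschke ?Kr1//; last first.
    by move=> j jN; have [w1 _] := Hw' j jN; rewrite (Krw z).
  have E2 : (nrm (f z) ^+ n) ^+ 2 = (nrm (f z) ^+ 2) ^+ n by rewrite -!exprM mulnC.
  by rewrite nrmX E2 -expRM_natl mulrN1 -[nrm (f z) ^+ n * _]exprMn -expr2.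
have dF z : nrm z < 1 -> (forall j, (j < N)%N -> z != w j) -> cdiff F z.
  move=> z1 zw; apply: cdiffM; first exact: cdiff_cst.
  apply: cdiffM; first by apply: cdiffX; have [] := df z z1.
  apply: (@cdiff_prod _ N (fun j u => invblaschke (w j) u ^+ m j)) => j jN.
  by apply/cdiffX/cdiff_invblaschke/zw.
have z0K : Kr z0.
  by split; [rewrite le_max lexx|move=> j /z0w/ltW].
have F1 : nrm (F z0) <= 1.
  apply: (max_modulus bKr _ _ z0K).
    by move=> z Kz; apply/cdiff_cont/dF; [exact: Kr1|move=> j; exact: Krw].
  move=> z Kz; have [zr zeta_] := Kz.
  have sq1 : nrm (F z) ^+ 2 <= 1 -> nrm (F z) <= 1.
    by rewrite expr_le1// nrm_ge0.
  have f21 : (nrm (f z) ^+ 2) ^+ n <= 1.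
    by rewrite exprn_ile1 ?sqr_ge0// expr_le1 ?nrm_ge0//; have [] := df z (Kr1 z Kz).
  have [[j jN zj]|nz] := pselect (exists2 j, (j < N)%N & nrm (z - w j) = eta).
    left; apply: sq1; rewrite nF//.
    have [Ew _] := Hw j jN; have fz := near_E _ z Ew; rewrite zj lexx in fz.
    have {}fz := ltW (fz isT).
    apply: (@le_trans _ _ (expR (-2) * (expR (- L * (2 * n%:R)) * expR (2 * A * K)))).
      rewrite ler_pM2l ?expR_gt0//; apply: ler_pM; rewrite ?expR_ge0 ?exprn_ge0 ?nrm_ge0 //.
        rewrite -exprM -natrM mulrC expRM_natl lerXn2r ?nnegrE ?nrm_ge0 ?expR_ge0//.
      by rewrite ler_expR Shi.
    have E3 : -2 + (- L * (2 * n%:R) + 2 * A * K) = - (2 * (n%:R * L - A * K) + 2) by ring.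
    rewrite -!expRD E3 expR_le1; move: nlo; clear; lra.
  have [zrho|zrho] := eqVneq (nrm z) rho; [left|right].
    apply: sq1; rewrite nF//.
    have S1 : S z <= 1.
      have X1 j : (j < N)%N -> ln (1 + bpair z (w j)) <= (M + 1)^-1.
        move=> jN; have [w1 _] := Hw' j jN; have z1 := Kr1 z Kz.
        apply: (le_trans (ln1D_le (bpair_ge0 z1 w1))).
        have zw := zeta_ j jN.
        have e20 : 0 < eta ^+ 2 by rewrite exprn_gt0.
        have dz : nrm (z - w j) ^+ 2 >= eta ^+ 2 by rewrite lerXn2r ?nnegrE ?nrm_ge0// ltW.
        rewrite /bpair ler_pdivrMr; last exact: lt_le_trans dz.
        have A1 := one_sub_sqr (nrm_ge0 z) z1.
        have A2 : 0 <= 1 - nrm (w j) ^+ 2 <= 1.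
          rewrite subr_ge0 expr_le1 ?nrm_ge0// (ltW w1)/= gerBl sqr_ge0//.
        have A3 : 2 * (1 - nrm z) <= eta ^+ 2 / (M + 1).
          have : 1 - eta ^+ 2 / (2 * (M + 1)) <= nrm z by rewrite zrho le_max lexx orbT.
          have -> : eta ^+ 2 / (M + 1) = 2 * (eta ^+ 2 / (2 * (M + 1))).
            by field; rewrite gt_eqF.
          clear; lra.
        apply: (@le_trans _ _ (eta ^+ 2 / (M + 1) * 1)).
          case/andP: A1 => a1 a2; case/andP: A2 => b1 b2.
          by apply: ler_pM => //; apply: (le_trans a2).
        by rewrite mulr1 mulrC ler_wpM2l// invr_ge0 ltW.
      apply: (@le_trans _ _ (M * (M + 1)^-1)).
        rewrite /S /M mulr_suml; apply: ler_sum => j _.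
        by rewrite ler_wpM2l// X1.
      by rewrite ler_pdivrMr// mul1r lerDl ler01.
    apply: (@le_trans _ _ (expR (-2) * (1 * expR 1))).
      rewrite ler_pM2l ?expR_gt0//; apply: ler_pM; rewrite ?expR_ge0 ?exprn_ge0 ?nrm_ge0 //.
      by rewrite ler_expR.
    rewrite mul1r -expRD expR_le1; clear; lra.
  have gpos j : (j < N)%N -> 0 < nrm (z - w j) - eta.
    move=> jN; rewrite subr_gt0 lt_neqAle zeta_// andbT eq_sym.
    by apply/eqP => zj; apply: nz; exists j.
  have [e e0 He] := finite_min gpos.
  have r0 : 0 < rho - nrm z by rewrite subr_gt0 lt_neqAle zrho zr.
  exists (Num.min e (rho - nrm z)); first by rewrite lt_min e0.
  move=> u; rewrite lt_min => /andP[ue ur].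
  have Ku : Kr u.
    split; first by have := nrm_lb u z; move: ur; clear; lra.
    by move=> j jN; have := He j jN; have := nrm_tri u z (w j); rewrite (nrmB z u); move: ue; clear; lra.
  by split => //; apply: dF; [exact: Kr1|move=> j; exact: Krw].
have zw0 j : (j < N)%N -> z0 != w j by exact: Krw.
have Slo : K * k / 18 <= S z0.
  apply: (@le_trans _ _ (K * ((1 - nrm z0) / (18 * s)))).
    rewrite -mulrA ler_pM2l// ler_pdivlMr ?mulr_gt0//.
    by have -> : k / 18 * (18 * s) = k * s by field.
  apply: (@le_trans _ _ (K * \sum_(j < N) h / (1 - nrm (w j)) * ln (1 + bpair z0 (w j)))).
    by rewrite ler_pM2l//; exact: (bpair_sum_ge h0 Nh Hw' zeta1 z01 z0s zw0).
  rewrite mulr_sumr; apply: ler_sum => j _.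
  by rewrite mulrA ler_wpM2r ?lnX0 ?mlo.
apply: (le_trans _ eT); rewrite leNgt; apply/negP => fbig.
have : nrm (F z0) ^+ 2 <= 1 by rewrite expr_le1// nrm_ge0.
rewrite nF//; apply/negP; rewrite -ltNge.
apply: (@lt_le_trans _ _ (expR (-2) * (expR (- T * (2 * n%:R)) * expR (K * k / 18)))).
  rewrite -!expRD expR_gt1.
  have nT : n%:R * T <= (A * K / L + 1) * T by rewrite ler_wpM2r// ltW.
  have LT : A * K / L * T <= K * k / 144.
    rewrite mulrAC ler_pdivrMr//.
    apply: (@le_trans _ _ (K * k / 144 * (q * T / k))).
      by rewrite qE le_eqVlt; apply/orP; left; apply/eqP; field; rewrite gt_eqF.
    by apply: ler_wpM2l L1; apply: divr_ge0; [apply: mulr_ge0; exact: ltW|exact: ler0n].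
  move: nT LT Kk T0; clear; lra.
rewrite ler_pM2l ?expR_gt0//; apply: ler_pM; rewrite ?expR_ge0 ?ler_expR//.
rewrite -exprM -natrM mulrC expRM_natl lerXn2r ?nnegrE ?nrm_ge0 ?expR_ge0//.
exact: ltW.
Qed.

End Crossing_theorem.

(** * Nontangential limits and accessible boundary points *)

Section Boundary_curves.
Variable R : realType.
Local Notation C := R[i].
Implicit Types (z w zeta : C) (f : C -> C) (sigma : R -> C).

Lemma compact_bounded_closedE (K : set C) : compact K -> bounded_closed K.
Proof.
move=> cK; split.
  have [->|/set0P K0] := eqVneq K set0; first by exists 0.
  have [|c Kc Hc] := @compact_max _ K (fun z => nrm z) cK K0.
    by apply: (@lipschitz_cont _ _ _ 1) => w z _ _; rewrite mul1r nrm_dist.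
  by exists (nrm c).
move=> z Hz; have [k Kk _] := Hz 1 ltr01.
have [||c Kc Hc] := @compact_min _ K (fun w => nrm (w - z)) cK.
- by exists k.
- apply: (@lipschitz_cont _ _ _ 1) => w u _ _; rewrite mul1r.
  apply: (le_trans (nrm_dist _ _)).
  by have -> : w - z - (u - z) = w - u by ring.
have [<-//|cz] := eqVneq c z.
have c0 : 0 < nrm (c - z) by rewrite nrm_gt0 subr_eq0.
by have [w Kw] := Hz _ c0; rewrite ltNge Hc.
Qed.

Lemma crossing_small_bounded (k tau M : R) : 0 < k -> 0 < tau -> 0 < M ->
  exists2 eps : R, 0 < eps & forall f zeta s (E : set C) z0,
  (forall z, nrm z < 1 -> cdiff f z /\ nrm (f z) <= M) ->
  nrm zeta = 1 -> 0 < s -> bounded_closed E ->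
  (forall z, E z -> nrm z < 1 /\ nrm (f z) < eps) ->
  (forall r, s <= r <= 2 * s -> exists2 w, E w & nrm (w - zeta) = r) ->
  nrm z0 < 1 -> nrm (z0 - zeta) <= s -> k * s <= 1 - nrm z0 ->
  nrm (f z0) <= tau.
Proof.
move=> k0 tau0 M0; have [e e0 He] := crossing_small k0 (divr_gt0 tau0 M0).
exists (e * M); first by rewrite mulr_gt0.
move=> f zeta s E z0 df zeta1 s0 bE Ef hit z01 z0s z0k.
pose g z := (M^-1)%:C * f z.
have ng z : nrm (g z) = nrm (f z) / M.
  by rewrite nrmM nrm_real gtr0_norm ?invr_gt0// mulrC.
suff : nrm (g z0) <= tau / M by rewrite ng ler_pM2r// invr_gt0.
apply: (He g zeta s E) => // [z z1|z /Ef[z1 fz]].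
  have [dfz fM] := df z z1; split; last by rewrite ng ler_pdivrMr// mul1r.
  by apply: cdiffM => //; exact: cdiff_cst.
by split => //; rewrite ng ltr_pdivrMr.
Qed.

Definition path_in (a b : R) sigma := forall t, a <= t <= b -> forall e : R, 0 < e ->
  exists2 d : R, 0 < d & forall u, a <= u <= b -> `|u - t| < d -> nrm (sigma u - sigma t) < e.

Lemma path_bounded_closed a b sigma : path_in a b sigma ->
  bounded_closed (sigma @` `[a, b]).
Proof.
move=> cs; apply: compact_bounded_closedE; apply: continuous_compact; last exact: segment_compact.
apply/(within_continuousP _ _ (@metrizesR R) (@metrizesC R)) => t /=.
rewrite in_itv/= => tab e e0; have [d d0 Hd] := cs t tab e e0.
by exists d => // u; rewrite in_itv/=; exact: Hd.
Qed.

Lemma path_hits a b sigma zeta x y (v : R) : path_in a b sigma -> a <= x <= b -> a <= y <= b ->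
  nrm (sigma x - zeta) <= v <= nrm (sigma y - zeta) ->
  exists2 t, a <= t <= b & nrm (sigma t - zeta) = v.
Proof.
move=> cs /andP[ax xb] /andP[ay yb] /andP[xv vy].
pose p := Num.min x y; pose q := Num.max x y.
have pq : p <= q by rewrite /p /q; case: (leP x y) => // /ltW.
have ap : a <= p by rewrite le_min ax.
have qb : q <= b by rewrite ge_max xb.
have cg : {within `[p, q], continuous (fun t => nrm (sigma t - zeta))}.
  apply/scontP => t /andP[pt tq] e e0.
  have [|d d0 Hd] := cs t _ e e0; first by rewrite (le_trans ap)// (le_trans tq).
  exists d => // u /andP[pu uq] ut; apply: le_lt_trans (nrm_dist _ _) _.
  have -> : sigma u - zeta - (sigma t - zeta) = sigma u - sigma t by ring.
  by apply: Hd => //; rewrite (le_trans ap)// (le_trans uq).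
have [|c] := IVT pq cg (v := v).
  rewrite ge_min le_max /p /q; case: (leP x y) => _; by rewrite xv vy ?orbT.
rewrite in_itv/= => /andP[pc cq] cv.
by exists c => //; rewrite (le_trans ap)// (le_trans cq).
Qed.

Definition disk_curve sigma := (forall t, 0 <= t < 1 -> nrm (sigma t) < 1) /\
  (forall t, 0 <= t < 1 -> forall e : R, 0 < e -> exists2 d : R, 0 < d &
    forall u, 0 <= u < 1 -> `|u - t| < d -> nrm (sigma u - sigma t) < e).

Definition lim1 (g : R -> C) (l : C) := forall e : R, 0 < e ->
  exists2 t0, 0 <= t0 < 1 & forall t, t0 <= t < 1 -> nrm (g t - l) < e.

(** By the intermediate value theorem, an arc of a curve going from distance s to distance 2 s meets
    all the circles in between, so its trace can serve as the set E. *)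
Lemma disk_curve_crossing f sigma zeta (k tau M : R) : 0 < k -> 0 < tau -> 0 < M ->
  (forall z, nrm z < 1 -> cdiff f z /\ nrm (f z) <= M) -> nrm zeta = 1 ->
  disk_curve sigma ->
  exists2 eps : R, 0 < eps & forall t0 x y s z0, 0 <= t0 ->
  (forall t, t0 <= t < 1 -> nrm (f (sigma t)) < eps) ->
  t0 <= x < 1 -> t0 <= y < 1 -> 0 < s -> nrm (sigma x - zeta) <= s ->
  2 * s <= nrm (sigma y - zeta) ->
  nrm z0 < 1 -> nrm (z0 - zeta) <= s -> k * s <= 1 - nrm z0 ->
  nrm (f z0) <= tau.
Proof.
move=> k0 tau0 M0 df zeta1 [sD cs].
have [eps eps0 He] := crossing_small_bounded k0 tau0 M0; exists eps => //.
move=> t0 x y s z0 t00 fs /andP[x0 x1] /andP[y0 y1] s0 xs ys z01 z0s z0k.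
pose b := Num.max x y; have b1 : b < 1 by rewrite gt_max x1.
have cb : path_in t0 b sigma.
  move=> t /andP[tt tb] e e0; have [|d d0 Hd] := cs t _ e e0.
    by rewrite (le_trans t00)// (le_lt_trans tb).
  exists d => // u /andP[tu ub]; apply: Hd.
  by rewrite (le_trans t00)// (le_lt_trans ub).
apply: (He f zeta s (sigma @` `[t0, b]) z0) => //.
- exact: path_bounded_closed.
- move=> _ [t + <-]; rewrite /= in_itv/= => /andP[tt tb].
  have t1 := le_lt_trans tb b1.
  by split; [apply: sD; rewrite (le_trans t00)|apply: fs; rewrite tt].
- move=> r /andP[sr rs].
  have [|||t tb tr] := @path_hits t0 b sigma zeta x y r cb.
  + by rewrite x0 le_max lexx.
  + by rewrite y0 le_max lexx orbT.
  + by rewrite (le_trans xs)// (le_trans rs).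
  by exists (sigma t) => //; exists t; rewrite //= in_itv.
Qed.

(** [k] measures the opening of the Stolz region at [zeta]; the limit is uniform in each region. *)
Definition nontangential_limit f zeta (p : C) := forall k tau : R, 0 < k -> 0 < tau ->
  exists2 s0 : R, 0 < s0 & forall z, nrm z < 1 -> nrm (z - zeta) <= s0 ->
    k * nrm (z - zeta) <= 1 - nrm z -> nrm (f z - p) <= tau.

Lemma cdiff_shift f p (M : R) z : cdiff f z /\ nrm (f z) <= M ->
  cdiff (fun z => f z + (- p)) z /\ nrm (f z + (- p)) <= M + nrm p.
Proof.
move=> [df fM]; split; first by apply: cdiffD => //; exact: cdiff_cst.
by rewrite (le_trans (nrm_sub _ _))// lerD2r.
Qed.

(** For z in a Stolz region take s = |z - zeta|. The tail of sigma, on which f - p is small, runs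
    from distance 2 s to distance s, and the threshold does not depend on s. *)
Lemma lindelof f sigma zeta p (M : R) : 0 < M ->
  (forall z, nrm z < 1 -> cdiff f z /\ nrm (f z) <= M) -> nrm zeta = 1 ->
  disk_curve sigma -> lim1 sigma zeta -> lim1 (f \o sigma) p ->
  nontangential_limit f zeta p.
Proof.
move=> M0 df zeta1 cs sz fp k tau k0 tau0.
have M'0 : 0 < M + nrm p by rewrite ltr_pwDl// nrm_ge0.
have [eps eps0 He] := @disk_curve_crossing _ sigma zeta k tau _ k0 tau0 M'0
  (fun z lt1 => cdiff_shift p (df z lt1)) zeta1 cs.
have [t0 /andP[t00 t01] Ht0] := fp eps eps0.
have d0 : 0 < nrm (sigma t0 - zeta).
  rewrite nrm_gt0 subr_eq0; apply/eqP => E.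
  have := cs.1 t0; rewrite E zeta1 ltxx t00 t01 => /(_ isT); by [].
exists (nrm (sigma t0 - zeta) / 2); first by rewrite divr_gt0.
move=> z z1 zs zk.
have s0 : 0 < nrm (z - zeta).
  by rewrite nrm_gt0 subr_eq0; apply/eqP => E; rewrite E zeta1 ltxx in z1.
have [t1 /andP[t10 t11] Ht1] := sz _ s0.
pose x := Num.max t0 t1.
have x1 : x < 1 by rewrite gt_max t01.
apply: (He t0 x t0 (nrm (z - zeta))) => //.
- by rewrite le_max lexx x1.
- by rewrite lexx t01.
- by apply/ltW/Ht1; rewrite le_max lexx orbT x1.
- lra.
Qed.

(** Let a be a cluster point of sigma at its end. If sigma kept leaving the disk of radius 2 s
    around a, arcs on which f - p is arbitrarily small would cross from s to 2 s and force |f z0 -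
    p| to be at most half of itself at the fixed point z0 = (1 - s) a, where it is not 0. *)
Lemma curve_lands f sigma p (M : R) : 0 < M ->
  (forall z, nrm z < 1 -> [/\ cdiff f z, nrm (f z) <= M & f z != p]) ->
  disk_curve sigma -> lim1 (fun t => (nrm (sigma t))%:C) 1 -> lim1 (f \o sigma) p ->
  exists2 zeta, nrm zeta = 1 & lim1 sigma zeta.
Proof.
move=> M0 df cs s1 fp.
have df' z : nrm z < 1 -> cdiff f z /\ nrm (f z) <= M by move=> /df[].
have M'0 : 0 < M + nrm p by rewrite ltr_pwDl// nrm_ge0.
pose D := [set z : C | nrm (z - 0) <= 1].
pose P (d : R) (x : C) := exists t, [/\ 0 <= t < 1, 1 - d < t & x = sigma t].
have [| |a Da Ha] := @compact_cluster R D P (bounded_closed_compact (bounded_closed_ball 0 1)).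
- by move=> d e x d0 de [t [t01 td ->]]; exists t; split => //; lra.
- move=> d d0; pose t := Num.max 0 (1 - d / 2).
  have t01 : 0 <= t < 1 by rewrite le_max lexx gt_max ltr01 /=; lra.
  exists (sigma t); first by rewrite /D /= subr0 ltW// cs.1.
  exists t; split => //; rewrite lt_max; apply/orP; right; lra.
have a1 : nrm a = 1.
  apply/eqP; rewrite eq_le; apply/andP; split; first by move: Da; rewrite /D /= subr0.
  apply/ler_addgt0Pr => e e0; have e20 : 0 < e / 2 by rewrite divr_gt0.
  have [t0 /andP[t00 t01] Ht0] := s1 _ e20.
  have m0 : 0 < Num.min (e / 2) (1 - t0) by rewrite lt_min e20 subr_gt0.
  have [x [_ [t [/andP[tt0 tt1] td ->]] xa]] := Ha _ m0.
  have tt : t0 <= t < 1.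
    rewrite tt1 andbT; have : Num.min (e / 2) (1 - t0) <= 1 - t0 by rewrite ge_min lexx orbT.
    lra.
  have := Ht0 t tt; rewrite -(rmorph1 (real_complex R)) -rmorphB nrm_real ltr_norml => /andP[h1 _].
  have : Num.min (e / 2) (1 - t0) <= e / 2 by rewrite ge_min lexx.
  have := nrm_lb (sigma t) a; lra.
exists a => // e e0.
pose s := Num.min (e / 2) (1 / 2).
have s0 : 0 < s by rewrite lt_min divr_gt0//= divr_gt0.
have s2 : s <= 1 / 2 by rewrite ge_min lexx orbT.
have se : 2 * s <= e.
  have : s <= e / 2 by rewrite ge_min lexx.
  lra.
pose z0 : C := (1 - s)%:C * a.
have nz0 : nrm z0 = 1 - s by rewrite nrmM nrm_real a1 mulr1 ger0_norm; lra.
have z0a : nrm (z0 - a) = s.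
  have -> : z0 - a = (- s)%:C * a by rewrite /z0 rmorphB rmorphN rmorph1; ring.
  by rewrite nrmM nrm_real normrN a1 mulr1 gtr0_norm.
have z01 : nrm z0 < 1 by lra.
have tau0 : 0 < nrm (f z0 - p) / 2.
  by rewrite divr_gt0// nrm_gt0 subr_eq0; have [] := df z0 z01.
have [eps eps0 He] := @disk_curve_crossing _ sigma a 1 _ _ ltr01 tau0 M'0
  (fun z lt1 => cdiff_shift p (df' z lt1)) a1 cs.
have [t0 /andP[t00 t01] Ht0] := fp eps eps0.
exists t0; rewrite ?t00// => y /andP[ty y1]; rewrite ltNge; apply/negP => ey.
have m0 : 0 < Num.min s (1 - t0) by rewrite lt_min s0 subr_gt0.
have [x [_ [t [/andP[tt0 tt1] td ->]] xa]] := Ha _ m0.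
have ms : Num.min s (1 - t0) <= s by rewrite ge_min lexx.
have mt : Num.min s (1 - t0) <= 1 - t0 by rewrite ge_min lexx orbT.
have : nrm (f z0 + (- p)) <= nrm (f z0 - p) / 2.
  apply: (He t0 t y s z0) => //.
  - by rewrite tt1 andbT; lra.
  - by rewrite ty.
  - lra.
  - exact: le_trans se ey.
  - by rewrite z0a.
  - by rewrite nz0; lra.
by rewrite leNgt; have := tau0; move: (nrm _) => u; lra.
Qed.

End Boundary_curves.

Section Accessible_points.
Variable R : realType.
Local Notation C := R[i].
Variables (G : set C) (phi psi : C -> C) (MG : R).
Hypothesis Gopen : forall z, G z -> exists2 d : R, 0 < d & forall w, nrm (w - z) < d -> G w.
Hypothesis MG0 : 0 < MG.
Hypothesis Gbounded : forall z, G z -> nrm z <= MG.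
Hypothesis phi_disk : forall u, G u -> nrm (phi u) < 1.
Hypothesis phi_cont : forall u, G u -> ccont phi u.
Hypothesis psi_dom : forall z, nrm z < 1 -> G (psi z).
Hypothesis psi_cdiff : forall z, nrm z < 1 -> cdiff psi z.
Hypothesis psiK : forall u, G u -> psi (phi u) = u.
Hypothesis phiK : forall z, nrm z < 1 -> phi (psi z) = z.

Lemma compl_closed (u : C) :
  (forall d : R, 0 < d -> exists2 w, (~` G) w & nrm (w - u) < d) -> (~` G) u.
Proof. by move=> H /Gopen[d d0 Hd]; have [w nGw /Hd] := H d d0. Qed.

Lemma compl_nonempty : (~` G) !=set0.
Proof.
exists (MG + 1)%:C => /Gbounded; rewrite nrm_real ger0_norm; last by rewrite addr_ge0// ltW.
by rewrite leNgt ltrDl ltr01.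
Qed.

(** The points of G at distance at least e from the complement form a compact set, whose image under
    phi stays away from the circle. *)
Lemma psi_near_compl (e : R) : 0 < e -> exists2 d : R, 0 < d &
  forall z, 1 - d < nrm z -> nrm z < 1 -> exists2 p, ~ G p & nrm (psi z - p) < e.
Proof.
move=> e0; pose K := [set u | forall p, ~ G p -> e <= nrm (u - p)].
have KG u : K u -> G u.
  move=> Ku; have [//|nGu] := pselect (G u).
  by have := Ku u nGu; rewrite subrr nrm0 leNgt e0.
have cK : compact K.
  apply: (@compact_bounded_closed _ _ MG).
    by move=> u /KG/Gbounded.
  move=> z Hz p nGp; apply/ler_addgt0Pr => d /Hz[w Kw wz].
  have := Kw p nGp; have := nrm_tri z w p; lra.
have H (d : R) (z : C) : nrm z < 1 -> ~ K (psi z) -> exists2 p, ~ G p & nrm (psi z - p) < e.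
  move=> z1 nK; have [//|nex] := pselect (exists2 p, ~ G p & nrm (psi z - p) < e).
  exfalso; apply: nK => p nGp; rewrite leNgt; apply/negP => zp.
  by apply: nex; exists p.
have [K0|/set0P Kn0] := eqVneq K set0.
  by exists 1 => // z _ z1; apply: (H 1) => //; rewrite K0.
have [|c Kc Hc] := @compact_max _ K (fun u => nrm (phi u)) cK Kn0.
  by apply: ccont_nrm => u /KG; exact: phi_cont.
exists (1 - nrm (phi c)); first by rewrite subr_gt0 phi_disk//; exact: KG.
move=> z zd z1; apply: (H 1) => // /Hc; rewrite phiK//; lra.
Qed.

Lemma end_curve (c : R -> C) p : ~ G p -> (forall t, 0 <= t < 1 -> G (c t)) ->
  (forall t, 0 <= t < 1 -> forall e : R, 0 < e -> exists2 d : R, 0 < d &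
    forall u, 0 <= u < 1 -> `|u - t| < d -> nrm (c u - c t) < e) ->
  lim1 c p ->
  [/\ disk_curve (phi \o c), lim1 (fun t => (nrm (phi (c t)))%:C) 1 &
      lim1 (psi \o (phi \o c)) p].
Proof.
move=> nGp cG cc cp; split.
- split=> [t t01|t t01 e e0]; first by apply/phi_disk/cG.
  have [d d0 Hd] := phi_cont (cG t t01) e0; have [r r0 Hr] := cc t t01 d d0.
  by exists r => // u u01 ut; apply/Hd/Hr.
- move=> e e0; pose e1 := Num.min e (1 / 2).
  have e10 : 0 < e1 by rewrite lt_min e0 divr_gt0.
  have e1e : e1 <= e by rewrite ge_min lexx.
  have e12 : e1 <= 1 / 2 by rewrite ge_min lexx orbT.
  have bK := bounded_closed_ball (0 : C) (1 - e1).
  have K1 z : nrm (z - 0) <= 1 - e1 -> nrm z < 1 by rewrite subr0; lra.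
  have [||z0 z01 Hz0] := @compact_min _ _ (fun z => nrm (psi z - p)) (bounded_closed_compact bK).
  + by exists 0; rewrite /= subr0 nrm0; lra.
  + apply: (@ccont_nrm _ _ (fun z => psi z + (- p))) => z /K1 z1.
    by apply/cdiff_cont/cdiffD; [exact: psi_cdiff|exact: cdiff_cst].
  have m0 : 0 < nrm (psi z0 - p).
    rewrite nrm_gt0 subr_eq0; apply/eqP => E; apply: nGp; rewrite -E.
    exact/psi_dom/K1.
  have [t0 t01 Ht0] := cp _ m0; exists t0 => // t /andP[tt t1].
  have t00 : 0 <= t0 by case/andP: t01.
  have Gt : G (c t) by apply: cG; rewrite (le_trans t00).
  rewrite -(rmorph1 (real_complex R)) -rmorphB nrm_real ler0_norm; last first.
    by rewrite subr_le0 ltW// phi_disk.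
  rewrite opprB ltrBlDr -ltrBlDl ltNge; apply/negP => H.
  have := Ht0 t; rewrite tt t1 => /(_ isT); rewrite -[c t]psiK// ltNge Hz0//=.
  by rewrite subr0; lra.
- move=> e /cp[t0 t01 Ht0]; exists t0 => // t /andP[tt t1]; rewrite /= psiK; last first.
    by apply: cG; case/andP: t01 => t00 _; rewrite (le_trans t00).
  by apply: Ht0; rewrite tt.
Qed.

(** The points of the segment before p are closer to u than p, the nearest point of the complement,
    so they lie in G. *)
Lemma segment_to_nearest u p : G u -> ~ G p -> (forall q, ~ G q -> nrm (u - p) <= nrm (u - q)) ->
  let c t := u + t%:C * (p - u) in
  [/\ forall t, 0 <= t < 1 -> G (c t) /\ nrm (c t - p) <= nrm (u - p),
      (forall t, 0 <= t < 1 -> forall e : R, 0 < e -> exists2 d : R, 0 < d &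
        forall v, 0 <= v < 1 -> `|v - t| < d -> nrm (c v - c t) < e) &
      lim1 c p].
Proof.
move=> Gu nGp near c.
have up0 : 0 < nrm (u - p).
  by rewrite nrm_gt0 subr_eq0; apply/eqP => E; apply: nGp; rewrite -E.
have cp t : nrm (c t - p) = `|1 - t| * nrm (u - p).
  have -> : c t - p = (1 - t)%:C * (u - p).
    by rewrite /c rmorphB rmorph1; ring.
  by rewrite nrmM nrm_real.
split.
- move=> t /andP[t0 t1]; split; last first.
    rewrite cp ler_piMl ?nrm_ge0// ger0_norm; lra.
  have [//|/near] := pselect (G (c t)).
  have -> : u - c t = t%:C * (u - p) by rewrite /c; ring.
  by rewrite nrmM nrm_real ger0_norm// leNgt gtr_pMl// t1.
- move=> t _ e e0; exists (e / nrm (u - p)); first by rewrite divr_gt0.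
  move=> v _; rewrite ltr_pdivlMr//.
  have -> : c v - c t = - ((v - t)%:C * (u - p)) by rewrite /c rmorphB; ring.
  by rewrite nrmN nrmM nrm_real.
- move=> e e0; pose t0 := Num.max 0 (1 - e / nrm (u - p) / 2).
  have q0 : 0 < e / nrm (u - p) by rewrite divr_gt0.
  exists t0.
    by rewrite le_max lexx gt_max ltr01 /=; lra.
  move=> t /andP[tt t1]; rewrite cp ger0_norm; last by lra.
  rewrite -ltr_pdivlMr//.
  have : 1 - e / nrm (u - p) / 2 <= t by apply: le_trans tt; rewrite le_max lexx orbT.
  lra.
Qed.

Lemma psi_bound z : nrm z < 1 -> cdiff psi z /\ nrm (psi z) <= MG.
Proof. by move=> z1; split; [exact: psi_cdiff|apply/Gbounded/psi_dom]. Qed.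

Lemma circle_point (zeta : C) (r s : R) : nrm zeta = 1 -> 0 < r -> r < 1 -> 1 - r <= s -> s <= 1 ->
  exists2 w, nrm w = r & nrm (w - zeta) = s.
Proof.
move=> z1 r0 r1 rs s1.
(* For zeta = 1, the real part of a point of modulus r at distance s from 1; the general case is a
   rotation. *)
pose x := (1 + r ^+ 2 - s ^+ 2) / 2.
have sr : (1 - r) ^+ 2 <= s ^+ 2 by rewrite lerXn2r ?nnegrE; lra.
have s21 : s ^+ 2 <= 1 by rewrite expr_le1//; lra.
have xr : x <= r by rewrite /x ler_pdivrMr//; nra.
have x0 : 0 <= x by rewrite /x divr_ge0//; have := sqr_ge0 r; lra.
have x2 : x ^+ 2 <= r ^+ 2 by rewrite lerXn2r ?nnegrE//; exact: ltW.
pose w : C := x +i* Num.sqrt (r ^+ 2 - x ^+ 2).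
have yy : Num.sqrt (r ^+ 2 - x ^+ 2) ^+ 2 = r ^+ 2 - x ^+ 2 by rewrite sqr_sqrtr// subr_ge0.
have sq (a b : R) : 0 <= a -> 0 <= b -> a ^+ 2 = b ^+ 2 -> a = b.
  by move=> a0 b0 /eqP; rewrite eqrXn2// => /eqP.
exists (w * zeta).
  rewrite nrmM z1 mulr1; apply: sq; rewrite ?nrm_ge0 ?(ltW r0)//.
  by rewrite nrm_sqr /= yy; ring.
have -> : w * zeta - zeta = (w - 1) * zeta by ring.
rewrite nrmM z1 mulr1; apply: sq; rewrite ?nrm_ge0//; first by lra.
by rewrite nrm_sqr /= subr0 yy /x; field.
Qed.

(** For a suitable z near zeta0, the segment from psi z to its nearest point p of the complement has
    an image under phi that lands at some zeta, and Lindelof's theorem gives the limit p there. If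
    the image went farther than 2 s from zeta0, psi - p would be small on a crossing of the circles
    and hence at [base s], where it is at least the distance to the complement. *)
Lemma accessible_avoiding (zeta0 : C) (rho : R) (x1 x2 x3 : C) :
  nrm zeta0 = 1 -> 0 < rho -> ~ G x1 -> ~ G x2 -> ~ G x3 ->
  exists zeta p, [/\ nrm zeta = 1, nrm (zeta - zeta0) < rho, ~ G p /\ closure G p,
    [/\ p != x1, p != x2 & p != x3] & nontangential_limit psi zeta p].
Proof.
move=> z1 rho0 nG1 nG2 nG3.
pose s := Num.min (rho / 4) (1 / 4).
have s0 : 0 < s by rewrite lt_min !divr_gt0.
have s14 : s <= 1 / 4 by rewrite ge_min lexx orbT.
have srho : s <= rho / 4 by rewrite ge_min lexx.
have s01 : 0 <= s <= 1 by apply/andP; split; lra.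
have s0' : 0 <= s by lra.
have s201 : 0 <= s / 2 <= 1 by apply/andP; split; lra.
have s20 : 0 <= s / 2 by lra.
pose base (t : R) : C := (1 - t)%:C * zeta0.
have nb t : 0 <= t <= 1 -> nrm (base t) = 1 - t.
  by move=> /andP[t0 t1]; rewrite nrmM nrm_real z1 mulr1 ger0_norm; lra.
have bz t : 0 <= t -> nrm (base t - zeta0) = t.
  move=> t0; have -> : base t - zeta0 = (- t)%:C * zeta0.
    by rewrite /base rmorphB rmorphN rmorph1; ring.
  by rewrite nrmM nrm_real z1 mulr1 normrN ger0_norm.
have b1 t : 0 < t -> t <= 1 -> nrm (base t) < 1.
  by move=> t0 t1; rewrite nb; [lra|rewrite ltW].
(* If the nearest points were all among the xi, the product of the psi - xi would be small on an
   arc of a circle |w| = r with r close to 1, contradicting crossing_small at base (s / 2). *)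
have b1s : nrm (base s) < 1 by apply: b1 => //; lra.
have [p0 nGp0 Hp0] := nearest_point (psi (base s)) compl_nonempty compl_closed.
have m0 : 0 < nrm (psi (base s) - p0).
  by rewrite nrm_gt0 subr_eq0; apply/eqP => E; apply: nGp0; rewrite -E; exact: psi_dom.
pose M' := 4 * MG + nrm x1 + nrm x2 + nrm x3 + 1.
have M'1 : 1 <= M'.
  rewrite /M'; have := MG0; have := nrm_ge0 x1; have := nrm_ge0 x2; have := nrm_ge0 x3; lra.
have M'0 : 0 < M' by lra.
have [eps1 eps10 He1] := crossing_small_bounded ltr01 (divr_gt0 m0 (ltr0Sn _ 1)) M'0.
pose f3 z := (psi z + (- x1)) * ((psi z + (- x2)) * (psi z + (- x3))).
have b1s2 : nrm (base (s / 2)) < 1 by apply: b1; lra.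
have f30 : 0 < nrm (f3 (base (s / 2))).
  by rewrite nrm_gt0; rewrite !mulf_neq0// subr_eq0; apply/eqP => E;
    [apply: nG1|apply: nG2|apply: nG3]; rewrite -E; exact: psi_dom.
have psi_le z (x : C) : nrm z < 1 -> nrm x <= M' - MG -> nrm (psi z - x) <= M'.
  by move=> /psi_bound[_ h] xM; have := nrm_sub (psi z) x; lra.
have x1M : nrm x1 <= M' - MG by rewrite /M'; have := MG0; have := nrm_ge0 x2; have := nrm_ge0 x3; lra.
have x2M : nrm x2 <= M' - MG by have := MG0; rewrite /M'; have := nrm_ge0 x1; have := nrm_ge0 x3; lra.
have x3M : nrm x3 <= M' - MG by have := MG0; rewrite /M'; have := nrm_ge0 x1; have := nrm_ge0 x2; lra.
have M30 : 0 < M' * (M' * M') by rewrite !mulr_gt0.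
have [eps3 eps30 He3] := crossing_small_bounded ltr01 (divr_gt0 f30 (ltr0Sn _ 1)) M30.
(* eps1 serves the crossing that keeps the landing point near zeta0, MG bounds p, and eps3 makes the
   product f3 small when one factor is below eta, the other two being at most M'. *)
pose eta := Num.min eps1 (Num.min MG (eps3 / (M' * M'))).
have MM0 : 0 < M' * M' by rewrite mulr_gt0.
have eta0 : 0 < eta by rewrite !lt_min eps10 MG0 divr_gt0.
have [d d0 Hd] := psi_near_compl eta0.
have [z [p [z_1 zs nGp Hp [zp px]]]] : exists z p, [/\ nrm z < 1, nrm (z - zeta0) <= s, ~ G p,
    forall q, ~ G q -> nrm (psi z - p) <= nrm (psi z - q) &
    nrm (psi z - p) < eta /\ [/\ p != x1, p != x2 & p != x3]].
  apply: contrapT => nex.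
  (* Within d of 1, so that psi is eta-close to the complement on |w| = r, and within s / 2 of 1, so
     that this circle meets all circles around zeta0 of radius between s / 2 and s. *)
  pose r := 1 - Num.min (d / 2) (s / 2).
  have mm0 : 0 < Num.min (d / 2) (s / 2) by rewrite lt_min !divr_gt0.
  have md : Num.min (d / 2) (s / 2) <= d / 2 by rewrite ge_min lexx.
  have ms : Num.min (d / 2) (s / 2) <= s / 2 by rewrite ge_min lexx orbT.
  have r1 : r < 1 by rewrite /r; lra.
  have rd : 1 - d < r by rewrite /r; lra.
  pose E := [set w : C | nrm (w - 0) = r] `&` [set w | nrm (w - zeta0) <= s].
  have bE : bounded_closed E.
    have [[M HM] cl1] := bounded_closed_circle (0 : C) r.
    have [_ cl2] := bounded_closed_ball zeta0 s; split; first by exists M => w [/HM].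
    move=> u Hu; split.
      by apply: cl1 => e /Hu[w [w1 _] wu]; exists w.
    by apply: cl2 => e /Hu[w [_ w2] wu]; exists w.
  suff : nrm (f3 (base (s / 2))) <= nrm (f3 (base (s / 2))) / 2.
    by rewrite leNgt; move: f30; move: (nrm _) => u; lra.
  apply: (He3 f3 zeta0 (s / 2) E) => //.
  - move=> w w1; have dp := psi_cdiff w1; split.
      by do 2?[apply: cdiffM]; apply: cdiffD => //; exact: cdiff_cst.
    rewrite !nrmM; apply: ler_pM; rewrite ?mulr_ge0 ?nrm_ge0 ?psi_le//.
    by apply: ler_pM; rewrite ?nrm_ge0 ?psi_le.
  - lra.
  - move=> w [/= wr ws]; rewrite subr0 in wr.
    have w1 : nrm w < 1 by rewrite wr.
    split => //.
    have [|p1 nGp1 wp1] := Hd w _ w1; first by rewrite wr.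
    have [p nGp Hp] := nearest_point (psi w) compl_nonempty compl_closed.
    have wp : nrm (psi w - p) < eta by apply: le_lt_trans _ wp1; exact: Hp.
    have wp' : nrm (psi w - p) * (M' * M') < eps3.
      by rewrite -ltr_pdivlMr//; apply: lt_le_trans wp _; rewrite !ge_min lexx !orbT.
    have [/or3P[]/eqP pE|npx] := boolP [|| p == x1, p == x2 | p == x3].
    + rewrite !nrmM -pE; apply: le_lt_trans _ wp'; rewrite ler_wpM2l ?nrm_ge0//.
      by apply: ler_pM; rewrite ?nrm_ge0 ?psi_le.
    + rewrite !nrmM mulrCA -pE; apply: le_lt_trans _ wp'; rewrite ler_wpM2l ?nrm_ge0//.
      by apply: ler_pM; rewrite ?nrm_ge0 ?psi_le.
    + rewrite !nrmM mulrA mulrC -pE; apply: le_lt_trans _ wp'; rewrite ler_wpM2l ?nrm_ge0//.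
      by apply: ler_pM; rewrite ?nrm_ge0 ?psi_le.
    exfalso; apply: nex; exists w, p; split => //; split => //.
    by move: npx; rewrite !negb_or => /and3P.
  - move=> t /andP[t1 t2]; have [|||w wr wt] := @circle_point zeta0 r t z1 _ r1.
    + by rewrite /r; move: ms s14; lra.
    + by rewrite /r; move: ms t1; lra.
    + by move: t2 s14; lra.
    by exists w => //; split; rewrite /= ?subr0 ?wr// wt; move: t2; lra.
  - by rewrite bz.
  - by rewrite nb// mul1r subKr.
have zp1 : nrm (psi z - p) < eps1 by apply: lt_le_trans zp _; rewrite ge_min lexx.
have [cG cc cp] := segment_to_nearest (psi_dom z_1) nGp Hp.
pose c (t : R) : C := psi z + t%:C * (p - psi z).
have [sc s1 sp] := @end_curve c p nGp (fun t h => (cG t h).1) cc cp.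
have [|zeta zeta1 sz] := @curve_lands _ psi (phi \o c) p MG MG0 _ sc s1 sp.
  move=> w w1; have [dw wM] := psi_bound w1; split => //.
  by apply/eqP => E; apply: nGp; rewrite -E; exact: psi_dom.
exists zeta, p; split => //.
- suff H t : 0 <= t < 1 -> nrm (phi (c t) - zeta0) < 2 * s.
    have rho4 : 0 < rho / 4 by rewrite divr_gt0.
    have [t0 /andP[t00 t01] Ht0] := sz _ rho4.
    have := Ht0 t0; rewrite lexx t01 => /(_ isT) /=; have := H t0; rewrite t00 t01 => /(_ isT).
    have := nrm_tri (phi (c t0)) zeta zeta0; rewrite (nrmB zeta (phi _)); move: srho; lra.
  move=> /andP[t0 t1]; rewrite ltNge; apply/negP => far.
  have c0 : phi (c 0) = z by rewrite /c rmorph0 mul0r addr0 phiK.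
  have path : path_in 0 t (phi \o c).
    move=> v /andP[v0 vt] e e0; have [|r r0 Hr] := sc.2 v _ e e0.
      by rewrite v0 (le_lt_trans vt).
    by exists r => // u /andP[u0 ut]; apply: Hr; rewrite u0 (le_lt_trans ut).
  have zpM : nrm (psi z - p) < MG by apply: lt_le_trans zp _; rewrite !ge_min lexx !orbT.
  have pM : nrm p <= M' - MG.
    have [_ h] := psi_bound z_1; have := nrm_lb p (psi z); rewrite (nrmB p).
    by have := MG0; rewrite /M'; have := nrm_ge0 x1; have := nrm_ge0 x2; have := nrm_ge0 x3; lra.
  suff : nrm (psi (base s) + (- p)) <= nrm (psi (base s) - p0) / 2.
    by have := Hp0 p nGp; lra.
  apply: (He1 (fun w => psi w + (- p)) zeta0 s ((phi \o c) @` `[0, t])) => //.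
  - move=> w w1; split; last exact: psi_le.
    by apply: cdiffD; [exact: psi_cdiff|exact: cdiff_cst].
  - exact: path_bounded_closed.
  - move=> _ [v + <-]; rewrite /= in_itv/= => /andP[v0 vt].
    have v01 : 0 <= v < 1 by rewrite v0 (le_lt_trans vt).
    split; first exact: sc.1.
    by have [Gv cv] := cG v v01; rewrite psiK//; exact: le_lt_trans zp1.
  - move=> r /andP[sr r2s].
    have [|||v v01 vr] := @path_hits _ 0 t (phi \o c) zeta0 0 t r path.
    + by rewrite lexx.
    + by rewrite t0 lexx.
    + by rewrite /= c0 (le_trans zs)//= (le_trans r2s).
    by exists (phi (c v)) => //; exists v; rewrite //= in_itv.
  - by rewrite bz.
  - by rewrite nb// mul1r subKr.
- split => //; apply/closureP => e /cp[t0 /andP[t00 t01] Ht0].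
  exists (c t0); first by apply: (cG t0 _).1; rewrite t00.
  by apply: Ht0; rewrite lexx.
- exact: (lindelof MG0 psi_bound zeta1 sc sz sp).
Qed.

End Accessible_points.

(** * Crosscuts that are images of chords *)

Section Connectedness.
Variable R : realType.
Local Notation C := R[i].
Implicit Types (A B U V : set C).

Lemma connected_two_open A U V : connected A -> open U -> open V -> A `<=` U `|` V ->
  U `&` V = set0 -> A `&` U !=set0 -> A `<=` U.
Proof.
move=> cA oU oV AUV UV0 AU.
have E : A `&` U = A.
  apply: cA => //; first by exists U.
  exists (~` V); first exact: open_closedC.
  apply/seteqP; split=> z [Az zU]; split => //.
    by move=> Vz; have : (U `&` V) z by []; rewrite UV0.
  by have [//|Vz] := AUV z Az.
by rewrite -E => z [].
Qed.

Lemma connected_star (f : C -> C) A z0 : A z0 -> (forall z, A z -> ccont f z) ->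
  (forall z t, A z -> 0 <= t <= 1 -> A (z0 + t%:C * (z - z0))) -> connected (f @` A).
Proof.
move=> Az0 cf star.
pose seg z (t : R) := f (z0 + t%:C * (z - z0)).
have -> : f @` A = \bigcup_(z in A) (seg z @` `[0, 1]).
  apply/seteqP; split=> [_ [z Az <-]|_ [z Az [t t01 <-]]].
    exists z => //; exists 1; first by rewrite /= in_itv/= ler01 lexx.
    by rewrite /seg rmorph1 mul1r subrKC.
  exists (z0 + t%:C * (z - z0)) => //; apply: star => //.
apply: bigcup_connected.
  exists (f z0) => z Az; exists 0; first by rewrite /= in_itv/= lexx ler01.
  by rewrite /seg rmorph0 mul0r addr0.
move=> z Az; apply: connected_continuous_connected; first exact: segment_connected.
apply/(within_continuousP _ _ (@metrizesR R) (@metrizesC R)) => t.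
rewrite /= in_itv/= => t01 e e0; have [d d0 Hd] := cf _ (star z t Az t01) e e0.
have n0 : 0 < nrm (z - z0) + 1 by rewrite ltr_wpDl// nrm_ge0.
exists (d / (nrm (z - z0) + 1)); first by rewrite divr_gt0.
move=> u; rewrite in_itv/= => u01; rewrite ltr_pdivlMr// => ut; apply: Hd.
have -> : z0 + u%:C * (z - z0) - (z0 + t%:C * (z - z0)) = (u - t)%:C * (z - z0).
  by rewrite rmorphB/=; ring.
rewrite nrmM nrm_real; apply: le_lt_trans _ ut.
by rewrite ler_wpM2l// lerDl.
Qed.

End Connectedness.

Section Chord.
Variable R : realType.
Local Notation C := R[i].
Implicit Types (z w a zeta : C).

Definition dotp (z w : C) : R := complex.Re ((z^*)%C * w).

Lemma dotpE z w : dotp z w = complex.Re z * complex.Re w + complex.Im z * complex.Im w.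
Proof. by rewrite /dotp; case: z w => ? ? [? ?] /=; ring. Qed.

Lemma nrmB_sqr z w : nrm (z - w) ^+ 2 = nrm z ^+ 2 - 2 * dotp w z + nrm w ^+ 2.
Proof. by rewrite dotpE !nrm_sqr; case: z w => ? ? [? ?] /=; ring. Qed.

Lemma dotpD z w w' : dotp z (w + w') = dotp z w + dotp z w'.
Proof. by rewrite !dotpE; case: z w w' => ? ? [? ?] [? ?] /=; ring. Qed.

Definition midp (zeta1 zeta2 : C) : C := (1 / 2)%:C * (zeta1 + zeta2).

(* Positive on the cap cut off by the chord that contains the middle of the minor arc. *)
Definition side (zeta1 zeta2 z : C) : R :=
  dotp (midp zeta1 zeta2) z - nrm (midp zeta1 zeta2) ^+ 2.

Definition chord (zeta1 zeta2 : C) (t : R) : C := zeta1 + t%:C * (zeta2 - zeta1).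

Variables zeta1 zeta2 : C.
Hypothesis n1 : nrm zeta1 = 1.
Hypothesis n2 : nrm zeta2 = 1.
Let m := midp zeta1 zeta2.

Lemma nrm_chord_sqr t : nrm (chord zeta1 zeta2 t) ^+ 2 = 1 - t * (1 - t) * nrm (zeta2 - zeta1) ^+ 2.
Proof.
have := nrm_sqr zeta1; have := nrm_sqr zeta2; rewrite n1 n2 expr1n !nrm_sqr /chord.
case: (zeta1) (zeta2) => [a b] [c d] /= E1 E2.
have -> : (c - a) ^+ 2 + (d - b) ^+ 2 = (c ^+ 2 + d ^+ 2) + (a ^+ 2 + b ^+ 2) - 2 * (a * c + b * d) by ring.
have -> : (a + (t * (c - a) - 0 * (d - b))) ^+ 2 + (b + (t * (d - b) + 0 * (c - a))) ^+ 2 =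
  (1 - t) ^+ 2 * (a ^+ 2 + b ^+ 2) + t ^+ 2 * (c ^+ 2 + d ^+ 2) + 2 * t * (1 - t) * (a * c + b * d) by ring.
by rewrite -E1 -E2; ring.
Qed.

Lemma side_chord t : side zeta1 zeta2 (chord zeta1 zeta2 t) = 0.
Proof.
have := nrm_sqr zeta1; have := nrm_sqr zeta2; rewrite n1 n2 expr1n.
rewrite /side dotpE nrm_sqr /midp /chord.
case: (zeta1) (zeta2) => [a b] [c d] /= E1 E2.
have -> : 1 / 2 * (a + c) - 0 * (b + d) = (a + c) / 2 by field.
have -> : 1 / 2 * (b + d) + 0 * (a + c) = (b + d) / 2 by field.
have -> : (a + c) / 2 * (a + (t * (c - a) - 0 * (d - b))) + (b + d) / 2 * (b + (t * (d - b) + 0 * (c - a))) -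
   (((a + c) / 2) ^+ 2 + ((b + d) / 2) ^+ 2) =
  (1 / 4 - t / 2) * ((a ^+ 2 + b ^+ 2) - (c ^+ 2 + d ^+ 2)) by field.
by rewrite -E1 -E2 subrr mulr0.
Qed.

(** Both zeta2 - zeta1 and z - m are orthogonal to m, so they are parallel in the plane as m is not
    0. By [nrm_chord_sqr], |z| < 1 means t (1 - t) > 0. *)
Lemma side0_chord z : m != 0 -> zeta1 != zeta2 -> nrm z < 1 -> side zeta1 zeta2 z = 0 ->
  exists2 t, 0 < t < 1 & z = chord zeta1 zeta2 t.
Proof.
move=> m0 z12 z1 sz.
pose u := zeta2 - zeta1; pose v := z - m.
have u0 : 0 < nrm u by rewrite nrm_gt0 subr_eq0 eq_sym.
have mu : dotp m u = 0.
  have := side_chord 1; have := side_chord 0; rewrite /side /chord rmorph0 rmorph1 mul0r mul1r addr0 subrKC.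
  rewrite /u dotpD -/m => E1 E2.
  have -> : dotp m (- zeta1) = - dotp m zeta1.
    by rewrite !dotpE; case: (m) (zeta1) => ? ? [? ?] /=; ring.
  lra.
have mv : dotp m v = 0.
  move: sz; rewrite /side -/m /v !dotpE nrm_sqr; case: (m) (z) => ? ? [? ?] /= <-; ring.
have vE : v = (dotp u v / nrm u ^+ 2)%:C * u.
  have u20 : nrm u ^+ 2 != 0 by rewrite expf_neq0// gt_eqF.
  have cross : complex.Re v * complex.Im u = complex.Im v * complex.Re u.
    have mm : nrm m ^+ 2 != 0 by rewrite expf_neq0// nrm_eq0.
    apply: (mulfI mm); move: mu mv; rewrite !dotpE nrm_sqr.
    case: (m) (u) (v) => [p q] [r s] [x y] /= E1 E2.
    apply/eqP; rewrite -subr_eq0; apply/eqP.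
    have -> : (p ^+ 2 + q ^+ 2) * (x * s) - (p ^+ 2 + q ^+ 2) * (y * r) =
      (p * x + q * y) * (p * s - q * r) - (p * r + q * s) * (p * y - q * x) by ring.
    rewrite E1 E2; ring.
  apply/eqP; rewrite eq_complex; apply/andP.
  move: cross u20; rewrite dotpE nrm_sqr; case: (u) (v) => [r s] [x y] /= E nz.
  split; apply/eqP; apply: (mulIf nz).
    have -> : x * (r ^+ 2 + s ^+ 2) = r * (r * x) + s * (x * s) by ring.
    by rewrite E; field.
  have -> : y * (r ^+ 2 + s ^+ 2) = s * (s * y) + r * (y * r) by ring.
  by rewrite -E; field.
set t := dotp u v / nrm u ^+ 2 in vE.
have zE : z = chord zeta1 zeta2 (1 / 2 + t).
  have -> : z = m + v by rewrite /v subrKC.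
  rewrite vE /chord rmorphD mulrDl addrA; congr (_ + _).
  rewrite /m /midp /u; case: (zeta1) (zeta2) => [a b] [c d]; congr (_ +i* _); by field.
exists (1 / 2 + t) => //.
have : nrm z ^+ 2 < 1 by rewrite expr_lt1// nrm_ge0.
rewrite zE nrm_chord_sqr -/u ltrBlDr ltrDl pmulr_lgt0 ?exprn_gt0//.
move=> h; apply/andP; split; rewrite ltNge; apply/negP => h'; nra.
Qed.

(** The cap lies in the disk whose diameter is the chord. *)
Lemma side_near z : nrm z <= 1 -> 0 <= side zeta1 zeta2 z -> nrm (z - m) ^+ 2 <= 1 - nrm m ^+ 2.
Proof.
move=> z1; rewrite /side -/m => s0; rewrite nrmB_sqr.
have : nrm z ^+ 2 <= 1 by rewrite expr_le1// nrm_ge0.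
lra.
Qed.

Lemma side_segment z0 z t : side zeta1 zeta2 (z0 + t%:C * (z - z0)) =
  (1 - t) * side zeta1 zeta2 z0 + t * side zeta1 zeta2 z.
Proof.
rewrite /side -/m !dotpE; case: (m) z z0 => ? ? [? ?] [? ?] /=; ring.
Qed.

Lemma ball_segment (c z0 z : C) (r t : R) : nrm (z0 - c) < r -> nrm (z - c) < r -> 0 <= t <= 1 ->
  nrm (z0 + t%:C * (z - z0) - c) < r.
Proof.
move=> z01 z1 /andP[t0 t1].
have -> : z0 + t%:C * (z - z0) - c = (1 - t)%:C * (z0 - c) + t%:C * (z - c).
  by rewrite rmorphB rmorph1; ring.
rewrite (le_lt_trans (nrmD _ _))// !nrmM !nrm_real !ger0_norm//; last by lra.
have [->|t_gt] := eqVneq t 0; first by rewrite subr0 mul1r mul0r addr0.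
have : t * nrm (z - c) < t * r by rewrite ltr_pM2l// lt_def t_gt.
have : (1 - t) * nrm (z0 - c) <= (1 - t) * r by rewrite ler_wpM2l; [|lra|exact: ltW].
lra.
Qed.

Lemma disk_segment (z0 z : C) (t : R) : nrm z0 < 1 -> nrm z < 1 -> 0 <= t <= 1 ->
  nrm (z0 + t%:C * (z - z0)) < 1.
Proof.
by move=> z01 z1 t01; have := @ball_segment 0 z0 z 1 t; rewrite !subr0; apply.
Qed.

Lemma chord_disk t : zeta1 != zeta2 -> 0 < t < 1 -> nrm (chord zeta1 zeta2 t) < 1.
Proof.
move=> z12 /andP[t0 t1]; rewrite -(@expr_lt1 _ 2) ?nrm_ge0// nrm_chord_sqr.
suff : 0 < t * (1 - t) * nrm (zeta2 - zeta1) ^+ 2 by lra.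
apply: mulr_gt0; first by rewrite mulr_gt0// subr_gt0.
by rewrite exprn_gt0// nrm_gt0 subr_eq0 eq_sym.
Qed.

End Chord.

Section Chord_crosscut.
Variable R : realType.
Local Notation C := R[i].
Variables (G : set C) (phi psi : C -> C).
Hypothesis Gopen : open G.
Hypothesis phi_disk : forall u, G u -> nrm (phi u) < 1.
Hypothesis phi_cont : forall u, G u -> ccont phi u.
Hypothesis psi_dom : forall z, nrm z < 1 -> G (psi z).
Hypothesis psi_cont : forall z, nrm z < 1 -> ccont psi z.
Hypothesis psiK : forall u, G u -> psi (phi u) = u.
Hypothesis phiK : forall z, nrm z < 1 -> phi (psi z) = z.

Lemma boundaryE (l : C) : boundary G l <-> closure G l /\ ~ G l.
Proof. by rewrite /boundary; move/interior_id: Gopen => ->. Qed.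

Lemma chordC zeta1 zeta2 (t : R) : chord zeta1 zeta2 t = chord zeta2 zeta1 (1 - t).
Proof. by rewrite /chord rmorphB rmorph1; ring. Qed.

(** A chord of length D stays in the Stolz region of parameter D / 4 on its first half: its point z
    of parameter t has |z - zeta1| = t D and 1 - |z|^2 = t (1 - t) D^2. *)
Lemma chord_end zeta1 zeta2 p (e : R) : nrm zeta1 = 1 -> nrm zeta2 = 1 -> zeta1 != zeta2 ->
  nontangential_limit psi zeta1 p -> 0 < e ->
  exists2 d : R, 0 < d & forall t, 0 < t < d -> nrm (psi (chord zeta1 zeta2 t) - p) < e.
Proof.
move=> n1 n2 z12 nt e0; set D := nrm (zeta2 - zeta1).
have D0 : 0 < D by rewrite nrm_gt0 subr_eq0 eq_sym.
have [s0 s00 Hs] := nt (D / 4) (e / 2) (divr_gt0 D0 (ltr0Sn _ 3)) (divr_gt0 e0 (ltr0Sn _ 1)).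
exists (Num.min (1 / 2) (s0 / D)); first by rewrite lt_min !divr_gt0.
move=> t; rewrite lt_min => /andP[t0 /andP[t2 ts]].
have cz : nrm (chord zeta1 zeta2 t - zeta1) = t * D.
  by rewrite /chord addrAC subrr add0r nrmM nrm_real gtr0_norm.
have c1 : nrm (chord zeta1 zeta2 t) < 1 by apply: chord_disk => //; lra.
have := Hs _ c1; rewrite cz -ler_pdivlMr// (ltW ts) => /(_ isT) H.
have {}H : nrm (psi (chord zeta1 zeta2 t) - p) <= e / 2.
  apply: H; have := nrm_chord_sqr n1 n2 t; rewrite -/D => E.
  have n0 := nrm_ge0 (chord zeta1 zeta2 t).
  move: (nrm _) E c1 n0 => x E x1 x0.
  have : 1 - x ^+ 2 <= 2 * (1 - x) by have /andP[] := one_sub_sqr x0 x1.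
  have -> : 1 - x ^+ 2 = t * (1 - t) * D ^+ 2 by rewrite E; ring.
  have : t * D ^+ 2 * (1 / 2) <= t * D ^+ 2 * (1 - t).
    by rewrite ler_wpM2l ?mulr_ge0 ?sqr_ge0 ?(ltW t0)//; lra.
  have -> : D / 4 * (t * D) = t * D ^+ 2 / 4 by field.
  lra.
lra.
Qed.

Section One_chord.
Variables (zeta1 zeta2 p1 p2 : C).
Hypothesis n1 : nrm zeta1 = 1.
Hypothesis n2 : nrm zeta2 = 1.
Hypothesis z12 : zeta1 != zeta2.

(** Nothing is known of the values of [psi] on the circle, so the end points are prescribed; they
    are to be its nontangential limits. *)
Definition chord_arc (t : R) : C :=
  if t == 0 then p1 else if t == 1 then p2 else psi (chord zeta1 zeta2 t).

Let gamma := chord_arc @` `[0, 1].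

Lemma chord_arc_in t : 0 < t < 1 -> chord_arc t = psi (chord zeta1 zeta2 t).
Proof. by move=> /andP[t0 t1]; rewrite /chord_arc gt_eqF// lt_eqF. Qed.

Lemma chord_arc0 : chord_arc 0 = p1.
Proof. by rewrite /chord_arc eqxx. Qed.

Lemma chord_arc1 : chord_arc 1 = p2.
Proof. by rewrite /chord_arc eqxx oner_eq0. Qed.

Lemma chord_arcP u : gamma u -> [\/ u = p1, u = p2 |
  exists2 t, 0 < t < 1 & u = psi (chord zeta1 zeta2 t)].
Proof.
move=> [t + <-]; rewrite /= in_itv/= => /andP[t0 t1].
have [->|tn0] := eqVneq t 0; first by constructor 1; rewrite chord_arc0.
have [->|tn1] := eqVneq t 1; first by constructor 2; rewrite chord_arc1.
have t01 : 0 < t < 1 by rewrite !lt_def tn0 t0 eq_sym tn1 t1.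
by constructor 3; exists t => //; rewrite chord_arc_in.
Qed.

Hypothesis bp1 : boundary G p1.
Hypothesis bp2 : boundary G p2.
Hypothesis p12 : p1 != p2.
Hypothesis nt1 : nontangential_limit psi zeta1 p1.
Hypothesis nt2 : nontangential_limit psi zeta2 p2.

Lemma chord_arc_path : path_in 0 1 chord_arc.
Proof.
move=> t /andP[t0 t1] e e0.
have [->|tn0] := eqVneq t 0.
  have [d d0 Hd] := chord_end n1 n2 z12 nt1 e0.
  have m0 : 0 < Num.min d 1 by rewrite lt_min d0 ltr01.
  exists (Num.min d 1) => // u /andP[u0 u1]; rewrite subr0 ger0_norm// lt_min => /andP[ud ul].
  rewrite chord_arc0; have [->|un0] := eqVneq u 0; first by rewrite chord_arc0 subrr nrm0.
  have u_gt : 0 < u by rewrite lt_def un0.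
  by rewrite chord_arc_in ?u_gt// Hd// u_gt.
have [->|tn1] := eqVneq t 1.
  have z21 : zeta2 != zeta1 by rewrite eq_sym.
  have [d d0 Hd] := chord_end n2 n1 z21 nt2 e0.
  have m0 : 0 < Num.min d 1 by rewrite lt_min d0 ltr01.
  exists (Num.min d 1) => // u /andP[u0 u1]; rewrite distrC ger0_norm ?subr_ge0// lt_min => /andP[ud ul].
  rewrite chord_arc1; have [->|un1] := eqVneq u 1; first by rewrite chord_arc1 subrr nrm0.
  have u_lt : u < 1 by rewrite lt_def eq_sym un1.
  by rewrite chord_arc_in; [rewrite chordC Hd// subr_gt0 u_lt|rewrite u_lt andbT; lra].
have t01 : 0 < t < 1 by rewrite !lt_def tn0 t0 eq_sym tn1 t1.
have [d d0 Hd] := psi_cont (chord_disk n1 n2 z12 t01) e0.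
set D := nrm (zeta2 - zeta1).
have D0 : 0 < D by rewrite nrm_gt0 subr_eq0 eq_sym.
case/andP: (t01) => t_gt t_lt.
exists (Num.min (d / D) (Num.min t (1 - t))).
  by rewrite !lt_min divr_gt0//= t_gt subr_gt0.
move=> u _; rewrite !lt_min !ltr_norml => /and3P[/andP[a1 a2] /andP[b1 b2] /andP[c1 c2]].
rewrite !chord_arc_in//; last by apply/andP; split; lra.
apply: Hd; have -> : chord zeta1 zeta2 u - chord zeta1 zeta2 t = (u - t)%:C * (zeta2 - zeta1).
  by rewrite /chord rmorphB; ring.
by rewrite nrmM nrm_real -/D -ltr_pdivlMr// ltr_norml a1.
Qed.

Lemma crosscut_chord : crosscut G gamma.
Proof.
have [_ nG1] := (boundaryE p1).1 bp1; have [_ nG2] := (boundaryE p2).1 bp2.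
have inG t : 0 < t < 1 -> G (psi (chord zeta1 zeta2 t)).
  by move=> t01; apply/psi_dom/chord_disk.
exists p1, p2; split => //.
- exists 0, 1, chord_arc; split => //.
  + apply/(within_continuousP _ _ (@metrizesR R) (@metrizesC R)) => t.
    rewrite /= in_itv/= => t01 e e0; have [d d0 Hd] := chord_arc_path t01 e0.
    by exists d => // u; rewrite in_itv/=; exact: Hd.
  + move=> t u; rewrite !inE/= !in_itv/= => /andP[t0 t1] /andP[u0 u1].
    have cases (v : R) : 0 <= v -> v <= 1 -> [\/ v = 0, v = 1 | 0 < v < 1].
      move=> v0 v1; have [->|vn0] := eqVneq v 0; first by constructor 1.
      have [->|vn1] := eqVneq v 1; first by constructor 2.
      by constructor 3; rewrite !lt_def vn0 v0 eq_sym vn1 v1.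
    case: (cases t t0 t1) => [->|->|t01]; case: (cases u u0 u1) => [->|->|u01] //;
      rewrite ?chord_arc0 ?chord_arc1 ?chord_arc_in// => E.
    * by move: p12; rewrite E eqxx.
    * by case: nG1; rewrite E; exact: inG.
    * by move: p12; rewrite E eqxx.
    * by case: nG2; rewrite E; exact: inG.
    * by case: nG1; rewrite -E; exact: inG.
    * by case: nG2; rewrite -E; exact: inG.
    * have : chord zeta1 zeta2 t = chord zeta1 zeta2 u.
        by rewrite -[LHS]phiK ?E ?phiK//; apply: chord_disk.
      rewrite /chord => /addrI /mulIf; rewrite subr_eq0 eq_sym => /(_ z12).
      exact: complexI.
  + by rewrite chord_arc0 chord_arc1.
- move=> u [/chord_arcP[->|->|[t t01 ->] _]]; last exact: inG.
  + by move=> H; exfalso; apply: H; left.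
  + by move=> H; exfalso; apply: H; right.
Qed.

Lemma side_lipschitz z w : `|side zeta1 zeta2 z - side zeta1 zeta2 w| <= nrm (midp zeta1 zeta2) * nrm (z - w).
Proof.
have -> : side zeta1 zeta2 z - side zeta1 zeta2 w = dotp (midp zeta1 zeta2) (z - w).
  by rewrite /side !dotpE; case: (midp _ _) z w => ? ? [? ?] [? ?] /=; ring.
rewrite /dotp (le_trans (Re_le_nrm _))// nrmM nrm_conj//.
Qed.

Lemma open_half (sg : R) : sg != 0 ->
  open (psi @` [set z | nrm z < 1 /\ 0 < sg * side zeta1 zeta2 z]).
Proof.
move=> sg0; apply/openP => _ [z [z1 zs] <-].
have [d d0 Hd] := (openP G).1 Gopen _ (psi_dom z1).
have k0 : 0 < `|sg| * nrm (midp zeta1 zeta2) + 1 by rewrite ltr_wpDl// mulr_ge0// nrm_ge0.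
have [d1 d10 H1] := phi_cont (psi_dom z1) (divr_gt0 zs k0).
exists (Num.min d d1); first by rewrite lt_min d0.
move=> u; rewrite lt_min => /andP[/Hd Gu /H1]; rewrite phiK// ltr_pdivlMr// => h.
exists (phi u); last exact: psiK.
split; first exact: phi_disk.
have := side_lipschitz (phi u) z.
set a := side _ _ (phi u); set b := side _ _ z => L.
have : `|sg * a - sg * b| <= `|sg| * (nrm (midp zeta1 zeta2) * nrm (phi u - z)).
  by rewrite -mulrBr normrM ler_wpM2l.
have : `|sg| * (nrm (midp zeta1 zeta2) * nrm (phi u - z)) <=
    nrm (phi u - z) * (`|sg| * nrm (midp zeta1 zeta2) + 1).
  have := nrm_ge0 (phi u - z); rewrite mulrDr mulr1; lra.
rewrite ler_norml => h1 /andP[h2 _]; rewrite -/a; rewrite -/b in h zs *; lra.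
Qed.

(** The cap is convex, so its image is connected. It is the whole component because the images of
    the two sides of the chord are disjoint open sets that cover G without the arc. *)
Lemma half_component z : midp zeta1 zeta2 != 0 -> nrm z < 1 -> 0 < side zeta1 zeta2 z ->
  is_component (G `\` gamma) (psi @` [set z | nrm z < 1 /\ 0 < side zeta1 zeta2 z]).
Proof.
move=> m0 z1 zs.
have [_ nG1] := (boundaryE p1).1 bp1; have [_ nG2] := (boundaryE p2).1 bp2.
pose U sg := psi @` [set z | nrm z < 1 /\ 0 < sg * side zeta1 zeta2 z].
have -> : psi @` [set z | nrm z < 1 /\ 0 < side zeta1 zeta2 z] = U 1.
  by congr (_ @` _); apply/seteqP; split=> w /=; rewrite mul1r.
have Usub sg : sg != 0 -> U sg `<=` G `\` gamma.
  move=> sg0 _ [w [w1 ws] <-]; split; first exact: psi_dom.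
  move=> /chord_arcP[E|E|[t t01 E]].
  - by apply: nG1; rewrite -E; exact: psi_dom.
  - by apply: nG2; rewrite -E; exact: psi_dom.
  - have wE : w = chord zeta1 zeta2 t.
      by rewrite -[LHS]phiK ?E ?phiK//; apply: chord_disk.
    by rewrite wE side_chord// mulr0 ltxx in ws.
have U1z : U 1 (psi z) by exists z; rewrite //= mul1r.
exists (psi z); first exact: (Usub 1 (oner_neq0 _) _ U1z).
apply/seteqP; split.
  apply: connected_component_max => //; first by apply: Usub; rewrite oner_eq0.
  apply: (@connected_star _ _ _ z); first by split; rewrite // mul1r.
    by move=> w [w1 _]; exact: psi_cont.
  move=> w t [w1 ws] t01; split; first exact: disk_segment.
  rewrite mul1r in ws; rewrite mul1r side_segment; case/andP: t01 => t0 t1.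
  have [->|tn0] := eqVneq t 0; first by rewrite !(subr0, mul1r, mul0r, addr0).
  apply: ltr_wpDl; first by apply: mulr_ge0; [lra|exact: ltW].
  by rewrite mulr_gt0// lt_def tn0.
apply: (@connected_two_open _ _ (U 1) (U (-1))).
- exact: component_connected.
- by apply: open_half; rewrite oner_eq0.
- by apply: open_half; rewrite oppr_eq0 oner_eq0.
- move=> u /connected_component_sub[Gu nu].
  have [s0|s0|s0] := ltgtP (side zeta1 zeta2 (phi u)) 0.
  + right; exists (phi u); last exact: psiK.
    by split; [exact: phi_disk|rewrite mulN1r oppr_gt0].
  + left; exists (phi u); last exact: psiK.
    by split; [exact: phi_disk|rewrite mul1r].
  + have [t t01 E] := side0_chord n1 n2 m0 z12 (phi_disk Gu) s0.
    exfalso; apply: nu; exists t.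
      by case/andP: t01 => t0 t1; rewrite /= in_itv/= !ltW.
    by rewrite chord_arc_in// -E psiK.
- rewrite -subset0 => _ [[w [w1 ws] <-] [v [v1 vs] E]].
  have wv : v = w by rewrite -[LHS]phiK ?E ?phiK.
  by rewrite wv in vs; rewrite mul1r mulN1r in ws vs; lra.
- exists (psi z); split => //; apply: connected_component_refl.
  exact: (Usub 1 (oner_neq0 _) _ U1z).
Qed.

End One_chord.
End Chord_crosscut.

Section Chord_around.
Variable R : realType.
Local Notation C := R[i].

(** The left-hand side is the scalar product of the vectors from 1 to the two points, so the point 1
    sees them under an obtuse angle. After squaring, y^2 = (1 - x) (1 + x) reduces this to (1 - x1)
    (1 - x2) < (1 + x1) (1 + x2). *)
Lemma thales_lt (x1 y1 x2 y2 : R) : x1 ^+ 2 + y1 ^+ 2 = 1 -> x2 ^+ 2 + y2 ^+ 2 = 1 ->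
  0 < x1 -> 0 < x2 -> 0 < y1 -> y2 < 0 -> (1 - x1) * (1 - x2) + y1 * y2 < 0.
Proof.
move=> E1 E2 x10 x20 y10 y20.
have x11 : x1 < 1 by have : 0 < y1 ^+ 2 by [rewrite exprn_gt0]; nra.
have x21 : x2 < 1.
  have : 0 < y2 ^+ 2 by rewrite lt_def sqr_ge0 andbT sqrf_eq0 lt_eqF.
  nra.
pose A := (1 - x1) * (1 - x2); have A0 : 0 < A by rewrite mulr_gt0// subr_gt0.
have N0 : 0 < - (y1 * y2) by rewrite oppr_gt0 pmulr_rlt0.
suff : A < - (y1 * y2) by rewrite -/A; lra.
rewrite -(@ltr_pXn2r _ 2) ?nnegrE ?ltW//.
have -> : (- (y1 * y2)) ^+ 2 = (1 - x1 ^+ 2) * (1 - x2 ^+ 2).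
  have -> : 1 - x1 ^+ 2 = y1 ^+ 2 by rewrite -E1; ring.
  have -> : 1 - x2 ^+ 2 = y2 ^+ 2 by rewrite -E2; ring.
  ring.
have -> : (1 - x1 ^+ 2) * (1 - x2 ^+ 2) = A * ((1 + x1) * (1 + x2)) by rewrite /A; ring.
rewrite expr2 ltr_pM2l// /A; nra.
Qed.

(** In coordinates that rotate a to 1, [side] at a is minus half the scalar product of zeta1 - a and
    zeta2 - a, the quantity in [thales_lt]. *)
Lemma side_rot (a zeta1 zeta2 : C) : nrm a = 1 -> nrm zeta1 = 1 -> nrm zeta2 = 1 ->
  2 * side zeta1 zeta2 a = - ((1 - complex.Re ((a^*)%C * zeta1)) * (1 - complex.Re ((a^*)%C * zeta2))
    + complex.Im ((a^*)%C * zeta1) * complex.Im ((a^*)%C * zeta2)).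
Proof.
move=> na n1 n2; have := nrm_sqr a; have := nrm_sqr zeta1; have := nrm_sqr zeta2.
rewrite na n1 n2 expr1n /side dotpE nrm_sqr /midp.
case: a zeta1 zeta2 {na n1 n2} => [a b] [p q] [r s] /= E2 E1 Ea.
have -> : 1 / 2 * (p + r) - 0 * (q + s) = (p + r) / 2 by field.
have -> : 1 / 2 * (q + s) + 0 * (p + r) = (q + s) / 2 by field.
have -> : 2 * ((p + r) / 2 * a + (q + s) / 2 * b - (((p + r) / 2) ^+ 2 + ((q + s) / 2) ^+ 2)) =
  (p + r) * a + (q + s) * b - ((p ^+ 2 + q ^+ 2) + (r ^+ 2 + s ^+ 2)) / 2 - (p * r + q * s) by field.
rewrite -E1 -E2.
have -> : - ((1 - (a * p - - b * q)) * (1 - (a * r - - b * s)) +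
    (a * q + - b * p) * (a * s + - b * r)) =
  (p + r) * a + (q + s) * b - 1 - (a ^+ 2 + b ^+ 2) * (p * r + q * s) by ring.
by rewrite -Ea mul1r; field.
Qed.

Variables (G : set C) (psi : C -> C).
Hypothesis Gopen : open G.
Hypothesis access : forall (zeta0 : C) (rho : R) (x1 x2 x3 : C),
  nrm zeta0 = 1 -> 0 < rho -> ~ G x1 -> ~ G x2 -> ~ G x3 ->
  exists zeta p, [/\ nrm zeta = 1, nrm (zeta - zeta0) < rho, ~ G p /\ closure G p,
    [/\ p != x1, p != x2 & p != x3] & nontangential_limit psi zeta p].

Lemma chord_around (a : C) (rho : R) (y1 y2 : C) : nrm a = 1 -> 0 < rho -> rho <= 1 / 4 ->
  ~ G y1 -> ~ G y2 -> exists zeta1 zeta2 q1 q2,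
  [/\ [/\ nrm zeta1 = 1, nrm zeta2 = 1, nrm (zeta1 - a) <= rho, nrm (zeta2 - a) <= rho &
          0 < side zeta1 zeta2 a],
      zeta1 != zeta2,
      [/\ boundary G q1, boundary G q2 & q1 != q2],
      nontangential_limit psi zeta1 q1 /\ nontangential_limit psi zeta2 q2 &
      [/\ q1 != y1, q1 != y2, q2 != y1 & q2 != y2]].
Proof.
move=> na rho0 rho4 nG1 nG2.
pose t := rho / 3; have t0 : 0 < t by rewrite divr_gt0.
have t1 : t < 1 by rewrite /t; lra.
have k0 : 0 < 1 + t ^+ 2 by rewrite ltr_pwDl// sqr_ge0.
(* A rational point of the circle at height at least t and at distance at most 2 t from 1.
   Perturbing c and its conjugate by t / 2 keeps them on opposite sides of 1 and, as rho = 3 t,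
   within rho. *)
pose c : C := ((1 - t ^+ 2) / (1 + t ^+ 2)) +i* (2 * t / (1 + t ^+ 2)).
have sq (x y : R) : 0 <= x -> 0 <= y -> x ^+ 2 <= y ^+ 2 -> x <= y.
  by move=> x0 y0; rewrite ler_pXn2r.
have nc : nrm c = 1.
  apply/eqP; rewrite -(@eqrXn2 _ 2) ?nrm_ge0// nrm_sqr expr1n/=; apply/eqP.
  by field; rewrite gt_eqF.
have c1 : nrm (c - 1) <= 2 * t.
  apply: sq; rewrite ?nrm_ge0//; first by lra.
  rewrite nrm_sqr /= subr0.
  have -> : ((1 - t ^+ 2) / (1 + t ^+ 2) - 1) ^+ 2 + (2 * t / (1 + t ^+ 2)) ^+ 2 =
    (2 * t) ^+ 2 / (1 + t ^+ 2) by field; rewrite gt_eqF.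
  by rewrite ler_pdivrMr// ler_peMr ?sqr_ge0// lerDl sqr_ge0.
have cIm : t <= 2 * t / (1 + t ^+ 2).
  rewrite ler_pdivlMr// mulrDr mulr1; have : t * t ^+ 2 <= t * 1.
    by rewrite ler_pM2l// expr_le1 ?ltW.
  lra.
have aa : (a^*)%C * a = 1.
  have := nrm_sqr a; rewrite na expr1n; case: (a) => x y /= E.
  by apply/eqP; rewrite eq_complex /=; apply/andP; split; apply/eqP; [rewrite E; ring|ring].
have t20 : 0 < t / 2 by rewrite divr_gt0.
have rot (c' zeta : C) : nrm c' = 1 -> nrm (c' - 1) <= 2 * t -> nrm (zeta - a * c') < t / 2 ->
  [/\ nrm (zeta - a) <= rho, 0 < complex.Re ((a^*)%C * zeta) &
      `|complex.Im ((a^*)%C * zeta) - complex.Im c'| < t / 2].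
  move=> nc' c'1 zc.
  have za : nrm (zeta - a) <= rho.
    have := nrm_tri (a * c') zeta a; have -> : a * c' - a = a * (c' - 1) by ring.
    rewrite nrmM na mul1r; rewrite /t in c'1 zc *; lra.
  split => //.
    have : nrm ((a^*)%C * zeta - 1) <= rho by rewrite -aa -mulrBr nrmM nrm_conj na mul1r.
    have := Re_le_nrm ((a^*)%C * zeta - 1); case: ((a^*)%C * zeta) => x y /=.
    rewrite ler_norml => /andP[h _]; lra.
  apply: le_lt_trans _ zc.
  have -> : zeta - a * c' = a * ((a^*)%C * zeta - c').
    by rewrite mulrBr mulrA (mulrC a (a^*)%C) aa mul1r.
  rewrite nrmM na mul1r; apply: le_trans (Im_le_nrm _).
  by case: (_ * zeta) (c') => ? ? [].
have nac (c' : C) : nrm c' = 1 -> nrm (a * c') = 1 by move=> n'; rewrite nrmM na n' mulr1.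
have [z1 [q1 [n1 z1c [nGq1 cq1] [q11 q12 _] nt1]]] := access (nac c nc) t20 nG1 nG2 nG2.
have ncb : nrm (c^*)%C = 1 by rewrite nrm_conj.
have c1b : nrm ((c^*)%C - 1) <= 2 * t.
  have -> : (c^*)%C - 1 = ((c - 1)^*)%C by rewrite rmorphB rmorph1.
  by rewrite nrm_conj.
(* The third value to avoid is now q1, which makes the two ends distinct. *)
have [z2 [q2 [n2 z2c [nGq2 cq2] [q21 q22 q23] nt2]]] := access (nac _ ncb) t20 nG1 nG2 nGq1.
have [r1 x1 i1] := rot c z1 nc c1 z1c; have [r2 x2 i2] := rot _ z2 ncb c1b z2c.
have y1p : 0 < complex.Im ((a^*)%C * z1).
  move: i1; rewrite ltr_norml => /andP[h _]; rewrite /= in h; lra.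
have y2n : complex.Im ((a^*)%C * z2) < 0.
  move: i2; rewrite ltr_norml => /andP[_ h]; rewrite /= in h; lra.
have nsq z : nrm z = 1 -> complex.Re ((a^*)%C * z) ^+ 2 + complex.Im ((a^*)%C * z) ^+ 2 = 1.
  by move=> nz; rewrite -nrm_sqr nrmM nrm_conj na nz mulr1 expr1n.
exists z1, z2, q1, q2; split => //.
- split => //; have := side_rot na n1 n2; have := thales_lt (nsq _ n1) (nsq _ n2) x1 x2 y1p y2n.
  lra.
- by apply: contraTneq y1p => ->; rewrite -leNgt ltW.
- by split; [exact/(boundaryE Gopen)|exact/(boundaryE Gopen)|rewrite eq_sym].
Qed.

End Chord_around.

(** * Multiple points and continuous extension *)

Section Clusters.
Variable R : realType.
Local Notation C := R[i].
Variables (G : set C) (phi psi : C -> C).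
Hypothesis Gopen : open G.
Hypothesis phi_disk : forall u, G u -> nrm (phi u) < 1.
Hypothesis phi_cont : forall u, G u -> ccont phi u.
Hypothesis psi_dom : forall z, nrm z < 1 -> G (psi z).
Hypothesis psi_cont : forall z, nrm z < 1 -> ccont psi z.
Hypothesis psiK : forall u, G u -> psi (phi u) = u.
Hypothesis phiK : forall z, nrm z < 1 -> phi (psi z) = z.

Definition cluster_value (l a : C) := forall d : R, 0 < d ->
  exists u, [/\ G u, nrm (u - l) < d & nrm (phi u - a) < d].

(** If |a| < 1, continuity of psi at a would give psi a = l, a point outside G. *)
Lemma cluster_value_circle l a : ~ G l -> cluster_value l a -> nrm a = 1.
Proof.
move=> nGl Ha.
have a1 : nrm a <= 1.
  apply/ler_addgt0Pr => e e0; have [u [Gu _ ua]] := Ha e e0.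
  have := nrm_lb a (phi u); rewrite nrmB; have := phi_disk Gu; lra.
apply/eqP; rewrite eq_le a1 /= leNgt; apply/negP => alt.
have : psi a = l.
  apply/eqP; rewrite -subr_eq0 -nrm_eq0 eq_le nrm_ge0 andbT; apply/ler_addgt0Pr => e e0.
  have e20 : 0 < e / 2 by rewrite divr_gt0.
  have [d d0 Hd] := psi_cont alt e20.
  have m0 : 0 < Num.min d (e / 2) by rewrite lt_min d0.
  have [u [Gu]] := Ha _ m0; rewrite !lt_min => /andP[_ ul] /andP[/Hd + _].
  rewrite psiK// nrmB; have := nrm_tri u (psi a) l; lra.
by move=> E; apply: nGl; rewrite -E; exact: psi_dom.
Qed.

(** The midpoint m is within rho of a, so 1 - |m|^2 <= 2 rho <= (D0 / 8)^2 and [side_near] puts the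
    cap within D0 / 8 of m. With D0 = |a - b|, the caps at a and b are disjoint. *)
Lemma cap_near (a zeta1 zeta2 z : C) (rho D0 : R) : nrm a = 1 -> nrm zeta1 = 1 -> nrm zeta2 = 1 ->
  nrm (zeta1 - a) <= rho -> nrm (zeta2 - a) <= rho -> 0 < D0 -> D0 <= 2 -> rho <= 1 / 4 ->
  rho <= D0 ^+ 2 / 128 -> nrm z < 1 -> 0 <= side zeta1 zeta2 z ->
  nrm (z - a) < D0 / 2 /\ midp zeta1 zeta2 != 0.
Proof.
move=> na n1 n2 z1a z2a D00 D02 rho4 rhoD z1 sz.
set m := midp zeta1 zeta2.
have ma : nrm (m - a) <= rho.
  have -> : m - a = (1 / 2)%:C * ((zeta1 - a) + (zeta2 - a)).
    by rewrite /m /midp; case: (a) (zeta1) (zeta2) => [? ?] [? ?] [? ?]; congr (_ +i* _); field.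
  rewrite nrmM nrm_real ger0_norm; last by lra.
  have := nrmD (zeta1 - a) (zeta2 - a); lra.
have m1 : 1 - rho <= nrm m by have := nrm_lb a m; rewrite (nrmB a); lra.
split; last by rewrite -/m -nrm_gt0; lra.
have := side_near (ltW z1) sz; rewrite -/m => zm.
have D2 : D0 ^+ 2 <= 2 * D0 by rewrite expr2 ler_wpM2r// ltW.
have zm2 : nrm (z - m) ^+ 2 <= (D0 / 8) ^+ 2.
  apply: (le_trans zm).
  have : (1 - rho) ^+ 2 <= nrm m ^+ 2 by rewrite lerXn2r ?nnegrE ?nrm_ge0//; lra.
  have := sqr_ge0 rho; have -> : (1 - rho) ^+ 2 = 1 - 2 * rho + rho ^+ 2 by ring.
  have -> : (D0 / 8) ^+ 2 = D0 ^+ 2 / 64 by field.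
  lra.
have {}zm2 : nrm (z - m) <= D0 / 8.
  by move: zm2; rewrite ler_pXn2r ?nnegrE ?nrm_ge0//; lra.
have := nrm_tri m z a; lra.
Qed.

Hypothesis access : forall (zeta0 : C) (rho : R) (x1 x2 x3 : C),
  nrm zeta0 = 1 -> 0 < rho -> ~ G x1 -> ~ G x2 -> ~ G x3 ->
  exists zeta p, [/\ nrm zeta = 1, nrm (zeta - zeta0) < rho, ~ G p /\ closure G p,
    [/\ p != x1, p != x2 & p != x3] & nontangential_limit psi zeta p].

Lemma two_clusters_multiple l a b : closure G l -> ~ G l -> cluster_value l a ->
  cluster_value l b -> a != b -> multiple_points G l.
Proof.
move=> cl nGl Ca Cb ab.
have na := cluster_value_circle nGl Ca; have nb := cluster_value_circle nGl Cb.
pose D0 := nrm (a - b).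
have D00 : 0 < D0 by rewrite nrm_gt0 subr_eq0.
have D02 : D0 <= 2 by have := nrm_sub a b; rewrite na nb /D0; lra.
pose rho := Num.min (1 / 4) (D0 ^+ 2 / 128).
have rho0 : 0 < rho by rewrite lt_min !divr_gt0// exprn_gt0.
have rho4 : rho <= 1 / 4 by rewrite ge_min lexx.
have rhoD : rho <= D0 ^+ 2 / 128 by rewrite ge_min lexx orbT.
have [z1 [z2 [q1 [q2 [[n1 n2 z1a z2a sa] z12 [bq1 bq2 q12] [nt1 nt2] _]]]]] :=
  chord_around Gopen access na rho0 rho4 nGl nGl.
have nGq1 := ((boundaryE Gopen q1).1 bq1).2; have nGq2 := ((boundaryE Gopen q2).1 bq2).2.
(* The second crosscut must avoid the end points of the first, for distinct points of the circle may
   have the same limit under psi. *)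
have [z3 [z4 [q3 [q4 [[n3 n4 z3b z4b sb] z34 [bq3 bq4 q34] [nt3 nt4] [q31 q32 q41 q42]]]]]] :=
  chord_around Gopen access nb rho0 rho4 nGq1 nGq2.
have nGq3 := ((boundaryE Gopen q3).1 bq3).2; have nGq4 := ((boundaryE Gopen q4).1 bq4).2.
have nearA z := @cap_near a z1 z2 z rho D0 na n1 n2 z1a z2a D00 D02 rho4 rhoD.
have nearB z := @cap_near b z3 z4 z rho D0 nb n3 n4 z3b z4b D00 D02 rho4 rhoD.
have apart z : nrm z < 1 -> 0 <= side z1 z2 z -> 0 <= side z3 z4 z -> False.
  move=> z_1 sA sB; have [hA _] := nearA z z_1 sA; have [hB _] := nearB z z_1 sB.
  have := nrm_tri z a b; rewrite (nrmB a z) -/D0; lra.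
split; first exact/boundaryE.
pose g1 := chord_arc psi z1 z2 q1 q2 @` `[0, 1].
pose g2 := chord_arc psi z3 z4 q3 q4 @` `[0, 1].
pose V1 := psi @` [set z | nrm z < 1 /\ 0 < side z1 z2 z].
pose V2 := psi @` [set z | nrm z < 1 /\ 0 < side z3 z4 z].
exists g1, g2, V1, V2.
(* The side of the chord containing c is a neighbourhood of c, so points u of G near l with phi u
   near c lie in the image of the cap. *)
have inV zeta1 zeta2 c : cluster_value l c -> 0 < side zeta1 zeta2 c ->
  boundary (psi @` [set z | nrm z < 1 /\ 0 < side zeta1 zeta2 z]) l /\
  exists2 z, nrm z < 1 & 0 < side zeta1 zeta2 z.
  move=> Cc sc.
  have k0 : 0 < nrm (midp zeta1 zeta2) + 1 by rewrite ltr_wpDl// nrm_ge0.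
  have near_c (d : R) : 0 < d -> exists u, [/\ G u, nrm (u - l) < d & 0 < side zeta1 zeta2 (phi u)].
    move=> d0; pose e := Num.min d (side zeta1 zeta2 c / (nrm (midp zeta1 zeta2) + 1)).
    have e0 : 0 < e by rewrite lt_min d0 divr_gt0.
    have [u [Gu]] := Cc e e0; rewrite !lt_min => /andP[ul _] /andP[_].
    rewrite ltr_pdivlMr// mulrDr mulr1 => uc; exists u; split => //.
    have := side_lipschitz zeta1 zeta2 (phi u) c; rewrite ler_norml => /andP[h _].
    have := nrm_ge0 (phi u - c); lra.
  split; last by have [u [Gu _ su]] := near_c 1 ltr01; exists (phi u) => //; exact: phi_disk.
  split.
    apply/closureP => d /near_c[u [Gu ul su]]; exists u => //.
    by exists (phi u); [split => //; exact: phi_disk|exact: psiK].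
  move=> /interior_subset[z [z_1 _] E]; apply: nGl; rewrite -E; exact: psi_dom.
have [bV1 [za za1 sza]] := inV z1 z2 a Ca sa; have [bV2 [zb zb1 szb]] := inV z3 z4 b Cb sb.
have [_ mA] := nearA za za1 (ltW sza); have [_ mB] := nearB zb zb1 (ltW szb).
split => //.
- split; first exact: (crosscut_chord Gopen psi_dom psi_cont phiK n1 n2 z12 bq1 bq2 q12 nt1 nt2).
  exact: (crosscut_chord Gopen psi_dom psi_cont phiK n3 n4 z34 bq3 bq4 q34 nt3 nt4).
- split.
    exact: (half_component Gopen phi_disk phi_cont psi_dom psi_cont psiK phiK n1 n2 z12 bq1 bq2 mA za1 sza).
  exact: (half_component Gopen phi_disk phi_cont psi_dom psi_cont psiK phiK n3 n4 z34 bq3 bq4 mB zb1 szb).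
- rewrite -subset0 => _ [[z [z_1 sA] <-] [w [w1 sB] E]].
  have wz : w = z by rewrite -[LHS]phiK ?E ?phiK.
  by rewrite wz in sB; apply: (apart z) => //; exact: ltW.
have B1 := path_bounded_closed (chord_arc_path psi_cont n1 n2 z12 nt1 nt2).
have B2 := path_bounded_closed (chord_arc_path psi_cont n3 n4 z34 nt3 nt4).
have inG zeta1 zeta2 t : nrm zeta1 = 1 -> nrm zeta2 = 1 -> zeta1 != zeta2 -> 0 < t < 1 ->
  G (psi (chord zeta1 zeta2 t)).
  by move=> *; apply/psi_dom/chord_disk.
(* End points differ by choice and lie outside G, unlike interior points; a common interior point
   would come from a point on both chords, which [apart] excludes. *)
have g12 : g1 `&` g2 = set0.
  rewrite -subset0 => u [/chord_arcP[->|->|[t t01 ->]] /chord_arcP[E|E|[s s01 E]]].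
  - by rewrite E eqxx in q31.
  - by rewrite E eqxx in q41.
  - by apply: nGq1; rewrite E; exact: inG.
  - by rewrite E eqxx in q32.
  - by rewrite E eqxx in q42.
  - by apply: nGq2; rewrite E; exact: inG.
  - by apply: nGq3; rewrite -E; exact: inG.
  - by apply: nGq4; rewrite -E; exact: inG.
  - have cc : chord z1 z2 t = chord z3 z4 s.
      by rewrite -[LHS]phiK ?E ?phiK//; apply: chord_disk.
    apply: (apart (chord z1 z2 t)); first exact: chord_disk.
      by rewrite side_chord.
    by rewrite cc side_chord.
have [d d0 Hd] := compact_closed_dist (bounded_closed_compact B1) B2.2 g12.
apply: (lt_le_trans d0); apply: lb_le_inf.
  exists (nrm (q1 - q3)); exists q1; last first.
    exists q3 => //; exists 0; first by rewrite /= in_itv/= lexx ler01.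
    by rewrite chord_arc0.
  exists 0; first by rewrite /= in_itv/= lexx ler01.
  by rewrite chord_arc0.
by move=> _ [u g1u [v g2v <-]]; exact: Hd.
Qed.

End Clusters.

Section Extension.
Variable R : realType.
Local Notation C := R[i].
Variables (G : set C) (phi psi : C -> C) (MG : R).
Hypothesis Gopen : open G.
Hypothesis MG0 : 0 < MG.
Hypothesis Gbounded : forall z, G z -> nrm z <= MG.
Hypothesis phi_disk : forall u, G u -> nrm (phi u) < 1.
Hypothesis phi_cont : forall u, G u -> ccont phi u.
Hypothesis psi_dom : forall z, nrm z < 1 -> G (psi z).
Hypothesis psi_cdiff : forall z, nrm z < 1 -> cdiff psi z.
Hypothesis psiK : forall u, G u -> psi (phi u) = u.
Hypothesis phiK : forall z, nrm z < 1 -> phi (psi z) = z.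

Let psi_cont z : nrm z < 1 -> ccont psi z.
Proof. by move=> /psi_cdiff/cdiff_cont. Qed.

Lemma nontangential_limit_unique zeta (x1 x2 : C) : nrm zeta = 1 ->
  nontangential_limit psi zeta x1 -> nontangential_limit psi zeta x2 -> x1 = x2.
Proof.
move=> zeta1 H1 H2; apply/eqP; rewrite -subr_eq0 -nrm_eq0 eq_le nrm_ge0 andbT.
apply/ler_addgt0Pr => e e0; rewrite add0r; have e20 : 0 < e / 2 by rewrite divr_gt0.
have [s1 s10 Hs1] := H1 1 _ ltr01 e20; have [s2 s20 Hs2] := H2 1 _ ltr01 e20.
pose s := Num.min 1 (Num.min s1 s2); have s0 : 0 < s by rewrite !lt_min ltr01 s10.
have sl1 : s <= 1 by rewrite ge_min lexx.
have ss1 : s <= s1 by rewrite !ge_min lexx !orbT.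
have ss2 : s <= s2 by rewrite !ge_min lexx !orbT.
pose z := (1 - s)%:C * zeta.
have nz : nrm z = 1 - s by rewrite nrmM nrm_real zeta1 mulr1 ger0_norm; lra.
have zz : nrm (z - zeta) = s.
  have -> : z - zeta = (- s)%:C * zeta by rewrite /z rmorphB rmorphN rmorph1; ring.
  by rewrite nrmM nrm_real normrN zeta1 mulr1 gtr0_norm.
have z1 : nrm z < 1 by lra.
have := Hs1 z z1; rewrite zz nz ss1 mul1r opprB subrKC lexx => /(_ isT isT).
have := Hs2 z z1; rewrite zz nz ss2 mul1r opprB subrKC lexx => /(_ isT isT).
have := nrm_tri (psi z) x1 x2; rewrite (nrmB x1 (psi z)); lra.
Qed.

Section Forward.
Variable F : C -> C.
Hypothesis Fcont : forall z, closure G z -> forall e : R, 0 < e ->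
  exists2 d : R, 0 < d & forall w, closure G w -> nrm (w - z) < d -> nrm (F w - F z) < e.
Hypothesis Fphi : forall z, G z -> F z = phi z.

Lemma F_circle l : closure G l -> ~ G l -> nrm (F l) = 1.
Proof.
move=> cl nGl; apply: (cluster_value_circle phi_disk psi_dom psi_cont psiK nGl).
move=> d d0; have [r r0 Hr] := Fcont cl d0.
have m0 : 0 < Num.min d r by rewrite lt_min d0.
have [u Gu] := (closureP G l).1 cl _ m0; rewrite lt_min => /andP[ud ur].
exists u; split; [exact: Gu|exact: ud|].
by rewrite -(Fphi Gu); apply: (Hr u _ ur); exact: subset_closure.
Qed.

Lemma crosscut_sub_closure gamma : crosscut G gamma -> gamma `<=` closure G.
Proof.
move=> [p [q [_ gG [cp _] [cq _]]]] u gu.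
have [->//|up] := eqVneq u p; have [->//|uq] := eqVneq u q.
apply/subset_closure/gG; split => //= -[E|E].
  by rewrite E eqxx in up.
by rewrite E eqxx in uq.
Qed.

(** As |F x| = 1, x is outside G and hence an end of gamma. The half of gamma from its middle
    parameter to x lies in G before x, continuity of F makes its image under phi end at zeta, and
    Lindelof's theorem applies. *)
Lemma crosscut_end_limit gamma x zeta : crosscut G gamma -> gamma x -> nrm zeta = 1 ->
  F x = zeta -> nontangential_limit psi zeta x.
Proof.
move=> cg gx zeta1 Fx.
have cx := crosscut_sub_closure cg gx.
have nGx : ~ G x.
  by move=> Gx; have := phi_disk Gx; rewrite -Fphi// Fx zeta1 ltxx.
have [p [q [[a [b [f [ab cf fi gE [fa fb]]]]] gG bp bq]]] := cg.
have [e [eab fe]] : exists e, (e = a \/ e = b) /\ f e = x.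
  have [xp|xp] := eqVneq x p; first by exists a; split; [left|rewrite xp].
  have [xq|xq] := eqVneq x q; first by exists b; split; [right|rewrite xq].
  exfalso; apply: nGx; apply: gG; split => //= -[E|E].
    by rewrite E eqxx in xp.
  by rewrite E eqxx in xq.
pose mid := (a + b) / 2.
pose s t := mid + t * (e - mid).
have sab t : 0 <= t < 1 -> a < s t < b.
  by move=> /andP[t0 t1]; rewrite /s /mid; case: eab => ->; apply/andP; split; nra.
have fG v : a < v < b -> G (f v).
  move=> /andP[av vb]; apply: gG.
  have vab : v \in `[a, b] by rewrite in_itv/= !ltW.
  have aab : a \in `[a, b] by rewrite in_itv/= lexx ltW.
  have bab : b \in `[a, b] by rewrite in_itv/= lexx andbT ltW.
  split; first by rewrite gE; exists v.
  move=> /= [E|E].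
    have : v = a by apply: fi; rewrite ?inE// E fa.
    by move=> va; rewrite va ltxx in av.
  have : v = b by apply: fi; rewrite ?inE// E fb.
  by move=> vb'; rewrite vb' ltxx in vb.
have fc : path_in a b f.
  move=> v vab r r0; have := (within_continuousP `[a, b]%classic f (@metrizesR R) (@metrizesC R)).1 cf v.
  by rewrite /= in_itv/= => /(_ vab r r0)[d d0 Hd]; exists d => // u uab; apply: Hd; rewrite in_itv.
have em : 0 < `|e - mid| by rewrite normr_gt0 /mid; case: eab => ->; rewrite subr_eq0; apply/eqP; lra.
pose c t := f (s t).
have cG t : 0 <= t < 1 -> G (c t) by move=> /sab/fG.
have cc t : 0 <= t < 1 -> forall r : R, 0 < r -> exists2 d : R, 0 < d &
    forall u, 0 <= u < 1 -> `|u - t| < d -> nrm (c u - c t) < r.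
  move=> /sab/andP[h1 h2] r r0; have [|d d0 Hd] := fc (s t) _ r r0; first by rewrite !ltW.
  exists (d / `|e - mid|); first by rewrite divr_gt0.
  move=> u /sab/andP[g1 g2]; rewrite ltr_pdivlMr// -normrM => ut; apply: Hd; first by rewrite !ltW.
  by have -> : s u - s t = (u - t) * (e - mid) by rewrite /s; ring.
have cl : lim1 c x.
  move=> r r0; have [|d d0 Hd] := fc e _ r r0.
    by case: eab => ->; rewrite lexx ltW// ltW.
  pose t0 := Num.max 0 (1 - d / `|e - mid| / 2).
  have q0 : 0 < d / `|e - mid| by rewrite divr_gt0.
  exists t0; first by rewrite le_max lexx gt_max ltr01 /=; lra.
  move=> t /andP[tt t1]; rewrite -fe; apply: Hd.
    have /sab/andP[h1 h2] : 0 <= t < 1 by rewrite t1 andbT (le_trans _ tt)// le_max lexx.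
    by rewrite !ltW.
  have -> : s t - e = (t - 1) * (e - mid) by rewrite /s; ring.
  rewrite normrM -ltr_pdivlMr// ler0_norm; last by lra.
  have : 1 - d / `|e - mid| / 2 <= t by rewrite (le_trans _ tt)// le_max lexx orbT.
  lra.
have [sc s1 sp] := end_curve phi_disk phi_cont psi_dom psi_cdiff psiK nGx cG cc cl.
apply: (lindelof MG0 (psi_bound Gbounded psi_dom psi_cdiff) zeta1 sc _ sp).
move=> r r0; have [d d0 Hd] := Fcont cx r0; have [t0 t01 Ht0] := cl d d0.
exists t0 => // t tt; have /andP[tt0 tt1] := tt; rewrite /= -Fphi; last first.
  by apply: cG; rewrite tt1 andbT (le_trans _ tt0)//; case/andP: t01.
rewrite -Fx; apply: Hd; last exact: (Ht0 t tt).
apply/subset_closure/cG; rewrite tt1 andbT (le_trans _ tt0)//; by case/andP: t01.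
Qed.

Lemma component_near gamma V l : crosscut G gamma -> is_component (G `\` gamma) V ->
  closure G l -> closure V l -> (forall x, gamma x -> F x <> F l) ->
  exists2 d : R, 0 < d & forall v, G v -> nrm (v - l) < d -> V v.
Proof.
move=> cg [x0 Gx0 VE] clG clV Fg.
have VG : V `<=` G `\` gamma by rewrite VE; exact: connected_component_sub.
have [p [q [[a [b [f [ab cf fi gE _]]]] _ _ _]]] := cg.
have cK : compact gamma.
  by rewrite gE; apply: continuous_compact => //; exact: segment_compact.
have [rho rho0 Hrho] : exists2 rho : R, 0 < rho & forall x, gamma x -> rho <= nrm (F x - F l).
  have [->|/set0P g0] := eqVneq gamma set0; first by exists 1.
  have [|c gc Hc] := @compact_min _ gamma (fun x => nrm (F x - F l)) cK g0.
    move=> z gz e e0; have [d d0 Hd] := Fcont (crosscut_sub_closure cg gz) e0.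
    exists d => // w gw wz; apply: le_lt_trans (nrm_dist _ _) _.
    have -> : F w - F l - (F z - F l) = F w - F z by ring.
    exact: (Hd w (crosscut_sub_closure cg gw) wz).
  exists (nrm (F c - F l)) => //.
  by rewrite nrm_gt0 subr_eq0; apply/eqP/Fg.
pose N := [set z : C | nrm z < 1 /\ nrm (z - F l) < rho].
have [d d0 Hd] := Fcont clG rho0.
have inN v : G v -> nrm (v - l) < d -> N (phi v).
  move=> Gv vl; split; first exact: phi_disk.
  by rewrite -(Fphi Gv); apply: (Hd v _ vl); exact: subset_closure.
exists d => // v Gv vl.
have [v0 Vv0 v0l] := (closureP V l).1 clV d d0.
have [Gv0 _] := VG v0 Vv0.
have cN : connected (psi @` N).
  apply: (@connected_star _ _ _ (phi v0)); first exact: inN.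
    by move=> z [z1 _]; exact: psi_cont.
  move=> z t [z1 zl] t01; have [w1 wl] := inN v0 Gv0 v0l.
  by split; [exact: disk_segment|exact: ball_segment].
have NG : psi @` N `<=` G `\` gamma.
  move=> _ [z [z1 zl] <-]; split; first exact: psi_dom.
  by move=> /Hrho; rewrite Fphi; [rewrite phiK// leNgt zl|exact: psi_dom].
have : connected_component (G `\` gamma) v0 v.
  have vN w : G w -> nrm (w - l) < d -> (psi @` N) w.
    by move=> Gw wl; exists (phi w); [exact: inN|exact: psiK].
  exact: (connected_component_max (vN v0 Gv0 v0l) NG cN (vN v Gv vl)).
by rewrite VE in Vv0 *; rewrite -(same_connected_component Vv0).
Qed.

Lemma dist_le (A B : set C) x y : A x -> B y -> dist A B <= nrm (x - y).
Proof.
move=> Ax By; apply: ge_inf; last by exists x => //; exists y.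
by exists 0 => _ [u _ [v _ <-]]; exact: nrm_ge0.
Qed.

Lemma extension_no_multiple : multiple_points G = set0.
Proof.
rewrite -subset0 => l [bl [g1 [g2 [V1 [V2 [[c1 c2] [k1 k2] V12 [[cl1 _] [cl2 _]] d12]]]]]].
have [clG nGl] := (boundaryE Gopen l).1 bl.
have F1 := F_circle clG nGl.
have sub g V : is_component (G `\` g) V -> V `<=` G.
  by move=> [x _ ->] u /connected_component_sub[].
have [[x1 g1x F1x]|n1] := pselect (exists2 x, g1 x & F x = F l); last first.
  have [|d d0 Hd] := component_near c1 k1 clG cl1; first by move=> x gx E; apply: n1; exists x.
  have [v Vv vl] := (closureP V2 l).1 cl2 d d0.
  have : (V1 `&` V2) v by split => //; apply: Hd => //; exact: (sub _ _ k2).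
  by rewrite V12.
have [[x2 g2x F2x]|n2] := pselect (exists2 x, g2 x & F x = F l); last first.
  have [|d d0 Hd] := component_near c2 k2 clG cl2; first by move=> x gx E; apply: n2; exists x.
  have [v Vv vl] := (closureP V1 l).1 cl1 d d0.
  have : (V1 `&` V2) v by split => //; apply: Hd => //; exact: (sub _ _ k1).
  by rewrite V12.
have E : x1 = x2.
  apply: (nontangential_limit_unique F1).
    exact: (crosscut_end_limit c1).
  exact: (crosscut_end_limit c2).
have := dist_le g1x g2x; rewrite E subrr nrm0 leNgt d12; by [].
Qed.

End Forward.

Hypothesis no_multiple : multiple_points G = set0.

(** Compactness gives one cluster value a. If phi does not tend to a, the points u near l with phi u
    at distance at least e from a have a cluster value of their own, different from a, so l is
    multiple. *)
Lemma limit_exists l : closure G l -> ~ G l -> exists L : C, forall e : R, 0 < e ->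
  exists2 d : R, 0 < d & forall u, G u -> nrm (u - l) < d -> nrm (phi u - L) < e.
Proof.
move=> cl nGl.
have Gop := (openP G).1 Gopen.
have cD := bounded_closed_compact (bounded_closed_ball (0 : C) 1).
have inD u : G u -> nrm (phi u - 0) <= 1 by move=> Gu; rewrite subr0 ltW// phi_disk.
pose P (d : R) (x : C) := exists u, [/\ G u, nrm (u - l) < d & x = phi u].
have [||a _ Ha] := @compact_cluster R _ P cD.
- by move=> d e x _ de [u [Gu ul ->]]; exists u; split => //; exact: lt_le_trans de.
- move=> d /((closureP G l).1 cl)[u Gu ul]; exists (phi u); first exact: inD.
  by exists u.
exists a => e e0; apply: contrapT => nex.
pose P' (d : R) (x : C) := exists u, [/\ G u, nrm (u - l) < d, x = phi u & e <= nrm (x - a)].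
have [||b _ Hb] := @compact_cluster R _ P' cD.
- by move=> d r x _ de [u [Gu ul -> h]]; exists u; split => //; exact: lt_le_trans de.
- move=> d d0; apply: contrapT => nb; apply: nex; exists d => // u Gu ul.
  rewrite ltNge; apply/negP => h; apply: nb; exists (phi u); first exact: inD.
  by exists u.
have Ca : cluster_value G phi l a.
  by move=> d d0; have [_ [_ [u [Gu ul ->]] xa]] := Ha d d0; exists u.
have Cb : cluster_value G phi l b.
  by move=> d d0; have [_ [_ [u [Gu ul -> _]] xb]] := Hb d d0; exists u.
suff : multiple_points G l by rewrite no_multiple.
apply: (@two_clusters_multiple _ G phi psi Gopen phi_disk phi_cont psi_dom psi_cont psiK phiK _ l a b) => //.
  exact: (accessible_avoiding Gop MG0 Gbounded phi_disk phi_cont psi_dom psi_cdiff psiK phiK).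
apply/eqP => ab; have [_ [_ [u [_ _ -> eu]] xb]] := Hb e e0.
by move: eu; rewrite ab leNgt xb.
Qed.

Lemma no_multiple_extension : extends_continuously G phi.
Proof.
have /choice[L HL] (l : C) : exists L : C, closure G l -> ~ G l -> forall e : R, 0 < e ->
    exists2 d : R, 0 < d & forall u, G u -> nrm (u - l) < d -> nrm (phi u - L) < e.
  have [[cl nGl]|n] := pselect (closure G l /\ ~ G l).
    by have [L HL] := limit_exists cl nGl; exists L.
  by exists 0 => cl nGl; exfalso; apply: n.
pose F z := if pselect (G z) then phi z else L z.
have FG z : G z -> F z = phi z by rewrite /F; case: pselect.
(* F is everywhere the limit of phi along G; continuity on the closure follows by comparing F w with
   phi at a point of G near w. *)
have HF z : closure G z -> forall e : R, 0 < e ->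
    exists2 d : R, 0 < d & forall u, G u -> nrm (u - z) < d -> nrm (phi u - F z) < e.
  move=> cz e e0; have [Gz|nGz] := pselect (G z).
    by have [d d0 Hd] := phi_cont Gz e0; exists d => // u _ uz; rewrite FG// Hd.
  have -> : F z = L z by rewrite /F; case: pselect.
  exact: HL.
exists F; split => //.
apply/(within_continuousP _ _ (@metrizesC R) (@metrizesC R)) => z cz e e0.
have e20 : 0 < e / 2 by rewrite divr_gt0.
have [d d0 Hd] := HF z cz _ e20.
exists (d / 2); first by rewrite divr_gt0.
move=> w cw wz; have [r r0 Hr] := HF w cw _ e20.
have m0 : 0 < Num.min r (d / 2) by rewrite lt_min r0 divr_gt0.
have [u Gu] := (closureP G w).1 cw _ m0; rewrite lt_min => /andP[ur ud].
have h1 := Hr u Gu ur.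
have h2 : nrm (phi u - F z) < e / 2.
  by apply: Hd => //; have := nrm_tri w u z; lra.
have := nrm_tri (phi u) (F w) (F z); rewrite (nrmB (F w) (phi u)); lra.
Qed.

End Extension.

Theorem theorem1 (R : realType) (G : set R[i]) (phi : R[i] -> R[i])
    (bndG : bounded_set G) (scG : simply_connected_domain G)
    (phiG : riemann_map G phi) :
  extends_continuously G phi <-> multiple_points G = set0.
Proof.
have [Gopen _ _] := scG; have [anphi [phifun phiinj phisurj]] := phiG.
have Gop := (openP G).1 Gopen.
have [M0 HM0] := (bounded_setP G).1 bndG.
pose MG := `|M0| + 1; have MG0 : 0 < MG by rewrite ltr_wpDl.
have Gb z : G z -> nrm z <= MG.
  by move=> /HM0 h; rewrite (le_trans h)// (le_trans (ler_norm _))// lerDl.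
have dphi z : G z -> cdiff phi z by move=> /anphi; exact: derivable_cdiff.
have iphi z w : G z -> G w -> phi z = phi w -> z = w.
  by move=> Gz Gw; apply: phiinj; rewrite inE.
have phi_disk u : G u -> nrm (phi u) < 1.
  by move=> /phifun; rewrite /unit_disk /= nrmC ltcR.
have phi_cont u : G u -> ccont phi u by move=> /dphi/cdiff_cont.
have /choice[psi Hpsi] (z : R[i]) : exists u, nrm z < 1 -> G u /\ phi u = z.
  have [z1|_] := ltP (nrm z) 1; last by exists 0.
  have [|u Gu uz] := phisurj z; last by exists u.
  by rewrite /unit_disk /= nrmC ltcR.
have psi_dom z : nrm z < 1 -> G (psi z) by move=> /Hpsi[].
have phiK z : nrm z < 1 -> phi (psi z) = z by move=> /Hpsi[].
have psiK u : G u -> psi (phi u) = u.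
  move=> Gu; have u1 := phi_disk u Gu.
  by apply: iphi => //; [exact: psi_dom|exact: phiK].
have psi_cdiff z : nrm z < 1 -> cdiff psi z.
  move=> z1; rewrite -(phiK z z1).
  exact: (inverse_cdiff dphi iphi Gop (psi_dom z z1) psiK).
split.
  move=> [F [cF FG]].
  apply: (extension_no_multiple Gopen MG0 Gb phi_disk phi_cont psi_dom psi_cdiff psiK phiK _ FG).
  move=> z cz e e0.
  exact: ((within_continuousP _ _ (@metrizesC R) (@metrizesC R)).1 cF z cz e e0).
exact: (no_multiple_extension Gopen MG0 Gb phi_disk phi_cont psi_dom psi_cdiff psiK phiK).
Qed.
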